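(* Let $\underline{t},\underline{s}\in\mathbb{R}^m$ with $|\underline{t}|=|\underline{s}|=1$, $\underline{t}\perp\underline{s}$, and let $\underline{\tau}=\underline{t}+i\underline{s}$. Let $f\in\mathscr{MB}(\mathbb{R}^m)$. Then the Bargmann-Radon transform $\mathcal{R}_{\underline{\tau}}[f]$ is a monogenic function, and for all $\underline{u}\in\mathbb{R}^m$ $$\mathcal{R}_{\underline{\tau}}[f](\underline{u})=\frac{\underline{\tau}\,\underline{\tau}^\dagger}{4}\,f\left(-\frac12\,\underline{\tau}^\dagger\,\langle\underline{u},\underline{\tau}\rangle\right),$$ where on the right-hand side $f$ denotes the holomorphic extension of $f$ to $\mathbb{C}^m$.
   Context: Let $m\ge 2$. $\mathbb{C}_m$ is the complex Clifford algebra with generators $\underline{e}_1,\dots,\underline{e}_m$, $\underline{e}_i\underline{e}_j+\underline{e}_j\underline{e}_i=-2\delta_{ij}$. A vector $z=(z_1,\dots,z_m)\in\mathbb{C}^m$ (in particular in $\mathbb{R}^m$) is identified with $\underline{z}=\sum_j z_j\underline{e}_j\in\mathbb{C}_m$; $\langle\underline{z},\underline{w}\rangle=\sum_j z_jw_j$ is complex bilinear, and $|\underline{x}|$ is the Euclidean norm for $\underline{x}\in\mathbb{R}^m$. The Hermitian conjugation $\dagger$ on $\mathbb{C}_m$ is the conjugate-linear anti-automorphism ($(\lambda\mu)^\dagger=\mu^\dagger\lambda^\dagger$) with $\underline{e}_j^\dagger=-\underline{e}_j$; thus for $\underline{\tau}=\underline{t}+i\underline{s}$ one has $\underline{\tau}^\dagger=-\underline{t}+i\underline{s}$.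 A continuously differentiable $f:\Omega\to\mathbb{C}_m$, $\Omega\subseteq\mathbb{R}^m$ open, is (left) monogenic if $\partial_{\underline{x}}f=\sum_{j=1}^m\underline{e}_j\partial_{x_j}f=0$. Every monogenic function on $\mathbb{R}^m$ extends uniquely to an entire holomorphic function $\mathbb{C}^m\to\mathbb{C}_m$, denoted by the same letter. $\mathscr{MB}(\mathbb{R}^m)$ (monogenic Bargmann module) is the right $\mathbb{C}_m$-module of monogenic $f:\mathbb{R}^m\to\mathbb{C}_m$ with $f(\underline{x})e^{-|\underline{x}|^2/4}\in L^2(\mathbb{R}^m)$, with $\mathbb{C}_m$-valued inner product $$\langle f,g\rangle=\frac{1}{(2\pi)^{m/2}}\int_{\mathbb{R}^m}e^{-|\underline{x}|^2/2}f^\dagger(\underline{x})g(\underline{x})\,d\underline{x};$$ the norm squared of $f$ is the scalar part of $\langle f,f\rangle$. For $\underline{\tau}=\underline{t}+i\underline{s}$ with $\underline{t},\underline{s}$ orthonormal in $\mathbb{R}^m$, $\mathscr{MB}(\underline{\tau})$ is the closure in $\mathscr{MB}(\mathbb{R}^m)$ of the right $\mathbb{C}_m$-module of all finite linear combinations $\sum_\ell\langle\underline{x},\underline{\tau}\rangle^\ell\,\underline{\tau}\,a_\ell$, $a_\ell\in\mathbb{C}_m$. The Bargmann-Radon transform $\mathcal{R}_{\underline{\tau}}[f]$ of $f\in\mathscr{MB}(\mathbb{R}^m)$ is the orthogonal projection of $f$ onto $\mathscr{MB}(\underline{\tau})$. *)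

(* Defs.v *)
From HB Require Import structures.
From mathcomp Require Import all_boot all_order all_algebra.
From mathcomp Require Import complex ring.
Set Implicit Arguments.
Unset Strict Implicit.
Unset Printing Implicit Defensive.
Import Order.TTheory GRing.Theory Num.Theory.
Local Open Scope ring_scope.

Section Blades.
Context {m : nat}.
Implicit Types A B C : {set 'I_m}.

Definition symdiff A B : {set 'I_m} := [set i | (i \in A) (+) (i \in B)].

(* For increasing products of generators, e_A e_B = (-1)^(inversions A B) e_(A symdiff B):
   a pair (a, b) costs a sign when e_a moves past e_b (b < a) and when e_a e_a = -1
   is used (b = a). *)
Definition inversions A B : nat := \sum_(a in A) \sum_(b in B) (b <= a)%N.

Lemma symdiffA : associative symdiff.
Proof. by move=> A B C; apply/setP=> i; rewrite !inE addbA. Qed.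
Lemma symdiffC : commutative symdiff.
Proof. by move=> A B; apply/setP=> i; rewrite !inE addbC. Qed.
Lemma symdiffK A : involutive (symdiff A).
Proof. by move=> B; apply/setP=> i; rewrite !inE addKb. Qed.
Lemma symdiff0 A : symdiff A set0 = A.
Proof. by apply/setP=> i; rewrite !inE addbF. Qed.
Lemma symdiffv A : symdiff A A = set0.
Proof. by apply/setP=> i; rewrite !inE addbb. Qed.
Lemma symdiff_eq A B C : (symdiff A B == C) = (B == symdiff A C).
Proof. by apply/eqP/eqP => [<-|->]; rewrite symdiffK. Qed.

Lemma odd_sum_symdiff A B (F : 'I_m -> nat) :
  odd (\sum_(i in symdiff A B) F i) =
  odd (\sum_(i in A) F i) (+) odd (\sum_(i in B) F i).
Proof.
rewrite (big_mkcond (mem (symdiff A B))) (big_mkcond (mem A)) (big_mkcond (mem B)) /=.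
rewrite !(big_morph odd oddD (erefl : odd 0 = false)) -big_split /=.
by apply: eq_bigr => i _; rewrite inE; case: (i \in A); case: (i \in B) => //=;
  rewrite ?addbb ?addbF.
Qed.

Lemma odd_inversionsDl A B C :
  odd (inversions (symdiff A B) C) = odd (inversions A C) (+) odd (inversions B C).
Proof. exact: odd_sum_symdiff. Qed.

Lemma odd_inversionsDr A B C :
  odd (inversions A (symdiff B C)) = odd (inversions A B) (+) odd (inversions A C).
Proof.
rewrite /inversions exchange_big [X in odd X (+) _]exchange_big.
rewrite [X in _ (+) odd X]exchange_big /=.
exact: odd_sum_symdiff.
Qed.

Lemma inversions0l A : inversions set0 A = 0%N.
Proof. by rewrite /inversions big_set0. Qed.
Lemma inversions0r A : inversions A set0 = 0%N.
Proof. by rewrite /inversions big1 // => i _; rewrite big_set0. Qed.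
End Blades.

(* x A is the coefficient of e_A = e_(i1) ... e_(ik), where A = {i1 < ... < ik} *)
Definition clifford (R : rcfType) (m : nat) := {ffun {set 'I_m} -> R[i]}.

Section Clifford.
Context {R : rcfType} {m : nat}.
Notation Cl := (clifford R m).
Implicit Types x y z : Cl.

HB.instance Definition _ := GRing.Lmodule.on Cl.

Definition blade (A : {set 'I_m}) : Cl := [ffun B => (B == A)%:R].

Definition clifford_one : Cl := blade set0.

Definition clifford_mul x y : Cl :=
  [ffun C => \sum_A \sum_(B | symdiff A B == C) (-1) ^+ inversions A B * (x A * y B)].

Lemma clifford_mulE x y C :
  clifford_mul x y C = \sum_A (-1) ^+ inversions A (symdiff A C) * (x A * y (symdiff A C)).
Proof.
rewrite ffunE; apply: eq_bigr => A _.
by rewrite (eq_bigl (pred1 (symdiff A C))) ?big_pred1_eq // => B /=; rewrite symdiff_eq.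
Qed.

Lemma clifford_mulA : associative clifford_mul.
Proof.
move=> x y z; apply/ffunP=> D; rewrite !clifford_mulE.
under [RHS]eq_bigr => E _ do rewrite clifford_mulE mulr_suml mulr_sumr.
rewrite [RHS]exchange_big /=; apply: eq_bigr => A _.
rewrite clifford_mulE 2!mulr_sumr.
rewrite [RHS](reindex_inj (can_inj (symdiffK A))) /=; apply: eq_bigr => B _.
rewrite symdiffK; set C := symdiff (symdiff A B) D.
have -> : symdiff B (symdiff A D) = C by rewrite /C symdiffA (symdiffC B).
have -> : symdiff A D = symdiff B C by rewrite /C (symdiffC A B) -symdiffA symdiffK.
have sgE : (-1) ^+ inversions A (symdiff B C) * (-1) ^+ inversions B C =
    (-1) ^+ inversions A B * (-1) ^+ inversions (symdiff A B) C :> R[i].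
  rewrite -!exprD -[LHS]signr_odd -[RHS]signr_odd !oddD.
  by rewrite odd_inversionsDr odd_inversionsDl addbA.
move: sgE.
move: ((-1) ^+ _ : R[i]) ((-1) ^+ inversions B C : R[i]) => s1 s2.
move: ((-1) ^+ _ : R[i]) ((-1) ^+ inversions A B : R[i]) => s3 s4.
move: (x A) (y B) (z C) => a b c sE.
have -> : s1 * (a * (s2 * (b * c))) = (s1 * s2) * (a * (b * c)) by ring.
by rewrite sE; ring.
Qed.

Lemma clifford_mul1 : left_id clifford_one clifford_mul.
Proof.
move=> x; apply/ffunP=> C; rewrite clifford_mulE (bigD1 set0) //= big1 ?addr0.
  by rewrite inversions0l ffunE eqxx symdiffC symdiff0 !mul1r.
by move=> A /negPf A0; rewrite ffunE A0 mul0r mulr0.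
Qed.

Lemma clifford_mulr1 : right_id clifford_one clifford_mul.
Proof.
move=> x; apply/ffunP=> C; rewrite clifford_mulE (bigD1 C) //= big1 ?addr0.
  rewrite symdiffv inversions0r ffunE eqxx mulr1.
  by rewrite mul1r.
move=> A nAC; rewrite ffunE symdiff_eq symdiff0 eq_sym (negPf nAC) !mulr0 //.
Qed.

Lemma clifford_mulDl : left_distributive clifford_mul +%R.
Proof.
move=> x y z; apply/ffunP=> C; rewrite [RHS]ffunE !clifford_mulE -big_split /=.
by apply: eq_bigr => A _; rewrite ffunE mulrDl mulrDr.
Qed.

Lemma clifford_mulDr : right_distributive clifford_mul +%R.
Proof.
move=> x y z; apply/ffunP=> C; rewrite [RHS]ffunE !clifford_mulE -big_split /=.
by apply: eq_bigr => A _; rewrite ffunE !mulrDr.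
Qed.

Lemma clifford_one_neq0 : clifford_one != 0.
Proof.
apply/eqP=> /ffunP /(_ set0); rewrite !ffunE eqxx => /eqP.
by rewrite oner_eq0.
Qed.

HB.instance Definition _ := GRing.Zmodule_isNzRing.Build Cl
  clifford_mulA clifford_mul1 clifford_mulr1 clifford_mulDl clifford_mulDr
  clifford_one_neq0.

Lemma clifford_mulrE x y C :
  (x * y) C = \sum_A (-1) ^+ inversions A (symdiff A C) * (x A * y (symdiff A C)).
Proof. exact: clifford_mulE. Qed.

Lemma clifford_scalerAl (k : R[i]) x y : k *: (x * y) = (k *: x) * y.
Proof.
apply/ffunP=> C; rewrite [LHS]ffunE !clifford_mulrE -[_ *: _]/(_ * _) mulr_sumr.
apply: eq_bigr => A _; rewrite ffunE -[k *: _]/(_ * _).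
by rewrite -[in RHS]mulrA mulrCA.
Qed.

HB.instance Definition _ := GRing.Lmodule_isLalgebra.Build R[i] Cl clifford_scalerAl.

Lemma clifford_scalerAr (k : R[i]) x y : k *: (x * y) = x * (k *: y).
Proof.
apply/ffunP=> C; rewrite [LHS]ffunE !clifford_mulrE -[_ *: _]/(_ * _) mulr_sumr.
apply: eq_bigr => A _; rewrite ffunE -[k *: _]/(_ * _).
by rewrite mulrCA; congr (_ * _); rewrite mulrCA.
Qed.

HB.instance Definition _ := GRing.Lalgebra_isAlgebra.Build R[i] Cl clifford_scalerAr.

Lemma blade_mul A B :
  blade A * blade B = (-1) ^+ inversions A B *: blade (symdiff A B).
Proof.
apply/ffunP=> C; rewrite clifford_mulrE (bigD1 A) //= big1 ?addr0.
  rewrite !ffunE eqxx mul1r symdiff_eq (eq_sym C) symdiff_eq.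
  by rewrite eq_sym; case: eqP => [->|_]; rewrite ?mulr0 // scaler0.
by move=> A' /negPf A'A; rewrite ffunE A'A mul0r mulr0.
Qed.

Definition gen (j : 'I_m) : Cl := blade [set j].

Lemma gen_anticomm i j : gen i * gen j + gen j * gen i = (-2%:R * (i == j)%:R)%:A.
Proof.
rewrite /gen !blade_mul (symdiffC [set j]) -scalerDl /inversions !big_set1.
case: eqVneq => [->|ij].
  by rewrite leqnn symdiffv expr1 mulr1 -opprD.
rewrite mulr0 scale0r.
have : (i <= j)%N (+) (j <= i)%N.
  move: ij; rewrite -val_eqE /= neq_ltn.
  by case: ltngtP.
by case: (i <= j)%N; case: (j <= i)%N => //= _; rewrite ?(addrC (-1)%R) ?(expr0, expr1) ?subrr ?addNr scale0r.
Qed.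

(* e_A^dagger = (-1)^k e_(ik) ... e_(i1) = e_A^-1, and e_A e_A = (-1)^(inversions A A).
   See dagger_gen, daggerD, daggerZ and daggerM. *)
Definition dagger x : Cl := [ffun A => (-1) ^+ inversions A A * (x A)^*%C].

Lemma daggerD x y : dagger (x + y) = dagger x + dagger y.
Proof. by apply/ffunP=> A; rewrite !ffunE rmorphD mulrDr. Qed.

Lemma dagger0 : dagger 0 = 0.
Proof. by apply/ffunP=> A; rewrite !ffunE rmorph0 mulr0. Qed.

Lemma daggerZ (k : R[i]) x : dagger (k *: x) = k^*%C *: dagger x.
Proof.
apply/ffunP=> A; by rewrite !ffunE -!/(_ * _) rmorphM mulrCA.
Qed.

Lemma dagger_gen j : dagger (gen j) = - gen j.
Proof.
apply/ffunP=> A; rewrite !ffunE; case: eqVneq => [->|_].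
  by rewrite /inversions !big_set1 leqnn expr1 conjc1 mulr1.
by rewrite conjc0 mulr0 oppr0.
Qed.

Lemma daggerM x y : dagger (x * y) = dagger y * dagger x.
Proof.
apply/ffunP=> C; rewrite ffunE !clifford_mulrE rmorph_sum mulr_sumr /=.
rewrite [RHS](reindex_inj (can_inj (symdiffK C))) /=; apply: eq_bigr => A _.
rewrite !ffunE (symdiffC (symdiff C A)) symdiffK (symdiffC C).
set B := symdiff A C.
have -> : C = symdiff A B by rewrite symdiffK.
clearbody B.
rewrite !rmorphM rmorphXn rmorphN1 /=.
set a := (x A)^*%C; set b := (y B)^*%C.
have sgE : (-1) ^+ inversions (symdiff A B) (symdiff A B) * (-1) ^+ inversions A B =
    (-1) ^+ inversions B A * (-1) ^+ inversions B B * (-1) ^+ inversions A A :> R[i].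
  rewrite -!exprD -[LHS]signr_odd -[RHS]signr_odd !oddD.
  rewrite !(odd_inversionsDr, odd_inversionsDl).
  by case: (odd (inversions A A)) (odd (inversions A B)) (odd (inversions B A))
           (odd (inversions B B)) => [] [] [] [].
move: sgE; move: ((-1) ^+ _) ((-1) ^+ inversions A B) => s1 s2.
move: ((-1) ^+ _) ((-1) ^+ inversions B B) ((-1) ^+ _) => s3 s4 s5 sgE.
have -> : s1 * (s2 * (a * b)) = s1 * s2 * (a * b) by ring.
by rewrite sgE; ring.
Qed.
End Clifford.

Section Vectors.
Context {R : rcfType} {m : nat}.

Definition dotv {K : pzRingType} {n : nat} (z w : 'rV[K]_n) : K :=
  \sum_j z 0 j * w 0 j.

Definition cvec (z : 'rV[R[i]]_m) : clifford R m := \sum_j z 0 j *: gen j.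

Definition complexify (x : 'rV[R]_m) : 'rV[R[i]]_m := map_mx (real_complex R) x.

(* coordinates of the Hermitian conjugate of a vector, see dagger_cvec *)
Definition vdagger (z : 'rV[R[i]]_m) : 'rV[R[i]]_m := - map_mx (@conjc R) z.

Definition null_vector (t s : 'rV[R]_m) : 'rV[R[i]]_m :=
  complexify t + 'i%C *: complexify s.

Lemma dagger_cvec z : dagger (cvec z) = cvec (vdagger z).
Proof.
rewrite /cvec (big_morph _ daggerD dagger0); apply: eq_bigr => j _.
by rewrite daggerZ dagger_gen !mxE scalerN scaleNr.
Qed.

Lemma vdagger_null_vector t s :
  vdagger (null_vector t s) = - complexify t + 'i%C *: complexify s.
Proof.
apply/rowP=> j; rewrite !mxE; apply/eqP; rewrite eq_complex /=.
by apply/andP; split; apply/eqP; ring.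
Qed.
End Vectors.

From mathcomp Require Import all_classical all_reals all_analysis.
Import numFieldNormedType.Exports.
Local Open Scope classical_set_scope.
Local Open Scope ring_scope.

Section LebesgueRn.
Context {R : realType}.
Local Notation mR := (measurableTypeR R).

Section Step.
Context {n : nat}.

Definition cons_pair (p : mR * n.-tuple mR) : n.+1.-tuple mR :=
  [the n.+1.-tuple mR of p.1 :: p.2].

Let measurable_cons_pair : measurable_fun [set: mR * n.-tuple mR] cons_pair.
Proof. exact: measurable_cons. Qed.

HB.instance Definition _ := isMeasurableFun.Build _ _ _ _ cons_pair
  measurable_cons_pair.

Context (mu : {sigma_finite_measure set (n.-tuple mR) -> \bar R}).

Definition lebesgue_cons : set (n.+1.-tuple mR) -> \bar R :=
  pushforward (@lebesgue_measure R \x mu)%E cons_pair.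

Let lebesgue_cons0 : lebesgue_cons set0 = 0%E.
Proof. exact: measure0. Qed.

Let lebesgue_cons_ge0 A : (0 <= lebesgue_cons A)%E.
Proof. exact: measure_ge0. Qed.

Let lebesgue_cons_sigma_additive : semi_sigma_additive lebesgue_cons.
Proof.
by apply: (@measure_semi_sigma_additive _ _ _
  (@measure_function_pushforward__canonical__measure_function_Measure
     _ _ _ _ _ (@lebesgue_measure R \x mu)%E _ measurable_cons_pair)).
Qed.

HB.instance Definition _ := isMeasure.Build _ _ _ lebesgue_cons
  lebesgue_cons0 lebesgue_cons_ge0 lebesgue_cons_sigma_additive.

Let lebesgue_cons_sigma_finite : sigma_finite setT lebesgue_cons.
Proof.
have /sigma_finiteP[F [TF ndF Ffin]] := sigma_finiteT (@lebesgue_measure R).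
have /sigma_finiteP[G [TG ndG Gfin]] := sigma_finiteT mu.
pose uncons (t : n.+1.-tuple mR) : mR * n.-tuple mR := (thead t, [tuple of behead t]).
have muncons : measurable_fun setT uncons.
  apply: measurable_fun_pair; first exact: measurable_tnth.
  exact: measurable_behead.
have unconsK : cancel cons_pair uncons.
  by move=> [x t]; rewrite /uncons /cons_pair theadE; congr pair; exact: val_inj.
exists (fun k => uncons @^-1` (F k `*` G k)).
  rewrite -preimage_bigcup -(preimage_setT uncons); congr (_ @^-1` _).
  apply/esym/seteqP; split=> // -[x t] _.
  have [i _ Fi] : (\bigcup_i F i) x by rewrite -TF.
  have [j _ Gj] : (\bigcup_j G j) t by rewrite -TG.
  exists (maxn i j) => //; split.
    by move: x Fi; exact/subsetPset/ndF/leq_maxl.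
  by move: t Gj; exact/subsetPset/ndG/leq_maxr.
move=> k; have [mF Fk] := Ffin k; have [mG Gk] := Gfin k.
have mFG : measurable (F k `*` G k) by exact: measurableX.
split; first by rewrite -[X in measurable X]setTI; exact: muncons.
rewrite /lebesgue_cons /pushforward -comp_preimage.
rewrite (_ : uncons \o cons_pair = id); last by apply/funext => p; exact: unconsK.
by rewrite preimage_id product_measure1E // lte_mul_pinfty // ge0_fin_numE.
Qed.

HB.instance Definition _ := Measure_isSigmaFinite.Build _ _ _ lebesgue_cons
  lebesgue_cons_sigma_finite.
End Step.

(* Lebesgue measure on R^n as an iterated product; see lebesgue_tuple_box. *)
Fixpoint lebesgue_tuple (n : nat) :
    {sigma_finite_measure set (n.-tuple mR) -> \bar R} :=
  match n with
  | 0 => [the sigma_finite_measure _ _ of dirac ([tuple] : 0.-tuple mR)]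
  | k.+1 => [the sigma_finite_measure _ _ of lebesgue_cons (lebesgue_tuple k)]
  end.

Lemma lebesgue_tuple_box n (A : 'I_n -> set mR) :
  (forall i, measurable (A i)) ->
  lebesgue_tuple n [set t | forall i, A i (tnth t i)] =
  (\prod_(i < n) lebesgue_measure (A i))%E.
Proof.
elim: n A => [|n IH] A mA.
  rewrite big_ord0 /= /dirac indicE mem_set //.
  by move=> [].
rewrite big_ord_recl -IH; last by move=> i; exact: mA.
rewrite -product_measure1E //=; last first.
  rewrite [X in measurable X](_ : _ = \bigcap_(i in [set: 'I_n])
      ((@tnth _ mR) ^~ i @^-1` A (lift ord0 i))).
    apply: fin_bigcap_measurable => [|i _]; first exact: finite_finset.
    by rewrite -[X in measurable X]setTI; exact: measurable_tnth.
  by apply/seteqP; split=> t /= h i; [move=> _|]; apply: h.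
rewrite /lebesgue_cons /pushforward; congr (product_measure1 _ _ _).
apply/seteqP; split=> -[x t] /=.
  by move=> h; split=> [|i]; [have := h ord0|have := h (lift ord0 i); rewrite tnthS].
move=> [h0 h] i; case: (unliftP ord0 i) => [j ->|->]; rewrite ?tnthS //.
Qed.
End LebesgueRn.


Section MonogenicBargmann.
Context {R : realType} {m : nat}.
Local Notation E := 'rV[R]_m.
Local Notation Cl := (clifford R m).

Definition eucl_norm (x : E) : R := Num.sqrt (dotv x x).

Definition row_of_tuple (t : m.-tuple (measurableTypeR R)) : E := \row_j tnth t j.

Definition partial (j : 'I_m) (g : E -> R) (x : E) : R := 'D_(delta_mx 0 j) g x.

Definition continuously_differentiable (g : E -> R) : Prop :=
  (forall x, differentiable g x) /\ (forall j, continuous (partial j g)).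

Definition coefRe (f : E -> Cl) A (x : E) : R := complex.Re (f x A).
Definition coefIm (f : E -> Cl) A (x : E) : R := complex.Im (f x A).

Definition partial_cl (j : 'I_m) (f : E -> Cl) (x : E) : Cl :=
  [ffun A => (partial j (coefRe f A) x +i* partial j (coefIm f A) x)%C].

Definition dirac_op (f : E -> Cl) (x : E) : Cl := \sum_j gen j * partial_cl j f x.

Definition monogenic (f : E -> Cl) : Prop :=
  (forall A, continuously_differentiable (coefRe f A) /\
             continuously_differentiable (coefIm f A)) /\
  (forall x, dirac_op f x = 0).

(* complex (Frechet) differentiability on C^m of each coefficient *)
Definition holomorphic (F : 'rV[R[i]]_m -> Cl) : Prop :=
  forall A z, differentiable (fun w => F w A : R[i]^o) z.

Definition is_holomorphic_extension (f : E -> Cl) (F : 'rV[R[i]]_m -> Cl) : Prop :=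
  holomorphic F /\ forall x, F (complexify x) = f x.

(* The constant 0 is only a default value, for functions without an extension. *)
Definition holomorphic_extension (f : E -> Cl) : 'rV[R[i]]_m -> Cl :=
  xget (fun=> 0) [set F | is_holomorphic_extension f F].

Definition square_integrable (g : E -> R) : Prop :=
  (g \o row_of_tuple) \in Lfun (lebesgue_tuple m) 2%:E.

(* f e^(-|x|^2/4) is in L^2 iff all its real coordinates are. *)
Definition MB : set (E -> Cl) := [set f | monogenic f /\
  forall A,
    square_integrable (fun x => coefRe f A x * expR (- eucl_norm x ^+ 2 / 4)) /\
    square_integrable (fun x => coefIm f A x * expR (- eucl_norm x ^+ 2 / 4))].

Definition integral_cl (h : E -> Cl) : Cl :=
  [ffun A => ((\int[lebesgue_tuple m]_t coefRe h A (row_of_tuple t)) +i*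
              (\int[lebesgue_tuple m]_t coefIm h A (row_of_tuple t)))%C].

Definition MB_inner (f g : E -> Cl) : Cl :=
  (((2 * pi) `^ (m%:R / 2))^-1)%:C%C *:
  integral_cl (fun x =>
    (expR (- eucl_norm x ^+ 2 / 2))%:C%C *: (dagger (f x) * g x)).

Definition scalar_part (a : Cl) : R[i] := a finset.set0.

Definition MB_norm (f : E -> Cl) : R :=
  Num.sqrt (complex.Re (scalar_part (MB_inner f f))).

(* finite right linear combinations of the functions <x, tau>^l tau *)
Definition tau_combination (tau : 'rV[R[i]]_m) : set (E -> Cl) :=
  [set S | exists n (a : 'I_n -> Cl),
    S = fun x => \sum_(l < n) dotv (complexify x) tau ^+ l *: (cvec tau * a l)].

Definition MB_tau (tau : 'rV[R[i]]_m) : set (E -> Cl) :=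
  [set g | MB g /\ forall eps : R, 0 < eps ->
     exists2 S, tau_combination tau S & MB_norm (g \- S) < eps].

Definition is_orthogonal_projection (M : set (E -> Cl)) (f p : E -> Cl) : Prop :=
  M p /\ forall h, M h -> MB_inner h (f \- p) = 0.

(* The constant 0 is only a default value, for functions without a projection. *)
Definition bargmann_radon (tau : 'rV[R[i]]_m) (f : E -> Cl) : E -> Cl :=
  xget (fun=> 0) [set p | is_orthogonal_projection (MB_tau tau) f p].

End MonogenicBargmann.

(* Main.v *)
From HB Require Import structures.
Require Import Defs.
From mathcomp Require Import all_boot all_order all_algebra.
From mathcomp Require Import complex.
From mathcomp Require Import all_classical all_reals all_analysis.
From mathcomp Require Import measurable_realfun ring lra.
Set Implicit Arguments.
Unset Strict Implicit.
Unset Printing Implicit Defensive.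
Import Order.TTheory GRing.Theory Num.Theory.
Import numFieldNormedType.Exports.
Local Open Scope classical_set_scope.
Local Open Scope ring_scope.

(** The reproducing formula. Averaging a monogenic function f against a radial kernel gives its
    value at the center. For kernels of compact support this follows from the symmetry, under
    rotations, of the moments of y_i d_j f(x + r y): the Dirac equation and
    e_i e_j + e_j e_i = -2 delta_ij force the sum of the diagonal moments, which is the
    derivative of the average in r, to vanish ([monogenic_radial_mean]). Approximating the
    Gaussian by such kernels shows that every f in the Bargmann space satisfies

      f(x) = (2 pi)^(-m/2) e^(-|x|^2/2) int f(y) e^<x, y> e^(-|y|^2/2) dy

    ([MB_gaussian_mean]).

    The holomorphic extension. The right-hand side makes sense for complex x and is holomorphic
    there, so that this Segal-Bargmann transform is an extension of f to C^m
    ([segal_bargmann_extension]). It is the only one: a holomorphic function of one variable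
    that vanishes on the reals vanishes at i ([zero_on_reals], from Goursat's theorem on a
    rectangle), and the lines x + u y through real points reach all of C^m
    ([holomorphic_extension_unique]).

    The orthogonal expansion. Put Z = <x, tau>. The vector tau is null, hence tau tau = 0, which
    makes the functions Z^l tau a monogenic ([monogenic_plane_wave]), and
    tau tau^dagger tau = 4 tau. Applying the reproducing formula to Z^k tau on the null line
    b conj(tau) and differentiating in b gives the orthogonality relations
    <Z^k, Z^l> = 2^k k! delta_kl ([gaussian_moment]). Consequently

      S_n = sum_(l < n) Z^l tau tau^dagger <Z^l, f> / (4 2^l l!)

    has the property that f - S_n is orthogonal to Z^k tau for k < n ([inner_zpow_remainder]).
    The sums S_n are (tau tau^dagger / 4) times the Taylor polynomials, under the integral sign,
    of the Segal-Bargmann transform at -(1/2) tau^dagger Z, where the factor e^(-<z, z>/2) is 1.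
    They converge pointwise to

      P(u) = (tau tau^dagger / 4) f(-(1/2) tau^dagger <u, tau>),

    which is monogenic, again as a plane wave annihilated by tau.

    The projection. The distances from f to S_n decrease, so that Pythagoras' theorem and Fatou's
    lemma turn the pointwise convergence S_n -> P into convergence in norm ([radon_remainder]).
    Hence P lies in MB(tau) and f - P is orthogonal to it ([radon_projection]); such a P is
    unique, because a difference of two candidates is orthogonal to itself
    ([orthogonal_projection_unique]). *)

(** * Calculus on the real line *)

Section RealCalculus.
Context {R : realType}.
Implicit Types (f g u U : R -> R) (a b x : R).

Lemma is_derive1_continuous f g :
  (forall x, is_derive x 1 f (g x)) -> continuous f.
Proof.
move=> df x; apply: differentiable_continuous.
by apply/derivable1_diffP; have [] := df x.
Qed.

Lemma is_derive1_within_continuous f g a b :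
  (forall x, a <= x <= b -> is_derive x 1 f (g x)) ->
  {within `[a, b], continuous f}.
Proof.
move=> df; apply: derivable_within_continuous => x; rewrite in_itv /= => xab.
by have [] := df _ xab.
Qed.

Lemma mean_value f g a b : a <= b ->
  (forall x, a <= x <= b -> is_derive x 1 f (g x)) ->
  exists2 c, a <= c <= b & f b - f a = g c * (b - a).
Proof.
move=> ab df; have [|x|c] := @MVT_segment R f g a b ab.
- by move=> x; rewrite in_itv /= => /andP[/ltW ax /ltW xb]; apply: df; rewrite ax xb.
- exact: is_derive1_within_continuous df x.
- by rewrite in_itv => cab fE; exists c.
Qed.

Lemma mean_value_le f g a b M : a <= b ->
  (forall x, a <= x <= b -> is_derive x 1 f (g x)) ->
  (forall x, a <= x <= b -> g x <= M) -> f b - f a <= M * (b - a).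
Proof.
move=> ab df gM; have [c cab ->] := mean_value ab df.
by rewrite ler_wpM2r ?subr_ge0 ?gM.
Qed.

Lemma mean_value_norm_le f g a b M : a <= b ->
  (forall x, a <= x <= b -> is_derive x 1 f (g x)) ->
  (forall x, a <= x <= b -> `|g x| <= M) -> `|f b - f a| <= M * (b - a).
Proof.
move=> ab df gM; have [c cab ->] := mean_value ab df.
by rewrite normrM (ger0_norm (_ : 0 <= b - a)) ?subr_ge0 // ler_wpM2r ?subr_ge0 ?gM.
Qed.

Lemma is_derive1M f g x (df dg : R) : is_derive x 1 f df -> is_derive x 1 g dg ->
  is_derive x 1 (fun s => f s * g s) (df * g x + f x * dg).
Proof.
move=> Hf Hg; apply: (is_derive_eq (is_deriveM Hf Hg)).
by rewrite -![_ *: _]/(_ * _) addrC (mulrC df).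
Qed.

Lemma is_derive1D f g x (df dg : R) : is_derive x 1 f df -> is_derive x 1 g dg ->
  is_derive x 1 (fun s => f s + g s) (df + dg).
Proof. by move=> Hf Hg; exact: is_deriveD. Qed.

Lemma is_derive1B f g x (df dg : R) : is_derive x 1 f df -> is_derive x 1 g dg ->
  is_derive x 1 (fun s => f s - g s) (df - dg).
Proof. by move=> Hf Hg; exact: is_deriveB. Qed.

Lemma is_derive1X n x : is_derive x 1 (fun s => s ^+ n.+1) (n.+1%:R * x ^+ n).
Proof.
elim: n => [|n IH].
  by rewrite expr0 mulr1; under [X in is_derive _ _ X _]eq_fun do rewrite expr1; exact: is_derive_id.
under [X in is_derive _ _ X _]eq_fun do rewrite exprS.
apply: (is_derive_eq (is_derive1M (is_derive_id x 1) IH)).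
by rewrite -[n.+2%:R]natr1 !exprS; ring.
Qed.

Lemma is_derive1Z (c : R) f x (df : R) : is_derive x 1 f df ->
  is_derive x 1 (fun s => c * f s) (c * df).
Proof.
move=> Hf; apply: (is_derive_eq (is_derive1M (is_derive_cst c x 1) Hf)).
by rewrite mul0r add0r.
Qed.

Lemma ex_primitive u (A : R) : continuous u ->
  exists U, forall x, A < x -> is_derive x 1 U (u x).
Proof.
move=> cu.
exists (fun x => (\int[lebesgue_measure]_(t in [set` `[A, x]]) u t)%R) => x Ax.
have [||dU <-] := @continuous_FTC1_closed R u A x (x + 1) _ _ Ax (cu x).
- by rewrite ltrDl.
- apply: continuous_compact_integrable; first exact: segment_compact.
  exact: continuous_subspaceT.
by rewrite derive1E; apply: DeriveDef.
Qed.

Lemma is_derive1_quadratic f x d (C : R) :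
  (forall h, `|h| <= 1 -> `|f (x + h) - f x - d * h| <= C * h ^+ 2) -> is_derive x 1 f d.
Proof.
move=> H.
have cvg : (fun h => h^-1 *: ((f \o shift x) (h *: 1) - f x)) @ 0^' --> d.
  apply/cvgrPdist_le => e e0.
  near=> h.
  have h0 : h != 0 by near: h; exact: nbhs_dnbhs_neq.
  have h1 : `|h| <= 1.
    near: h; apply: dnbhs0_le; exact: ltr01.
  have hC : `|h| <= e / (`|C| + 1).
    by near: h; apply: dnbhs0_le; rewrite divr_gt0 // ltr_wpDl.
  rewrite distrC [_ *: 1]mulr1 /= -[_ *: _]/(_ * _).
  have -> : h^-1 * (f (h + x) - f x) - d = h^-1 * (f (x + h) - f x - d * h).
    by rewrite (addrC h) [RHS]mulrBr (mulrC d) (mulrA _ h) mulVf // mul1r.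
  rewrite normrM normfV ler_pdivrMl ?normr_gt0 //.
  apply: (le_trans (H _ h1)).
  rewrite -real_normK ?num_real // expr2 mulrCA ler_wpM2l //.
  have C1 : 0 < `|C| + 1 by rewrite ltr_wpDl.
  apply: (@le_trans _ _ ((`|C| + 1) * `|h|)).
    by rewrite ler_wpM2r //; have := ler_norm C; lra.
  by rewrite mulrC -ler_pdivlMr.
apply: DeriveDef; last exact: cvg_lim cvg.
by apply/cvg_ex; exists d.
Unshelve. all: by end_near. Qed.
End RealCalculus.

(** * Goursat's theorem on rectangles *)

Section Goursat.
Context {R : realType}.
Variables (A : R) (P Q IP IQ : R -> R -> R).
Hypothesis dIP : forall x y, A < x -> is_derive x 1 (IP y) (P x y).
Hypothesis dIQ : forall x y, A < y -> is_derive y 1 (IQ x) (Q x y).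

(** The integral of P dx + Q dy around the boundary of [a, b] x [c, d], written with primitives
    IP of P in x and IQ of Q in y instead of path integrals. *)
Definition rect_integral a b c d : R :=
  (IP c b - IP c a) - (IP d b - IP d a) + ((IQ b d - IQ b c) - (IQ a d - IQ a c)).
Local Notation J := rect_integral.

(** The terms with p cancel, because the two cross derivatives agree; the mean value
    inequality on pairs of opposite sides bounds what remains. *)
Lemma rect_integral_near (a c w h p e : R) : A < a -> A < c -> 0 <= w -> 0 <= h ->
  (forall x, a <= x <= a + w -> `|P x c - P x (c + h) + p * h| <= e) ->
  (forall y, c <= y <= c + h -> `|Q (a + w) y - Q a y - p * w| <= e) ->
  `|J a (a + w) c (c + h)| <= e * (w + h).
Proof.
move=> Aa Ac w0 h0 HP HQ.
have := @mean_value_norm_le R (fun x => IP c x - IP (c + h) x + p * h * x)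
  (fun x => P x c - P x (c + h) + p * h) a (a + w) e _ _ HP.
have := @mean_value_norm_le R (fun y => IQ (a + w) y - IQ a y - p * w * y)
  (fun y => Q (a + w) y - Q a y - p * w) c (c + h) e _ _ HQ.
rewrite !lerDl => /(_ h0) H1 /(_ w0) H2.
have {}H2 : `|IP c (a + w) - IP (c + h) (a + w) + p * h * (a + w) -
     (IP c a - IP (c + h) a + p * h * a)| <= e * (a + w - a).
  apply: H2 => x /andP[ax _]; have Ax := lt_le_trans Aa ax.
  have d1 := dIP c Ax; have d2 := dIP (c + h) Ax.
  by apply: is_derive_eq; rewrite [_ *: 1]mulr1.
have {}H1 : `|IQ (a + w) (c + h) - IQ a (c + h) - p * w * (c + h) -
       (IQ (a + w) c - IQ a c - p * w * c)| <= e * (c + h - c).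
  apply: H1 => y /andP[cy _]; have Ay := lt_le_trans Ac cy.
  have d1 := dIQ a Ay; have d2 := dIQ (a + w) Ay.
  by apply: is_derive_eq; rewrite [_ *: 1]mulr1.
have -> : J a (a + w) c (c + h) =
  (IP c (a + w) - IP (c + h) (a + w) + p * h * (a + w) -
     (IP c a - IP (c + h) a + p * h * a)) +
  (IQ (a + w) (c + h) - IQ a (c + h) - p * w * (c + h) -
       (IQ (a + w) c - IQ a c - p * w * c)) by rewrite /J; ring.
apply: (le_trans (ler_normD _ _)).
have -> : e * (w + h) = e * (a + w - a) + e * (c + h - c) by ring.
exact: lerD.
Qed.

(** P dx + Q dy is closed pointwise: p2 is both the derivative of P in y and that of Q in x. *)
Hypothesis closed_form : forall x0 y0, exists p1 p2 q2 : R, forall e, 0 < e ->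
  exists2 d, 0 < d & forall x y, `|x - x0| <= d -> `|y - y0| <= d ->
   `|P x y - P x0 y0 - p1 * (x - x0) - p2 * (y - y0)| <= e * (`|x - x0| + `|y - y0|) /\
   `|Q x y - Q x0 y0 - p2 * (x - x0) - q2 * (y - y0)| <= e * (`|x - x0| + `|y - y0|).

Lemma goursat_local x0 y0 (e : R) : 0 < e -> exists2 d, 0 < d &
  forall a c w h, A < a -> A < c -> 0 <= w <= d -> 0 <= h <= d ->
   a <= x0 <= a + w -> c <= y0 <= c + h ->
   `|J a (a + w) c (c + h)| <= e * (w + h) ^+ 2.
Proof.
move=> e0; have [p1 [p2 [q2 H]]] := closed_form x0 y0.
have [|d d0 {}H] := H (e / 2); first by rewrite divr_gt0.
exists d => // a c w h Aa Ac /andP[w0 wd] /andP[h0 hd] xa yc.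
rewrite expr2 mulrA; apply: (rect_integral_near (p := p2)) => //.
- move=> x xab.
  have hx : `|x - x0| <= w by rewrite ler_norml; lra.
  have hc : `|c - y0| <= h by rewrite ler_norml; lra.
  have hd' : `|c + h - y0| <= h by rewrite ler_norml; lra.
  have [H1 _] := H x c (le_trans hx wd) (le_trans hc hd).
  have [H2 _] := H x (c + h) (le_trans hx wd) (le_trans hd' hd).
  have -> : P x c - P x (c + h) + p2 * h =
    (P x c - P x0 y0 - p1 * (x - x0) - p2 * (c - y0)) -
    (P x (c + h) - P x0 y0 - p1 * (x - x0) - p2 * (c + h - y0)) by ring.
  apply: (le_trans (ler_normB _ _)); apply: (le_trans (lerD H1 H2)).
  rewrite -mulrDr -mulrA ler_pM2l // ler_pdivrMl //; lra.
- move=> y ycd.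
  have hy : `|y - y0| <= h by rewrite ler_norml; lra.
  have hc : `|a - x0| <= w by rewrite ler_norml; lra.
  have hd' : `|a + w - x0| <= w by rewrite ler_norml; lra.
  have [_ H1] := H (a + w) y (le_trans hd' wd) (le_trans hy hd).
  have [_ H2] := H a y (le_trans hc wd) (le_trans hy hd).
  have -> : Q (a + w) y - Q a y - p2 * w =
    (Q (a + w) y - Q x0 y0 - p2 * (a + w - x0) - q2 * (y - y0)) -
    (Q a y - Q x0 y0 - p2 * (a - x0) - q2 * (y - y0)) by ring.
  apply: (le_trans (ler_normB _ _)); apply: (le_trans (lerD H1 H2)).
  rewrite -mulrDr -mulrA ler_pM2l // ler_pdivrMl //; lra.
Qed.

(** The integrals around the four quarters add up to the integral around the rectangle. *)
Lemma rect_integral_quarter (a c w h e : R) : e < `|J a (a + w) c (c + h)| ->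
  exists i j : bool, e / 4 < `|J (a + i%:R * (w / 2)) (a + i%:R * (w / 2) + w / 2)
    (c + j%:R * (h / 2)) (c + j%:R * (h / 2) + h / 2)|.
Proof.
move=> He; apply: contrapT => H.
have {}H i j : `|J (a + (i : bool)%:R * (w / 2)) (a + i%:R * (w / 2) + w / 2)
    (c + (j : bool)%:R * (h / 2)) (c + j%:R * (h / 2) + h / 2)| <= e / 4.
  by rewrite leNgt; apply/negP => H'; apply: H; exists i, j.
have H1 := H false false; have H2 := H false true.
have H3 := H true false; have H4 := H true true.
move: He; rewrite ltNge => /negP; apply.
rewrite /= !mul0r !mul1r !addr0 in H1 H2 H3 H4.
have wE : a + w / 2 + w / 2 = a + w by field.
have hE : c + h / 2 + h / 2 = c + h by field.
rewrite ?wE ?hE in H1 H2 H3 H4.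
have -> : J a (a + w) c (c + h) =
   J a (a + w / 2) c (c + h / 2) + J a (a + w / 2) (c + h / 2) (c + h) +
   (J (a + w / 2) (a + w) c (c + h / 2) + J (a + w / 2) (a + w) (c + h / 2) (c + h)).
  by rewrite /J; ring.
have -> : e = e / 4 + e / 4 + (e / 4 + e / 4) by field.
apply: (le_trans (ler_normD _ _)); apply: lerD;
by apply: (le_trans (ler_normD _ _)); apply: lerD.
Qed.

Lemma nested_point (u : nat -> R) (w : R) : 0 <= w ->
  (forall n, u n <= u n.+1 /\ u n.+1 + w / 2 ^+ n.+1 <= u n + w / 2 ^+ n) ->
  exists x, forall n, u n <= x <= u n + w / 2 ^+ n.
Proof.
move=> w0 H.
have nd k n : u n <= u (n + k)%N /\ u (n + k)%N + w / 2 ^+ (n + k) <= u n + w / 2 ^+ n.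
  elim: k => [|k [IH1 IH2]]; first by rewrite addn0.
  rewrite addnS; have [H1 H2] := H (n + k)%N.
  by split; [exact: le_trans IH1 H1|exact: le_trans H2 IH2].
have wp n : 0 <= w / 2 ^+ n by rewrite divr_ge0 // exprn_ge0.
have ub n k : u k <= u n + w / 2 ^+ n.
  have [nk|kn] := leqP n k.
    have [_] := nd (k - n)%N n; rewrite subnKC // => h.
    by apply: le_trans h; rewrite lerDl.
  have [h _] := nd (n - k)%N k; rewrite subnKC // ?(ltnW kn) // in h.
  by apply: (le_trans h); rewrite lerDl.
exists (sup (range u)) => n; apply/andP; split.
  apply: ub_le_sup; last by exists n.
  by exists (u 0%N + w / 2 ^+ 0) => _ [k _ <-]; exact: ub.
apply: ge_sup; first by exists (u 0%N); exists 0%N.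
by move=> _ [k _ <-]; exact: ub.
Qed.

(** If the integral were nonzero, repeated quartering would give nested rectangles of sides
    w / 2^n and h / 2^n around which the integral exceeds e (w / 2^n + h / 2^n)^2, against
    [goursat_local] at their common point. *)
Lemma goursat a c w h : A < a -> A < c -> 0 <= w -> 0 <= h ->
  J a (a + w) c (c + h) = 0.
Proof.
move=> Aa Ac w0 h0; apply/eqP; rewrite -normr_eq0; apply/negPn/negP => J0.
have {}J0 : 0 < `|J a (a + w) c (c + h)| by rewrite lt_neqAle eq_sym J0 normr_ge0.
have wh0 : 0 < (w + h) ^+ 2 + 1 by rewrite ltr_wpDl // sqr_ge0.
(* so small that the bound of goursat_local fails on the whole rectangle *)
pose e := `|J a (a + w) c (c + h)| / (2 * ((w + h) ^+ 2 + 1)).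
have e0 : 0 < e by rewrite divr_gt0 // mulr_gt0.
have He : e * (w + h) ^+ 2 < `|J a (a + w) c (c + h)|.
  rewrite /e mulrAC ltr_pdivrMr ?mulr_gt0 // ltr_pM2l //.
  by have := sqr_ge0 (w + h); lra.
pose W n := w / 2 ^+ n; pose H n := h / 2 ^+ n.
have WS n : W n.+1 = W n / 2 by rewrite /W exprS invfM mulrA mulrAC.
have HS n : H n.+1 = H n / 2 by rewrite /H exprS invfM mulrA mulrAC.
have W0 n : 0 <= W n by rewrite divr_ge0 // exprn_ge0.
have H0 n : 0 <= H n by rewrite divr_ge0 // exprn_ge0.
pose bad n (p : R * R) := e * (W n + H n) ^+ 2 < `|J p.1 (p.1 + W n) p.2 (p.2 + H n)|.
have step n p : exists ij : bool * bool, bad n p ->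
    bad n.+1 (p.1 + ij.1%:R * (W n / 2), p.2 + ij.2%:R * (H n / 2)).
  have [bp|nb] := pselect (bad n p); last by exists (true, true).
  have [i [j Hij]] := rect_integral_quarter bp; exists (i, j) => _.
  rewrite /bad /= WS HS (_ : e * _ = e * (W n + H n) ^+ 2 / 4) //.
  by field.
pose s n p := projT1 (cid (step n p)).
pose fix pt n := if n is k.+1 then
  ((pt k).1 + (s k (pt k)).1%:R * (W k / 2), (pt k).2 + (s k (pt k)).2%:R * (H k / 2))
  else (a, c).
have ptbad n : bad n (pt n).
  elim: n => [|n IH]; first by rewrite /bad /W /H /= expr0 !divr1.
  by rewrite /= /s; case: cid => /= ij; apply.
have incr (b : bool) (v : R) : 0 <= v -> 0 <= b%:R * (v / 2) <= v / 2.
  by move=> v0; case: b; rewrite ?mul1r ?mul0r; lra.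
have [|x Hx] := @nested_point (fun n => (pt n).1) w w0.
  move=> n; rewrite -/(W n) -/(W n.+1) WS /=.
  by have := incr (s n (pt n)).1 _ (W0 n); split; lra.
have [|y Hy] := @nested_point (fun n => (pt n).2) h h0.
  move=> n; rewrite -/(H n) -/(H n.+1) HS /=.
  by have := incr (s n (pt n)).2 _ (H0 n); split; lra.
have [d d0 Hd] := @goursat_local x y e e0.
have Apt n : A < (pt n).1 /\ A < (pt n).2.
  elim: n => [//|n [I1 I2]] /=.
  have h1 := incr (s n (pt n)).1 _ (W0 n); have h2 := incr (s n (pt n)).2 _ (H0 n).
  split; lra.
have [n Hn] : exists n, w + h <= d * 2 ^+ n.
  have [n Hn] : exists n, (w + h) / d < n%:R.
    exists (Num.bound ((w + h) / d)); apply: Num.Theory.archi_boundP.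
    by rewrite divr_ge0 ?addr_ge0 // ltW.
  exists n; rewrite mulrC -ler_pdivrMr //; apply: (le_trans (ltW Hn)).
  by rewrite -natrX ler_nat ltnW // ltn_expl.
have p2 : 0 < 2 ^+ n :> R by rewrite exprn_gt0.
have [A1 A2] := Apt n.
have := ptbad n; rewrite /bad ltNge => /negP; apply; apply: Hd => //.
- by rewrite W0 ler_pdivrMr //; lra.
- by rewrite H0 ler_pdivrMr //; lra.
Qed.
End Goursat.

(** * Complex derivatives *)

Section ComplexDerivative.
Context {R : realType}.
Local Notation C := R[i].
Local Notation normc := (@ComplexField.Normc.normc R).
Implicit Types (f g : C -> C) (z w d : C).

Lemma normrcE z : `|z| = (normc z)%:C%C.
Proof. by case: z. Qed.

Lemma normc_ge0 z : 0 <= normc z.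
Proof. by case: z => a b; rewrite sqrtr_ge0. Qed.

Lemma normcC (x : R) : normc x%:C%C = `|x|.
Proof. by rewrite /= expr0n addr0 sqrtr_sqr. Qed.

Lemma normcB z w : normc (z - w) = normc (w - z).
Proof. by rewrite -[RHS]normcN opprB. Qed.

Lemma normc_triang z w : normc (z + w) <= normc z + normc w.
Proof. exact: le_normcD. Qed.

Lemma normc_sum (I : Type) (s : seq I) (F : I -> C) :
  normc (\sum_(i <- s) F i) <= \sum_(i <- s) normc (F i).
Proof.
elim: s => [|i s IH]; first by rewrite !big_nil ComplexField.Normc.normc0.
by rewrite !big_cons; apply: (le_trans (normc_triang _ _)); rewrite lerD2l.
Qed.

Lemma normcX z n : normc (z ^+ n) = normc z ^+ n.
Proof.
elim: n => [|n IH]; first by rewrite !expr0 ComplexField.Normc.normc1.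
by rewrite !exprS ComplexField.Normc.normcM IH.
Qed.

Lemma Re_le_normc z : `|complex.Re z| <= normc z.
Proof.
by case: z => a b /=; rewrite -sqrtr_sqr ler_wsqrtr // lerDl sqr_ge0.
Qed.

Lemma Im_le_normc z : `|complex.Im z| <= normc z.
Proof.
by case: z => a b /=; rewrite -sqrtr_sqr ler_wsqrtr // lerDr sqr_ge0.
Qed.

Lemma normc_le_ReIm z : normc z <= `|complex.Re z| + `|complex.Im z|.
Proof.
case: z => a b /=; rewrite -(ger0_norm (addr_ge0 (normr_ge0 a) (normr_ge0 b))).
rewrite -sqrtr_sqr ler_wsqrtr // -[a ^+ 2]real_normK ?num_real //.
rewrite -[b ^+ 2]real_normK ?num_real //.
have := mulr_ge0 (normr_ge0 a) (normr_ge0 b); nra.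
Qed.

Lemma cReM z w : complex.Re (z * w) =
  complex.Re z * complex.Re w - complex.Im z * complex.Im w.
Proof. by case: z; case: w. Qed.
Lemma cImM z w : complex.Im (z * w) =
  complex.Re z * complex.Im w + complex.Im z * complex.Re w.
Proof. by case: z; case: w. Qed.
Lemma cReD z w : complex.Re (z + w) = complex.Re z + complex.Re w.
Proof. by case: z; case: w. Qed.
Lemma cImD z w : complex.Im (z + w) = complex.Im z + complex.Im w.
Proof. by case: z; case: w. Qed.
Lemma cReN z : complex.Re (- z) = - complex.Re z.
Proof. by case: z. Qed.
Lemma cImN z : complex.Im (- z) = - complex.Im z.
Proof. by case: z. Qed.

(** Differentiability in one complex variable, in terms of the real-valued modulus: the norm
    of R[i] as a field has its values in R[i], which is only partially ordered. *)
Definition cderivative f z d := forall e : R, 0 < e ->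
  exists2 del : R, 0 < del & forall w, normc (w - z) <= del ->
    normc (f w - f z - d * (w - z)) <= e * normc (w - z).

Lemma cderivative_cst d z : cderivative (fun=> d) z 0.
Proof.
move=> e e0; exists 1 => // w _.
by rewrite mul0r subrr subr0 ComplexField.Normc.normc0 mulr_ge0 ?normc_ge0 // ltW.
Qed.

Lemma cderivative_id z : cderivative id z 1.
Proof.
move=> e e0; exists 1 => // w _.
by rewrite mul1r subrr ComplexField.Normc.normc0 mulr_ge0 ?normc_ge0 // ltW.
Qed.

Lemma cderivativeD f g z d1 d2 : cderivative f z d1 -> cderivative g z d2 ->
  cderivative (fun w => f w + g w) z (d1 + d2).
Proof.
move=> Hf Hg e e0; have e2 : 0 < e / 2 by rewrite divr_gt0.
have [a a0 Ha] := Hf _ e2; have [b b0 Hb] := Hg _ e2.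
exists (Num.min a b) => [|w]; first by rewrite lt_min a0.
rewrite le_min => /andP[/Ha h1 /Hb h2].
have -> : f w + g w - (f z + g z) - (d1 + d2) * (w - z) =
  (f w - f z - d1 * (w - z)) + (g w - g z - d2 * (w - z)) by ring.
apply: (le_trans (normc_triang _ _)); apply: (le_trans (lerD h1 h2)).
by rewrite -mulrDl -splitr.
Qed.

Lemma cderivative_lip f z d : cderivative f z d ->
  exists2 del : R, 0 < del & forall w, normc (w - z) <= del ->
    normc (f w - f z) <= (normc d + 1) * normc (w - z).
Proof.
move=> /(_ 1 ltr01)[del del0 H]; exists del => // w /H.
rewrite mul1r => h.
have -> : f w - f z = (f w - f z - d * (w - z)) + d * (w - z) by ring.
apply: (le_trans (normc_triang _ _)).
by rewrite ComplexField.Normc.normcM mulrDl mul1r addrC lerD2l.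
Qed.

Lemma cderivativeM f g z d1 d2 : cderivative f z d1 -> cderivative g z d2 ->
  cderivative (fun w => f w * g w) z (d1 * g z + f z * d2).
Proof.
move=> Hf Hg e e0.
have [dl dl0 Hl] := cderivative_lip Hg; have [dk dk0 Hk] := cderivative_lip Hf.
set K := normc d1 + 1 in Hk; set L := normc d2 + 1 in Hl.
have K0 : 0 < K by rewrite ltr_wpDl // normc_ge0.
have L0 : 0 < L by rewrite ltr_wpDl // normc_ge0.
have [|a a0 Ha] := Hf (e / 3 / (normc (g z) + 1)).
  by rewrite !divr_gt0 // ltr_wpDl // normc_ge0.
have [|b b0 Hb] := Hg (e / 3 / (normc (f z) + 1)).
  by rewrite !divr_gt0 // ltr_wpDl // normc_ge0.
have c0 : 0 < e / 3 / (K * L) by rewrite !divr_gt0 // mulr_gt0.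
exists (Num.min (Num.min dl dk) (Num.min (Num.min a b) (e / 3 / (K * L)))) => [|w].
  by rewrite !lt_min dl0 dk0 a0 b0 c0.
rewrite !le_min => /andP[/andP[/Hl hl /Hk hk]] /andP[/andP[/Ha ha /Hb hb] hc].
set n := normc (w - z) in hl hk ha hb hc *.
have n0 : 0 <= n := normc_ge0 _.
have -> : f w * g w - f z * g z - (d1 * g z + f z * d2) * (w - z) =
   (f w - f z - d1 * (w - z)) * g z + f z * (g w - g z - d2 * (w - z)) +
   (f w - f z) * (g w - g z) by ring.
have third : e * n = e / 3 * n + e / 3 * n + e / 3 * n by field.
rewrite third; apply: (le_trans (normc_triang _ _)); apply: lerD.
  apply: (le_trans (normc_triang _ _)); apply: lerD.
    rewrite ComplexField.Normc.normcM.
    apply: (le_trans (ler_wpM2r (normc_ge0 _) ha)).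
    rewrite mulrAC ler_wpM2r // -(mulrA (e / 3)) ler_piMr ?divr_ge0 ?(ltW e0) //.
    by rewrite ler_pdivrMl ?ltr_wpDl ?normc_ge0 // mulr1 lerDl.
  rewrite ComplexField.Normc.normcM.
  apply: (le_trans (ler_wpM2l (normc_ge0 _) hb)).
  rewrite mulrA ler_wpM2r // (mulrCA _ (e / 3)) ler_piMr ?divr_ge0 ?(ltW e0) //.
  by rewrite ler_pdivrMr ?ltr_wpDl ?normc_ge0 // mul1r lerDl.
rewrite ComplexField.Normc.normcM.
apply: (le_trans (ler_pM (normc_ge0 _) (normc_ge0 _) hk hl)).
rewrite (_ : K * n * (L * n) = (K * L * n) * n); last by ring.
by rewrite ler_wpM2r // -ler_pdivlMl ?mulr_gt0 // mulrC.
Qed.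

(** The form Re (f dz) is closed when f is complex differentiable: this is the
    Cauchy-Riemann system. *)
Lemma cderivative_closed_form f : (forall z, exists d, cderivative f z d) ->
  forall x0 y0 : R, exists p1 p2 q2 : R, forall e, 0 < e ->
  exists2 d, 0 < d & forall x y, `|x - x0| <= d -> `|y - y0| <= d ->
   `|complex.Re (f (x +i* y)%C) - complex.Re (f (x0 +i* y0)%C)
      - p1 * (x - x0) - p2 * (y - y0)| <= e * (`|x - x0| + `|y - y0|) /\
   `|- complex.Im (f (x +i* y)%C) - - complex.Im (f (x0 +i* y0)%C)
      - p2 * (x - x0) - q2 * (y - y0)| <= e * (`|x - x0| + `|y - y0|).
Proof.
move=> H x0 y0; have [[a b] Hd] := H (x0 +i* y0)%C.
exists a, (- b), (- a) => e e0; have [d d0 {}Hd] := Hd e e0.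
exists (d / 2) => [|x y hx hy]; first by rewrite divr_gt0.
have := Hd (x +i* y)%C; set n := normc _.
have hn : n <= `|x - x0| + `|y - y0| by apply: normc_le_ReIm.
move=> /(_ _) h; have {}h := h (le_trans hn _).
have {}h := h _; set v := _ - _ - _ in h.
have {}h : normc v <= e * (`|x - x0| + `|y - y0|).
  by apply: (le_trans (h _)); [lra|rewrite ler_pM2l].
split.
  have -> : complex.Re (f (x +i* y)%C) - complex.Re (f (x0 +i* y0)%C) -
     a * (x - x0) - - b * (y - y0) = complex.Re v.
    by rewrite /v !(cReD, cReN, cReM) /=; ring.
  exact: le_trans (Re_le_normc _) h.
have -> : - complex.Im (f (x +i* y)%C) - - complex.Im (f (x0 +i* y0)%C) -
     - b * (x - x0) - - a * (y - y0) = - complex.Im v.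
  by rewrite /v !(cImD, cImN, cImM) /=; ring.
by rewrite normrN; exact: le_trans (Im_le_normc _) h.
Qed.

Lemma closed_form_continuous (P : R -> R) (x0 p : R) :
  (forall e : R, 0 < e -> exists2 d : R, 0 < d & forall x, `|x - x0| <= d ->
     `|P x - P x0 - p * (x - x0)| <= e * `|x - x0|) -> {for x0, continuous P}.
Proof.
move=> H; apply: differentiable_continuous; apply/derivable1_diffP.
apply/cvg_ex; exists p; apply/cvgrPdist_le => e e0.
have [d d0 Hd] := H e e0.
near=> h.
have h0 : h != 0 by near: h; exact: nbhs_dnbhs_neq.
have hd : `|h| <= d by near: h; apply: dnbhs0_le.
have := Hd (h + x0); rewrite addrK => /(_ hd) Hh.
rewrite distrC [_ *: 1]mulr1 /= -[_ *: _]/(_ * _).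
have -> : h^-1 * (P (h + x0) - P x0) - p = h^-1 * (P (h + x0) - P x0 - p * h).
  by rewrite [RHS]mulrBr (mulrC p) (mulrA _ h) mulVf // mul1r.
by rewrite normrM normfV ler_pdivrMl ?normr_gt0 // (mulrC `|h| e).
Unshelve. all: by end_near. Qed.

Lemma continuous_bounded (u : R -> R) (a b : R) : continuous u -> a <= b ->
  exists2 M, 0 < M & forall x, a <= x <= b -> `|u x| <= M.
Proof.
move=> cu ab.
have cn : {within `[a, b], continuous (fun x => `|u x|)}.
  apply: continuous_subspaceT => x; apply: continuous_comp; first exact: cu.
  exact: norm_continuous.
have [c _ Hc] := EVT_max ab cn.
exists (`|u c| + 1) => [|x xab]; first by rewrite ltr_wpDl.
by apply: (le_trans (Hc _ _)); rewrite ?in_itv // lerDl.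
Qed.

(** The powers of r / k tend to 0. *)
Lemma geometric_gap (k r C1 : R) : 0 <= r < k -> 0 < C1 ->
  exists N : nat, C1 * r ^+ N < k ^+ N.
Proof.
move=> /andP[r0 rk] C10; have k0 : 0 < k := le_lt_trans r0 rk.
have q : `|r / k| < 1.
  by rewrite ger0_norm ?divr_ge0 ?(ltW k0) // ltr_pdivrMr // mul1r.
have /cvgrPdist_lt /(_ C1^-1) := cvg_expr q.
rewrite invr_gt0 => /(_ C10) [N _ /(_ N (leqnn N))] /=.
rewrite sub0r normrN ger0_norm ?exprn_ge0 ?divr_ge0 ?(ltW k0) //.
rewrite expr_div_n ltr_pdivrMr ?exprn_gt0 // => h; exists N.
by rewrite -ltr_pdivlMl // mulrC.
Qed.

End ComplexDerivative.

Section DerivativeRules.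
Context {R : realType}.
Local Notation C := R[i].
Local Notation normc := (@ComplexField.Normc.normc R).
Implicit Types (f g : C -> C) (z w d : C) (p : {poly C}).

Lemma cderivative_unique f z d1 d2 : cderivative f z d1 -> cderivative f z d2 -> d1 = d2.
Proof.
move=> H1 H2; apply/eqP; rewrite -subr_eq0; apply/eqP.
apply: (@ComplexField.Normc.eq0_normc R).
apply/eqP; rewrite eq_le normc_ge0 andbT; apply/ler_addgt0Pr => e e0; rewrite add0r.
have e2 : 0 < e / 2 by rewrite divr_gt0.
have [a a0 Ha] := H1 _ e2; have [b b0 Hb] := H2 _ e2.
pose r := Num.min a b; have r0 : 0 < r by rewrite lt_min a0.
have wE : z + r%:C%C - z = r%:C%C by rewrite addrAC subrr add0r.
have nr : normc r%:C%C = r by rewrite normcC ger0_norm // ltW.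
have := Ha (z + r%:C%C); have := Hb (z + r%:C%C); rewrite wE nr.
rewrite /r ge_min lexx orbT ge_min lexx -/r => /(_ isT) h1 /(_ isT) h2.
have -> : normc (d1 - d2) = normc ((f (z + r%:C%C) - f z - d2 * r%:C%C) -
    (f (z + r%:C%C) - f z - d1 * r%:C%C)) / r.
  rewrite (_ : f (z + r%:C%C) - f z - d2 * r%:C%C - (f (z + r%:C%C) - f z - d1 * r%:C%C) =
     (d1 - d2) * r%:C%C); last by ring.
  by rewrite ComplexField.Normc.normcM nr mulfK // gt_eqF.
rewrite ler_pdivrMr //; apply: (le_trans (normc_triang _ _)); rewrite normcN.
by apply: (le_trans (lerD h1 h2)); rewrite -mulrDl -splitr.
Qed.

Lemma cderivative_sum (I : Type) (s : seq I) (F : I -> C -> C) (d : I -> C) z :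
  (forall i, cderivative (F i) z (d i)) ->
  cderivative (fun w => \sum_(i <- s) F i w) z (\sum_(i <- s) d i).
Proof.
move=> H; elim: s => [|i s IH].
  by under eq_fun do rewrite big_nil; rewrite big_nil; exact: cderivative_cst.
by under eq_fun do rewrite big_cons; rewrite big_cons; exact: cderivativeD.
Qed.

Lemma cderivativeZ (a : C) f z d : cderivative f z d ->
  cderivative (fun w => a * f w) z (a * d).
Proof.
by move=> /(cderivativeM (cderivative_cst a z)); rewrite mul0r add0r.
Qed.

Lemma cderivative_horner p z : cderivative (fun w => p.[w]) z p^`().[z].
Proof.
elim/poly_ind: p => [|p c IH].
  under eq_fun do rewrite horner0; rewrite deriv0 horner0; exact: cderivative_cst.
have -> : (fun w => (p * 'X + c%:P).[w]) = fun w => p.[w] * w + c.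
  by apply/funext => w; rewrite hornerMXaddC.
have -> : (p * 'X + c%:P)^`().[z] = (p^`().[z] * z + p.[z] * 1) + 0.
  by rewrite derivMXaddC hornerD hornerMX; ring.
apply: cderivativeD; last exact: cderivative_cst.
by apply: cderivativeM => //; exact: cderivative_id.
Qed.
End DerivativeRules.

(** * Holomorphic functions that vanish on the real line *)

Section ZeroOnReals.
Context {R : realType}.
Local Notation C := R[i].
Local Notation normc := (@ComplexField.Normc.normc R).
Implicit Types (f g : C -> C) (z w d : C).

Lemma ex_cderivativeX f n : (forall z, exists d, cderivative f z d) ->
  forall z, exists d, cderivative (fun w => f w ^+ n) z d.
Proof.
move=> Hf z; elim: n => [|n [d IH]].
  by exists 0; rewrite /=; under eq_fun do rewrite expr0; exact: cderivative_cst.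
have [d1 H1] := Hf z; eexists; under eq_fun do rewrite exprS.
exact: cderivativeM H1 IH.
Qed.

(** 1 - (z - i)^2 / 25. On the line Im z = 1 it is real, with its maximum 1 at i; on the vertical
    sides of [-5, 5] x [0, 1] its modulus is at most 1/2. *)
Definition peak z : C := 1 + (- 25^-1) * ((z + - 'i%C) * (z + - 'i%C)).

Lemma peakE (x y : R) : peak (x +i* y)%C =
  ((1 - (x ^+ 2 - (1 - y) ^+ 2) / 25) +i* (2 * x * (1 - y) / 25))%C.
Proof.
have E : (25^-1 : C) = (25^-1)%:C%C by rewrite fmorphV rmorph_nat.
by rewrite /peak E; apply/eqP; rewrite eq_complex /=; apply/andP; split; apply/eqP; field.
Qed.

Lemma ex_cderivative_peak z : exists d, cderivative peak z d.
Proof.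
have H : cderivative (fun w => w + - 'i%C) z (1 + 0).
  exact: cderivativeD (@cderivative_id R z) (@cderivative_cst R (- 'i%C) z).
eexists; apply: cderivativeD; first exact: cderivative_cst.
apply: cderivativeM; first exact: cderivative_cst.
have H2 := cderivativeM H H; exact: H2.
Qed.

(** Apply Goursat's theorem to h = g peak^N on [-5, 5] x [0, 1]. The bottom side contributes
    nothing if g vanishes there, and the vertical sides contribute O(2^-N). On the top side
    the integrand concentrates near i, where the real part of g is at least 1/2, so that
    the real part of the integral is at least of the order of k^N minus O(r^N), with
    k > r >= 1/2. For large N the four sides cannot cancel. *)
Lemma normalized_not_zero_on_reals g : (forall z, exists d, cderivative g z d) ->
  (forall x : R, g x%:C%C = 0) -> g 'i%C <> 1.
Proof.
move=> dg g0 gi.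
have cP (h : C -> C) : (forall z, exists d, cderivative h z d) ->
    (forall y : R, continuous (fun x : R => complex.Re (h (x +i* y)%C))) /\
    (forall x : R, continuous (fun y : R => - complex.Im (h (x +i* y)%C))) .
  move=> /cderivative_closed_form cf; split=> [y|x] t.
    have [p1 [p2 [q2 H]]] := cf t y; apply: (@closed_form_continuous R _ _ p1).
    move=> e e0; have [d d0 Hd] := H e e0; exists d => // x xd.
    have [|E _] := Hd x y xd; first by rewrite subrr normr0 ltW.
    by move: E; rewrite subrr mulr0 subr0 normr0 addr0.
  have [p1 [p2 [q2 H]]] := cf x t; apply: (@closed_form_continuous R _ _ q2).
  move=> e e0; have [d d0 Hd] := H e e0; exists d => // y yd.
  have [|_ E] := Hd x y _ yd; first by rewrite subrr normr0 ltW.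
  by move: E; rewrite subrr mulr0 subr0 normr0 add0r.
have [gRe gIm] := cP g dg.
have dgi : forall z, exists d, cderivative (fun w => 'i%C * g w) z d.
  move=> z; have [d Hd] := dg z; eexists.
  exact: cderivativeM (@cderivative_cst R 'i%C z) Hd.
have [igRe igIm] := cP _ dgi.
have iRe z : complex.Re ('i%C * z) = - complex.Im z by case: z => a b /=; ring.
have iIm z : complex.Im ('i%C * z) = complex.Re z by case: z => a b /=; ring.
have bnd (u v : R -> R) (a b : R) : continuous u -> continuous v -> a <= b ->
    exists2 M : R, 0 < M & forall x : R, a <= x <= b -> `|u x| + `|v x| <= M.
  move=> cu cv ab; have [M1 M10 H1] := continuous_bounded cu ab.
  have [M2 M20 H2] := continuous_bounded cv ab; exists (M1 + M2); first exact: addr_gt0.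
  by move=> x xab; apply: lerD; [exact: H1|exact: H2].
have [Mt Mt0 Ht] := @bnd _ _ (-5) 5 (gRe 1) (igRe 1) ltac:(lra).
have [Ml Ml0 Hl] := @bnd _ _ 0 1 (gIm (-5)) (igIm (-5)) ltac:(lra).
have [Mr Mr0 Hr] := @bnd _ _ 0 1 (gIm 5) (igIm 5) ltac:(lra).
(* near the point i, the function keeps a real part above 1/2 *)
have [d d01 Hd] : exists2 d : R, 0 < d <= 1 &
    forall x : R, `|x| <= d -> 2^-1 <= complex.Re (g (x +i* 1)%C).
  have /cvgrPdist_le /(_ 2^-1) := gRe 1 0.
  rewrite invr_gt0 ltr0n => /(_ isT) /nbhs_ballP [d /= d0 H].
  exists (Num.min (d / 2) 1); first by rewrite lt_min divr_gt0 // ltr01 ge_min lexx orbT.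
  move=> x; rewrite le_min => /andP[xd _].
  have := H x; rewrite /ball /= sub0r normrN => /(_ _) h.
  have {}h := h ltac:(lra).
  rewrite (_ : (0 +i* 1)%C = 'i%C) // gi /= ler_norml in h; lra.
have /andP[d0 d1] := d01.
(* peak >= k on the top side for |x| <= d / 2, and peak <= r there for |x| >= d *)
pose k := 1 - d ^+ 2 / 100; pose r := 1 - d ^+ 2 / 25.
have dd : 0 < d ^+ 2 <= 1 by rewrite exprn_gt0 //= -(expr1n R 2) lerXn2r ?nnegrE // ltW.
have [N HN] := @geometric_gap R k r ((10 * Mt + (Ml + Mr)) / (d / 2))
   ltac:(rewrite /k /r; lra) ltac:(rewrite divr_gt0 //; lra).
have r2 : 2^-1 <= r by rewrite /r; lra.
have {}HN : 10 * Mt * r ^+ N + (Ml + Mr) * 2^-1 ^+ N < k ^+ N * (d / 2).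
  move: HN; rewrite mulrAC ltr_pdivrMr ?divr_gt0 //; apply: le_lt_trans.
  by rewrite [leRHS]mulrDl lerD2l ler_pM2l ?addr_gt0 // lerXn2r ?nnegrE //; lra.
pose h z := g z * peak z ^+ N.
have dh : forall z, exists e, cderivative h z e.
  move=> z; have [e1 H1] := dg z.
  have [e2 H2] := ex_cderivativeX N ex_cderivative_peak z.
  by eexists; exact: cderivativeM H1 H2.
have [hRe hIm] := cP h dh.
have exIP y := @ex_primitive R _ (-6) (hRe y).
have exIQ x := @ex_primitive R _ (-6) (hIm x).
have {exIP}[IP dIP'] := choice exIP; have {exIQ}[IQ dIQ'] := choice exIQ.
have dIP (x y : R) : -6 < x -> is_derive x 1 (IP y) (complex.Re (h (x +i* y)%C)).
  exact: dIP'.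
have dIQ (x y : R) : -6 < y -> is_derive y 1 (IQ x) (- complex.Im (h (x +i* y)%C)).
  exact: dIQ'.
have := @goursat R (-6) _ _ IP IQ dIP dIQ (cderivative_closed_form dh) (-5) 0 10 1
  ltac:(lra) ltac:(lra) ltac:(lra) ltac:(lra).
rewrite /rect_integral add0r (_ : -5 + 10 = 5 :> R); last by ring.
(* h vanishes on the bottom side *)
have -> : IP 0 5 - IP 0 (-5) = 0.
  have [|x /andP[hx _]|c _ ->] := @mean_value R (IP 0)
      (fun x => complex.Re (h (x +i* 0)%C)) (-5) 5; [lra| |].
    by apply: dIP; lra.
  by rewrite /h (g0 c) mul0r /= mul0r.
have peak_side (s y : R) : s ^+ 2 = 25 -> `|s| <= 5 -> 0 <= y <= 1 ->
    normc (peak (s +i* y)%C) <= 2^-1.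
  move=> s2 s5 y01; rewrite peakE s2; apply: (le_trans (normc_le_ReIm _)) => /=.
  have -> : 1 - (25 - (1 - y) ^+ 2) / 25 = (1 - y) ^+ 2 / 25 by field.
  have y0 : 0 <= 1 - y by lra.
  have -> : `|(1 - y) ^+ 2 / 25| = (1 - y) ^+ 2 / 25.
    by rewrite ger0_norm // divr_ge0 ?exprn_ge0.
  have -> : `|2 * s * (1 - y) / 25| = 2 * (`|s| * (1 - y)) / 25.
    by rewrite !normrM normfV (ger0_norm y0) !normr_nat; ring.
  have h1 : (1 - y) ^+ 2 <= 1 by rewrite expr2; nra.
  have h2 : `|s| * (1 - y) <= 5 by have := normr_ge0 s; nra.
  lra.
have side (s M : R) : s ^+ 2 = 25 -> `|s| <= 5 -> 0 < M ->
    (forall x : R, 0 <= x <= 1 -> `|- complex.Im (g (s +i* x)%C)| +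
       `|- complex.Im ('i%C * g (s +i* x)%C)| <= M) ->
    `|IQ s 1 - IQ s 0| <= M * 2^-1 ^+ N.
  move=> s2 s5 M0 HM.
  rewrite -[leRHS]mulr1 -[X in _ * X](subr0 1).
  apply: (mean_value_norm_le (g := fun y => - complex.Im (h (s +i* y)%C))); first lra.
    by move=> y y01; apply: dIQ; lra.
  move=> y y01; rewrite normrN; apply: (le_trans (Im_le_normc _)).
  rewrite /h ComplexField.Normc.normcM normcX.
  apply: ler_pM; rewrite ?exprn_ge0 ?normc_ge0 //.
    apply: (le_trans (normc_le_ReIm _)); apply: le_trans (HM _ y01).
    by rewrite !normrN iIm addrC.
  by rewrite lerXn2r ?nnegrE ?normc_ge0 // peak_side.
have hl := side (-5) Ml ltac:(by ring) ltac:(by rewrite normrN ger0_norm) Ml0 Hl.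
have hr := side 5 Mr ltac:(by ring) ltac:(by rewrite ger0_norm) Mr0 Hr.
have hE x : complex.Re (h (x +i* 1)%C) =
    complex.Re (g (x +i* 1)%C) * (1 - x ^+ 2 / 25) ^+ N.
  rewrite /h peakE subrr expr0n /= subr0 mulr0 mul0r.
  rewrite -[((1 - _) +i* 0)%C]/((1 - x ^+ 2 / 25)%:C%C) -rmorphXn cReM /=.
  by rewrite mulr0 subr0.
have kpos (x : R) : -5 <= x <= 5 -> 0 <= 1 - x ^+ 2 / 25.
  move=> /andP[x1 x2]; rewrite subr_ge0 ler_pdivrMr // mul1r; nra.
have outer (a b : R) : a <= b -> b - a <= 5 -> -5 <= a -> b <= 5 ->
    (forall x : R, a <= x <= b -> d <= `|x|) -> `|IP 1 b - IP 1 a| <= 5 * Mt * r ^+ N.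
  move=> ab ba5 a5 b5 Hx; apply: (@le_trans _ _ (Mt * r ^+ N * (b - a))).
    apply: (mean_value_norm_le (g := fun x => complex.Re (h (x +i* 1)%C))) => //.
      by move=> x xab; apply: dIP; lra.
    move=> x xab; rewrite hE normrM; apply: ler_pM => //.
      by apply: le_trans (Ht x _); [rewrite lerDl|lra].
    rewrite ger0_norm ?exprn_ge0 ?kpos //; last lra.
    rewrite lerXn2r ?nnegrE ?kpos //; [|rewrite /r; lra|].
      lra.
    rewrite /r lerD2l lerN2 ler_pM2r ?invr_gt0 //.
    by rewrite -[x ^+ 2]real_normK ?num_real // lerXn2r ?nnegrE ?Hx // ltW.
  have r0 : 0 <= r by lra.
  by rewrite mulrC mulrA ler_wpM2r ?exprn_ge0 // ler_wpM2r // ltW.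
have posIP (a b : R) : a <= b -> -d <= a -> b <= d -> IP 1 a <= IP 1 b.
  move=> ab ad bd; rewrite -subr_ge0.
  have [|c cab ->] := @mean_value R (IP 1)
      (fun x => complex.Re (h (x +i* 1)%C)) a b ab.
    by move=> x xab; apply: dIP; lra.
  rewrite hE mulr_ge0 ?subr_ge0 // mulr_ge0 //.
    by have := Hd c; rewrite ler_norml; lra.
  by rewrite exprn_ge0 // kpos //; lra.
have mid : k ^+ N * (d / 2) <= IP 1 (d / 2) - IP 1 (- (d / 2)).
  have [|x xab|c cab ->] := @mean_value R (IP 1)
      (fun x => complex.Re (h (x +i* 1)%C)) (- (d / 2)) (d / 2); first lra.
    by apply: dIP; lra.
  rewrite hE opprK -splitr.
  have hc : 2^-1 <= complex.Re (g (c +i* 1)%C) by apply: Hd; rewrite ler_norml; lra.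
  have hk : k ^+ N <= (1 - c ^+ 2 / 25) ^+ N.
    have hc2 : c ^+ 2 <= (d / 2) ^+ 2.
      by rewrite -[c ^+ 2]real_normK ?num_real // lerXn2r ?nnegrE ?ler_norml //; lra.
    rewrite lerXn2r ?nnegrE //; rewrite /k; [lra|apply: kpos; lra|].
    by move: hc2; rewrite expr_div_n; lra.
  have hk0 : 0 <= k ^+ N by rewrite exprn_ge0 // /k; lra.
  have h1 : 2^-1 * k ^+ N <= complex.Re (g (c +i* 1)%C) * (1 - c ^+ 2 / 25) ^+ N.
    by apply: ler_pM => //; lra.
  have := ler_wpM2r (ltW d0) h1; lra.
have o1 := outer (-5) (-d) ltac:(lra) ltac:(lra) ltac:(lra) ltac:(lra)
  ltac:(by move=> x xa; rewrite ler0_norm; lra).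
have o2 := outer d 5 ltac:(lra) ltac:(lra) ltac:(lra) ltac:(lra)
  ltac:(by move=> x xa; rewrite ger0_norm; lra).
have m1 := posIP (-d) (- (d / 2)) ltac:(lra) ltac:(lra) ltac:(lra).
have m2 := posIP (d / 2) d ltac:(lra) ltac:(lra) ltac:(lra).
move: hl hr o1 o2; rewrite !ler_norml => /andP[l1 l2] /andP[r1 r3] /andP[p1 p2] /andP[q1 q2].
move=> J0; clear gi; lra.
Qed.

Lemma zero_on_reals g : (forall z, exists d, cderivative g z d) ->
  (forall x : R, g x%:C%C = 0) -> g 'i%C = 0.
Proof.
move=> dg g0; apply/eqP/negPn/negP => gi0.
apply: (@normalized_not_zero_on_reals (fun w => (g 'i%C)^-1 * g w)).
- move=> z; have [d Hd] := dg z; eexists.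
  exact: cderivativeM (@cderivative_cst R _ z) Hd.
- by move=> x; rewrite g0 mulr0.
- by rewrite mulVf.
Qed.
End ZeroOnReals.

(** * Lebesgue measure on tuples *)

Section LebesgueTuple.
Context {R : realType}.
Local Notation mR := (measurableTypeR R).
Local Notation mu := (@lebesgue_tuple R).

Lemma measurable_box n (c : 'I_n -> R) (e : R) :
  measurable [set t : n.-tuple mR | forall i, `|tnth t i - c i| < e].
Proof.
rewrite [X in measurable X](_ : _ = \bigcap_(i in [set: 'I_n])
      ((@tnth _ mR) ^~ i @^-1` [set x | `|x - c i| < e])).
  apply: fin_bigcap_measurable => [|i _]; first exact: finite_finset.
  rewrite -[X in measurable X]setTI; apply: measurable_tnth => //.
  rewrite (_ : [set x | _] = ball (c i : R) e); first exact: measurable_ball.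
  by apply/seteqP; split => x /=; rewrite /ball /= distrC.
by apply/seteqP; split=> t /= h i; [move=> _|]; apply: h.
Qed.

(** The sigma-algebra on tuples is the product one: an open preimage is the union of the
    countably many boxes with rational centers and radii 1 / (k + 1) that it contains. *)
Lemma continuous_measurable_row n (g : 'rV[R]_n -> R) : continuous g ->
  measurable_fun setT (g \o @row_of_tuple R n : n.-tuple mR -> R).
Proof.
move=> cg; apply: (measurability (@RGenOInfty.G R)); first exact: RGenOInfty.measurableE.
move=> _ [_ [a ->] <-]; rewrite setTI comp_preimage.
set U := g @^-1` _.
have oU : open U by apply: open_comp; [move=> x _; exact: cg|exact: interval_open].
pose B (p : 'rV[rat]_n * nat) := [set t : n.-tuple mR |
  forall i, `|tnth t i - ratr (p.1 0 i)| < p.2.+1%:R^-1].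
pose F p := if pselect (B p `<=` @row_of_tuple R n @^-1` U) then B p else set0.
rewrite [X in measurable X](_ : _ = \bigcup_p F p).
  apply: countable_bigcupT_measurable => [|p]; first exact: countableP.
  rewrite /F; case: pselect => h; first exact: (@measurable_box n (fun i => ratr (p.1 0 i))).
  exact: measurable0.
apply/seteqP; split=> [t Ut|t [p _]]; last by rewrite /F; case: pselect => // h /h.
have /nbhs_ballP[e /= e0 He] : nbhs (row_of_tuple t) U by exact: open_nbhs_nbhs.
have [k Hk] : exists k : nat, k.+1%:R^-1 < e / 2.
  have [N _ /(_ N (leqnn N))] := near_infty_natSinv_lt (PosNum (divr_gt0 e0 (ltr0n R 2))).
  by move=> /= h; exists N.
have k0 : 0 < k.+1%:R^-1 :> R by rewrite invr_gt0.
have q i : exists q : rat, `|tnth t i - ratr q| < k.+1%:R^-1.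
  move: (tnth t i : R) (k.+1%:R^-1 : R) k0 => x r r0.
  have [|q] := @rat_in_itvoo R (x - r) (x + r); first by lra.
  by rewrite in_itv /= => h; exists q; rewrite ltr_norml; lra.
pose p : 'rV[rat]_n * nat := (\row_i projT1 (cid (q i)), k).
suff BU : B p `<=` @row_of_tuple R n @^-1` U.
  exists p => //; rewrite /F; case: pselect => [h|/(_ BU)//].
  by move=> i /=; rewrite mxE; case: cid.
move=> t' Bt' /=; apply: He; split => // i j; rewrite /ball /= !mxE.
have := Bt' j; rewrite /= mxE; case: cid => q0 /= h1 h2.
rewrite (_ : _ - _ = (tnth t j - ratr q0) - (tnth t' j - ratr q0)); last by ring.
apply: (le_lt_trans (ler_normB _ _)); apply: (lt_trans (ltrD h1 h2)).
by rewrite [ltRHS]splitr; apply: ltrD.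
Qed.

Lemma integral_lebesgue_tupleS n (g : n.+1.-tuple mR -> \bar R) :
  measurable_fun setT g -> (forall t, 0 <= g t)%E ->
  (\int[mu n.+1]_t g t =
   \int[@lebesgue_measure R]_x \int[mu n]_t g (cons_pair (x, t)))%E.
Proof.
move=> mg g0.
have mc : measurable_fun setT (@cons_pair R n) by exact: measurable_cons.
rewrite /= /lebesgue_cons ge0_integral_pushforward // preimage_setT.
rewrite (fubini_tonelli1 (g \o @cons_pair R n)) //=.
exact: measurableT_comp.
Qed.

Lemma lebesgue_measure_shift (a : R) (A : set mR) : measurable A ->
  lebesgue_measure (+%R a @^-1` A) = lebesgue_measure A.
Proof.
have ma : measurable_fun [set: mR] (+%R a : mR -> mR).
  by apply: continuous_measurable_fun => x; apply: cvgD; [exact: cvg_cst|exact: cvg_id].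
move=> mA; apply/esym.
pose phi : {mfun mR >-> mR} := HB.pack (+%R a : mR -> mR)
  (isMeasurableFun.Build _ _ _ _ _ ma).
apply: (@lebesgue_measure_unique R (pushforward lebesgue_measure phi)) => //.
move=> _ [[x y] _ <-]; rewrite /= /pushforward /=.
have -> : +%R a @^-1` `]x, y] = `]x - a, y - a]%classic.
  by apply/seteqP; split=> z /=; rewrite !in_itv /=; lra.
rewrite !lebesgue_measure_itv /= !lte_fin ltrD2r.
by case: ifP => // _; rewrite -!EFinD; congr (_%:E); ring.
Qed.

Lemma integral_shift1 (a : R) (g : mR -> \bar R) :
  measurable_fun setT g -> (forall t, 0 <= g t)%E ->
  (\int[@lebesgue_measure R]_x g (a + x)%R = \int[@lebesgue_measure R]_x g x)%E.
Proof.
move=> mg g0.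
have ma : measurable_fun [set: mR] (+%R a : mR -> mR).
  by apply: continuous_measurable_fun => x; apply: cvgD; [exact: cvg_cst|exact: cvg_id].
have := @ge0_integral_pushforward _ _ mR mR R _ ma lebesgue_measure setT g
   measurableT mg (fun t _ => g0 t).
rewrite preimage_setT /= => <-.
apply: eq_measure_integral => A mA _; exact: lebesgue_measure_shift.
Qed.

Definition shift_tuple n (a : 'rV[R]_n) (t : n.-tuple mR) : n.-tuple mR :=
  [tuple a 0 i + tnth t i | i < n].

Lemma row_of_shift n (a : 'rV[R]_n) t :
  row_of_tuple (shift_tuple a t) = a + row_of_tuple t.
Proof. by apply/rowP => j; rewrite !mxE tnth_mktuple. Qed.

Lemma measurable_shift_tuple n (a : 'rV[R]_n) : measurable_fun setT (shift_tuple a).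
Proof.
apply/measurable_fun_tnthP => i.
rewrite (_ : _ \o _ = fun t : n.-tuple mR => a 0 i + tnth t i); last first.
  by apply/funext => t /=; rewrite tnth_mktuple.
by apply: measurable_funD => //; exact: measurable_tnth.
Qed.

Lemma integral_shift_tuple n (a : 'rV[R]_n) (g : n.-tuple mR -> \bar R) :
  measurable_fun setT g -> (forall t, 0 <= g t)%E ->
  (\int[mu n]_t g (shift_tuple a t) = \int[mu n]_t g t)%E.
Proof.
elim: n a g => [|n IH] a g mg g0.
  by apply: eq_integral => t _; congr g; apply/eq_from_tnth => -[].
have mc : measurable_fun setT (@cons_pair R n) by exact: measurable_cons.
have mcx x : measurable_fun setT (fun t : n.-tuple mR => cons_pair (x, t)).
  by apply: measurableT_comp => //; exact: pair1_measurable.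
rewrite !integral_lebesgue_tupleS //; last first.
  by apply: measurableT_comp => //; exact: measurable_shift_tuple.
pose a' : 'rV[R]_n := \row_i a 0 (lift ord0 i).
have E x t : shift_tuple a (cons_pair (x, t)) = cons_pair (a 0 ord0 + x, shift_tuple a' t).
  apply/eq_from_tnth => i; rewrite tnth_mktuple.
  case: (unliftP ord0 i) => [j ->|->] //.
  by rewrite !tnthS tnth_mktuple mxE.
under eq_integral => x _.
  under eq_integral => t _ do rewrite E.
  rewrite (IH a' (fun t => g (cons_pair (a 0 ord0 + x, t)))) //; last first.
    exact: measurableT_comp.
  over.
apply: (@integral_shift1 _ (fun x => \int[mu n]_t g (cons_pair (x, t)))%E).
  apply: (measurable_fun_fubini_tonelli_F (m2 := mu n) (g \o @cons_pair R n)) => //.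
  exact: measurableT_comp.
  by move=> x; exact: g0.
by move=> x; apply: integral_ge0 => t _; exact: g0.
Qed.

Lemma measurable_prod_tuple n (g : 'I_n -> R -> R) :
  (forall i, measurable_fun setT (g i)) ->
  measurable_fun setT (fun t : n.-tuple mR => (\prod_i g i (tnth t i))%:E).
Proof.
move=> mg; apply/measurable_EFinP.
apply: (measurable_prod (D := setT) (s := index_enum 'I_n)
  (h := fun i (t : n.-tuple mR) => g i (tnth t i))) => i _.
exact: (measurableT_comp (mg i) (measurable_tnth i)).
Qed.

Lemma integral_prod_tuple n (g : 'I_n -> R -> R) :
  (forall i, measurable_fun setT (g i)) -> (forall i x, 0 <= g i x) ->
  (\int[mu n]_t (\prod_i g i (tnth t i))%:E =
   \prod_i \int[@lebesgue_measure R]_x (g i x)%:E)%E.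
Proof.
elim: n g => [|n IH] g mg g0.
  rewrite big_ord0 /= integral_dirac //; last exact: measurable_prod_tuple.
  by rewrite [X in (X * _)%E](_ : _ = 1%E) ?mul1e ?big_ord0 // /dirac indicT.
rewrite integral_lebesgue_tupleS; first last.
- by move=> t; rewrite lee_fin prodr_ge0.
- exact: measurable_prod_tuple.
rewrite big_ord_recl -IH //.
rewrite -ge0_integralZr //; first last.
- by apply: integral_ge0 => t _; rewrite lee_fin prodr_ge0.
- by move=> x _; rewrite lee_fin.
- by apply/measurable_EFinP; exact: mg.
apply: eq_integral => x _; rewrite -ge0_integralZl ?lee_fin //; first last.
- by move=> t _; rewrite lee_fin prodr_ge0.
- by apply: (@measurable_prod_tuple n (fun i => g (lift ord0 i))) => i; exact: mg.
apply: eq_integral => t _; rewrite big_ord_recl -EFinM /=; congr ((_ * _)%:E).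
by apply: eq_bigr => i _; rewrite tnthS.
Qed.
End LebesgueTuple.

(** * Integration over row vectors *)

Section VectorIntegral.
Context {R : realType} {m : nat}.
Local Notation mR := (measurableTypeR R).
Local Notation mu := (@lebesgue_tuple R m).
Local Notation E := 'rV[R]_m.
Implicit Types (g h : E -> R).

(** Lebesgue measure is carried by tuples, so functions of row vectors are integrated
    through [row_of_tuple]. *)
Definition vmeasurable g := measurable_fun setT (g \o @row_of_tuple R m).
Definition vintegrable g := mu.-integrable setT (EFin \o (g \o @row_of_tuple R m)).
Definition vint g : R := \int[mu]_t g (row_of_tuple t).

Lemma vintE g : vint g = \int[mu]_t g (row_of_tuple t).
Proof. by []. Qed.

Lemma vmeasurable_cst c : vmeasurable (fun=> c).
Proof. exact: measurable_cst. Qed.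
Lemma vmeasurableD g h : vmeasurable g -> vmeasurable h -> vmeasurable (fun y => g y + h y).
Proof. exact: measurable_funD. Qed.
Lemma vmeasurableM g h : vmeasurable g -> vmeasurable h -> vmeasurable (fun y => g y * h y).
Proof. exact: measurable_funM. Qed.
Lemma vmeasurableN g : vmeasurable g -> vmeasurable (fun y => - g y).
Proof. exact: measurable_funN. Qed.
Lemma vmeasurable_comp (u : R -> R) g : continuous u -> vmeasurable g ->
  vmeasurable (fun y => u (g y)).
Proof. by move=> /continuous_measurable_fun mu mg; exact: measurableT_comp. Qed.
Lemma vmeasurable_sum I (s : seq I) (g : I -> E -> R) :
  (forall i, vmeasurable (g i)) -> vmeasurable (fun y => \sum_(i <- s) g i y).
Proof. by move=> mg; apply: measurable_sum. Qed.
Lemma vmeasurable_coord j : vmeasurable (fun y => y 0 j).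
Proof.
rewrite /vmeasurable (_ : _ \o _ = (@tnth _ mR ^~ j)); first exact: measurable_tnth.
by apply/funext => t; rewrite /= mxE.
Qed.
Lemma vmeasurable_continuous g : continuous g -> vmeasurable g.
Proof. exact: continuous_measurable_row. Qed.

Lemma vintegrable_measurable g : vintegrable g -> vmeasurable g.
Proof. by move=> /measurable_int /measurable_EFinP. Qed.

Lemma vintegrable_le g h : vmeasurable g -> (forall y, `|g y| <= h y) ->
  vintegrable h -> vintegrable g.
Proof.
move=> mg gh; apply: le_integrable => //; first exact/measurable_EFinP.
move=> t _ /=; rewrite lee_fin (le_trans (gh _)) //; exact: ler_norm.
Qed.

Lemma vintegrable0 : vintegrable (fun=> 0).
Proof. exact: integrable0. Qed.
Lemma vintegrableD g h : vintegrable g -> vintegrable h -> vintegrable (fun y => g y + h y).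
Proof. move=> ig ih; exact: (integrableD measurableT ig ih). Qed.
Lemma vintegrableZ c g : vintegrable g -> vintegrable (fun y => c * g y).
Proof. move=> ig; exact: (integrableZl measurableT c ig). Qed.
Lemma vintegrableB g h : vintegrable g -> vintegrable h -> vintegrable (fun y => g y - h y).
Proof. move=> ig ih; exact: (integrableB measurableT ig ih). Qed.
Lemma vintegrable_norm g : vintegrable g -> vintegrable (fun y => `|g y|).
Proof. move=> ig; exact: (integrable_norm ig). Qed.
Lemma vintegrable_sum (I : eqType) (s : seq I) (g : I -> E -> R) :
  (forall i, vintegrable (g i)) -> vintegrable (fun y => \sum_(i <- s) g i y).
Proof.
move=> ig; elim: s => [|i s IH].
  by under eq_fun do rewrite big_nil; exact: vintegrable0.
by under eq_fun do rewrite big_cons; exact: vintegrableD.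
Qed.

Lemma vint0 : vint (fun=> 0) = 0.
Proof. by rewrite /vint Rintegral_cst // mul0r. Qed.
Lemma vintD g h : vintegrable g -> vintegrable h ->
  vint (fun y => g y + h y) = vint g + vint h.
Proof. by move=> ig ih; rewrite /vint RintegralD. Qed.
Lemma vintB g h : vintegrable g -> vintegrable h ->
  vint (fun y => g y - h y) = vint g - vint h.
Proof. by move=> ig ih; rewrite /vint RintegralB. Qed.
Lemma vintZ c g : vintegrable g -> vint (fun y => c * g y) = c * vint g.
Proof. by move=> ig; rewrite /vint RintegralZl. Qed.
Lemma vint_sum (I : eqType) (s : seq I) (g : I -> E -> R) :
  (forall i, vintegrable (g i)) ->
  vint (fun y => \sum_(i <- s) g i y) = \sum_(i <- s) vint (g i).
Proof.
move=> ig; elim: s => [|i s IH].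
  by under eq_fun do rewrite big_nil; rewrite vint0 big_nil.
under eq_fun do rewrite big_cons.
by rewrite vintD ?IH ?big_cons //; exact: vintegrable_sum.
Qed.
Lemma vint_ge0 g : (forall y, 0 <= g y) -> 0 <= vint g.
Proof. by move=> g0; apply: Rintegral_ge0. Qed.
Lemma le_vint g h : vintegrable g -> vintegrable h -> (forall y, g y <= h y) ->
  vint g <= vint h.
Proof. by move=> ig ih gh; apply: le_Rintegral. Qed.
Lemma le_norm_vint g : vintegrable g -> `|vint g| <= vint (fun y => `|g y|).
Proof. by move=> ig; apply: le_normr_Rintegral. Qed.
Lemma le_norm_vint_le g h : vmeasurable g -> (forall y, `|g y| <= h y) ->
  vintegrable h -> `|vint g| <= vint h.
Proof.
move=> mg gh ih; have ig := vintegrable_le mg gh ih.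
by apply: (le_trans (le_norm_vint ig)); apply: le_vint => //; exact: vintegrable_norm.
Qed.

Lemma EFin_vint g : vintegrable g -> (\int[mu]_t (g (row_of_tuple t))%:E)%E = (vint g)%:E.
Proof. by move=> ig; rewrite /vint /Rintegral fineK //; exact: integrable_fin_num. Qed.

Lemma vint_shift_ereal (a : E) (g : E -> R) : vmeasurable g -> (forall y, 0 <= g y) ->
  (\int[mu]_t (g (a + row_of_tuple t))%:E = \int[mu]_t (g (row_of_tuple t))%:E)%E.
Proof.
move=> mg g0.
rewrite -(@integral_shift_tuple R m a (fun t => (g (row_of_tuple t))%:E)) //.
- by apply: eq_integral => t _; rewrite row_of_shift.
- exact/measurable_EFinP.
- by move=> t; rewrite lee_fin.
Qed.

Lemma vmeasurable_shift (a : E) g : vmeasurable g -> vmeasurable (fun y => g (a + y)).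
Proof.
move=> mg; rewrite /vmeasurable (_ : _ \o _ = (g \o @row_of_tuple R m) \o shift_tuple a).
  by apply: measurableT_comp => //; exact: measurable_shift_tuple.
by apply/funext => t /=; rewrite row_of_shift.
Qed.

Lemma vintegrable_shift (a : E) g : vintegrable g -> vintegrable (fun y => g (a + y)).
Proof.
move=> ig; have mg := vintegrable_measurable ig.
apply/integrableP; split; first by apply/measurable_EFinP; exact: vmeasurable_shift.
have /integrableP[_] := ig; apply: le_lt_trans; rewrite le_eqVlt; apply/orP; left; apply/eqP.
apply: (@vint_shift_ereal a (fun y => `|g y|)) => //.
by apply: vmeasurable_comp => //; exact: norm_continuous.
Qed.

Lemma vint_shift (a : E) g : vintegrable g -> vint (fun y => g (a + y)) = vint g.
Proof.
move=> ig.
have pos h : vintegrable h -> (forall y, 0 <= h y) -> vint (fun y => h (a + y)) = vint h.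
  move=> ih h0; rewrite /vint /Rintegral vint_shift_ereal //.
  exact: vintegrable_measurable.
have in1 := vintegrable_norm ig.
have iN : vintegrable (fun y => `|g y| - g y) by exact: vintegrableB.
have gE : g = fun y => `|g y| - (`|g y| - g y) by apply/funext => y; ring.
rewrite [in RHS]gE [RHS]vintB // -(pos _ in1) // -(pos _ iN); last first.
  by move=> y; rewrite subr_ge0 ler_norm.
rewrite -vintB; first by congr vint; apply/funext => y; ring.
  exact: (vintegrable_shift a in1).
exact: (vintegrable_shift a iN).
Qed.

(** Fubini's theorem and the fundamental theorem of calculus for s in ]0, 1]: the endpoint 0 is
    left out, since it is there that an application below cannot integrate Phi to c. *)
Lemma vint_path (K Phi : R -> E -> R) (c C : R) :
  measurable_fun setT (fun p : mR * m.-tuple mR => Phi p.1 (row_of_tuple p.2)) ->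
  (forall s, 0 < s <= 1 ->
     [/\ vintegrable (Phi s), vint (fun y => `|Phi s y|) <= C & vint (Phi s) = c]) ->
  (forall y s, is_derive (s : R) 1 (K ^~ y) (Phi s y)) ->
  (forall y, continuous (Phi ^~ y)) ->
  vintegrable (K 0) -> vintegrable (K 1) -> vint (K 1) - vint (K 0) = c.
Proof.
move=> mPhi HPhi dK cPhi iK0 iK1.
pose D : set mR := `]0, 1]%classic.
have mD : measurable D by exact: measurable_itv.
pose f (p : mR * m.-tuple mR) := (Phi p.1 (row_of_tuple p.2) * \1_D p.1)%:E.
have mf : measurable_fun setT f.
  apply/measurable_EFinP; apply: measurable_funM => //.
  apply: (measurableT_comp (f := \1_D : mR -> R)); last exact: measurable_fst.
  exact: measurable_indic.
have muD : lebesgue_measure D = 1%E.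
  have := @lebesgue_measure_itv R `]0, 1]; rewrite /= lte_fin ltr01 oppr0 adde0.
  exact.
have D1 : (\int[@lebesgue_measure R]_s (\1_D s)%:E)%E = 1%E.
  by rewrite integral_indic // setIT.
have iD : lebesgue_measure.-integrable setT (EFin \o \1_D : mR -> \bar R).
  apply/integrableP; split; first by apply/measurable_EFinP; exact: measurable_indic.
  under eq_integral => s _ do rewrite /= ger0_norm ?indicE //.
  by under eq_integral do rewrite -indicE; rewrite D1 ltry.
have inD s : \1_D s = (if 0 < s <= 1 then 1 else 0) :> R.
  rewrite indicE; case: ifPn => h.
    by rewrite mem_set // /D /= in_itv.
  by rewrite memNset // /D /= in_itv; exact/negP.
have iF : (lebesgue_measure \x mu)%E.-integrable setT f.
  apply/(integrable12ltyP _ _ mf).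
  have le1 : (\int[@lebesgue_measure R]_s \int[mu]_t `|f (s, t)| <=
     \int[@lebesgue_measure R]_s (C%:E * (\1_D s)%:E))%E.
    apply: ge0_le_integral => //.
    - by move=> s _; apply: integral_ge0.
    - apply: (measurable_fun_fubini_tonelli_F (m2 := mu) (abse \o f)) => //.
        exact: measurableT_comp.
      by move=> s; exact: abse_ge0.
    - apply: emeasurable_funM; first exact: measurable_cst.
      by apply/measurable_EFinP; exact: measurable_indic.
    - move=> s _; rewrite /f /= inD; case: ifPn => h.
        have [i1 le1 _] := HPhi s h; rewrite mule1.
        under eq_integral do rewrite mulr1.
        by move: le1; rewrite -lee_fin -(EFin_vint (vintegrable_norm i1)).
      rewrite mule0; under eq_integral do rewrite mulr0 normr0.
      by rewrite integral0.
  apply: (le_lt_trans le1); rewrite integralZl // D1 mule1; exact: ltry.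
have := Fubini iF.
have -> : (\int[@lebesgue_measure R]_s \int[mu]_t f (s, t) = c%:E)%E.
  rewrite -[RHS]mule1 -D1 -integralZl //; apply: eq_integral => s _.
  rewrite /f /= inD; case: ifPn => h.
    have [i1 _ <-] := HPhi s h; rewrite mule1 -EFin_vint //.
    by under eq_integral do rewrite mulr1.
  by rewrite mule0; under eq_integral do rewrite mulr0; rewrite integral0.
have FTC (y : E) : (\int[@lebesgue_measure R]_s (Phi s y * \1_D s)%:E = (K 1 y - K 0 y)%:E)%E.
  rewrite EFinB -(@continuous_FTC2 R (Phi ^~ y) (K ^~ y) 0 1 ltr01); first last.
  - by move=> s _; rewrite derive1E; have [_] := dK y s.
  - have cK : continuous (K ^~ y) by exact: is_derive1_continuous (dK y).
    split; first by move=> s _; have [] := dK y s.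
      exact: cvg_at_right_filter (cK 0).
    exact: cvg_at_left_filter (cK 1).
  - exact: continuous_subspaceT.
  rewrite -integral_itv_obnd_cbnd; last first.
    apply/measurable_EFinP/measurable_funTS.
    exact: (continuous_measurable_fun (cPhi y)).
  rewrite [RHS]integral_mkcond epatch_indic; apply: eq_integral => s _.
  by rewrite EFinM.
under eq_integral => t _ do rewrite /f /= FTC.
have -> : (\int[mu]_t (K 1 (row_of_tuple t) - K 0 (row_of_tuple t))%:E)%E =
    (vint (K 1) - vint (K 0))%:E.
  by rewrite -vintB // -EFin_vint //; exact: vintegrableB.
by case.
Qed.

Lemma measurable_line (g : E -> R) (v : E) : vmeasurable g ->
  measurable_fun setT (fun p : mR * m.-tuple mR => g (p.1 *: v + row_of_tuple p.2)).
Proof.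
move=> mg.
pose T (p : mR * m.-tuple mR) : m.-tuple mR := [tuple p.1 * v 0 i + tnth p.2 i | i < m].
rewrite (_ : (fun p => _) = (g \o @row_of_tuple R m) \o T); last first.
  by apply/funext => p /=; congr g; apply/rowP => j; rewrite !mxE tnth_mktuple.
apply: measurableT_comp => //; apply/measurable_fun_tnthP => i.
rewrite (_ : _ \o _ = fun p : mR * m.-tuple mR => p.1 * v 0 i + tnth p.2 i); last first.
  by apply/funext => p /=; rewrite tnth_mktuple.
apply: measurable_funD; first by apply: measurable_funM => //; exact: measurable_fst.
exact: (measurableT_comp (measurable_tnth i) measurable_snd).
Qed.

Lemma measurable_dilate (g : E -> R) (x : E) : vmeasurable g ->
  measurable_fun setT (fun p : mR * m.-tuple mR => g (x + p.1 *: row_of_tuple p.2)).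
Proof.
move=> mg.
pose T (p : mR * m.-tuple mR) : m.-tuple mR := [tuple x 0 i + p.1 * tnth p.2 i | i < m].
rewrite (_ : (fun p => _) = (g \o @row_of_tuple R m) \o T); last first.
  by apply/funext => p /=; congr g; apply/rowP => j; rewrite !mxE tnth_mktuple.
apply: measurableT_comp => //; apply/measurable_fun_tnthP => i.
rewrite (_ : _ \o _ = fun p : mR * m.-tuple mR => x 0 i + p.1 * tnth p.2 i); last first.
  by apply/funext => p /=; rewrite tnth_mktuple.
apply: measurable_funD => //; apply: measurable_funM; first exact: measurable_fst.
exact: (measurableT_comp (measurable_tnth i) measurable_snd).
Qed.

Lemma measurable_snd_row (g : E -> R) : vmeasurable g ->
  measurable_fun setT (fun p : mR * m.-tuple mR => g (row_of_tuple p.2)).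
Proof. by move=> mg; exact: (measurableT_comp mg measurable_snd). Qed.

Lemma line_continuous (v y : E) : continuous (fun s : R => s *: v + y).
Proof.
move=> s; apply: cvgD; last exact: cvg_cst.
exact: scalel_continuous.
Qed.

(** By translation invariance the integral of G(s v + y) does not depend on s. *)
Lemma vint_derive (G G' : E -> R) (v : E) : continuous G' ->
  (forall y s, is_derive (s : R) 1 (fun s => G (s *: v + y)) (G' (s *: v + y))) ->
  vintegrable G -> vintegrable G' -> vint G' = 0.
Proof.
move=> cG' dG iG iG'.
have := @vint_path (fun s y => G (s *: v + y)) (fun s y => G' (s *: v + y))
  (vint G') (vint (fun y => `|G' y|)).
rewrite /= !vint_shift // subrr => -> //.
- by apply: measurable_line; exact: vintegrable_measurable.
- move=> s _; split.
  + exact: vintegrable_shift.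
  + by rewrite (vint_shift _ (vintegrable_norm iG')).
  + by rewrite vint_shift.
- move=> y s; apply: (@continuous_comp _ _ _ (fun s : R => s *: v + y) G'); last exact: cG'.
  exact: line_continuous.
- exact: vintegrable_shift.
- exact: vintegrable_shift.
Qed.

End VectorIntegral.

#[global] Opaque vint.

(** * The Gaussian weight *)

Section GaussianWeight.
Context {R : realType} {m : nat}.
Local Notation mR := (measurableTypeR R).
Local Notation mu := (@lebesgue_tuple R m).
Local Notation E := 'rV[R]_m.
Implicit Types (g h k u : E -> R) (y : E).

Lemma square_integrableP g :
  square_integrable g <-> vmeasurable g /\ vintegrable (fun y => g y ^+ 2).
Proof.
split=> [Lg|[mg ig]].
  split; last exact: Lfun2_integrable_sqr Lg.
  by move: Lg; rewrite /square_integrable inE => /andP[/[!inE]].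
rewrite /square_integrable inE; apply/andP; rewrite !inE; split => //=.
rewrite /finite_norm unlock; apply: poweR_lty.
have /integrableP[_] := ig; apply: le_lt_trans.
apply: ge0_le_integral => //.
- by move=> t _; exact: poweR_ge0.
- rewrite (_ : (fun _ => _) = EFin \o (fun t => `|g (row_of_tuple t)| `^ 2)) //.
  apply/measurable_EFinP.
  apply/(@measurableT_comp _ _ _ _ _ _ (fun x : R => x `^ 2)%R) => //.
  by apply: measurableT_comp.
- by apply: measurableT_comp => //; apply/measurable_EFinP; exact: measurable_funX.
- by move=> t _ /=; rewrite lee_fin normrX powR_mulrn.
Qed.

Lemma dotv_ge0 (y : E) : 0 <= dotv y y.
Proof. by apply: sumr_ge0 => j _; rewrite -expr2 sqr_ge0. Qed.

Lemma eucl_norm2 (y : E) : eucl_norm y ^+ 2 = dotv y y.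
Proof. by rewrite sqr_sqrtr // dotv_ge0. Qed.

Lemma gauss1 (s : R) : s != 0 ->
  (\int[@lebesgue_measure R]_x (expR (- x ^+ 2 / (s ^+ 2 *+ 2)))%:E)%E =
  (Num.sqrt (s ^+ 2 * pi *+ 2))%:E.
Proof.
move=> s0; have p0 := normal_peak_gt0 s0.
have E1 x : expR (- x ^+ 2 / (s ^+ 2 *+ 2)) = normal_fun 0 s x.
  by rewrite /normal_fun subr0.
under eq_integral do rewrite E1.
have : (\int[@lebesgue_measure R]_x ((normal_peak s)%:E * (normal_fun 0 s x)%:E) = 1)%E.
  rewrite -(@integral_normal_pdf R 0 s); apply: eq_integral => x _.
  by rewrite normal_pdfE.
rewrite ge0_integralZl //; first last.
- by rewrite lee_fin ltW.
- by move=> x _; rewrite lee_fin; exact: normal_fun_ge0.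
- by apply/measurable_EFinP; exact: measurable_normal_fun.
set I := (X in (_ * X)%E) => H.
have I0 : (0 <= I)%E by apply: integral_ge0 => x _; rewrite lee_fin; exact: normal_fun_ge0.
have : (I = (normal_peak s)^-1%:E * ((normal_peak s)%:E * I))%E.
  by rewrite muleA -EFinM mulVf ?mul1e // gt_eqF.
by rewrite H mule1 /normal_peak invrK.
Qed.

Lemma expR_dotv (a : R) (y : E) : expR (a * dotv y y) = \prod_j expR (a * y 0 j ^+ 2).
Proof.
rewrite /dotv mulr_sumr expR_sum; apply: eq_bigr => j _; by rewrite expr2.
Qed.

Lemma gauss_integral (s : R) : s != 0 ->
  (\int[mu]_t (expR (- (s ^+ 2 *+ 2)^-1 * dotv (row_of_tuple t) (row_of_tuple t)))%:E)%E =
  (Num.sqrt (s ^+ 2 * pi *+ 2) ^+ m)%:E.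
Proof.
move=> s0.
have E1 t : expR (- (s ^+ 2 *+ 2)^-1 * dotv (row_of_tuple t) (row_of_tuple t)) =
    \prod_(i < m) expR (- (tnth t i : R) ^+ 2 / (s ^+ 2 *+ 2)).
  rewrite expR_dotv; apply: eq_bigr => i _; rewrite mxE; congr expR.
  by rewrite !mulNr mulrC.
under eq_integral do rewrite E1.
have mg (i : 'I_m) : measurable_fun setT (fun x : R => expR (- x ^+ 2 / (s ^+ 2 *+ 2))).
  have := measurable_normal_fun (0 : R) s.
  by congr measurable_fun; apply/funext => x; rewrite /normal_fun subr0.
rewrite (@integral_prod_tuple R m (fun _ x => expR (- x ^+ 2 / (s ^+ 2 *+ 2))) mg); last first.
  by move=> i x; exact: expR_ge0.
under eq_bigr do rewrite gauss1 //.
by rewrite prodEFin prodr_const card_ord.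
Qed.

Lemma continuous_coord (j : 'I_m) : continuous (fun y : E => y 0 j).
Proof. exact: coord_continuous. Qed.

Lemma continuous_sumr (T : topologicalType) I (s : seq I) (F : I -> T -> R) :
  (forall i, continuous (F i)) -> continuous (fun x => \sum_(i <- s) F i x).
Proof. by move=> cF; apply: continuous_big => // z; exact: add_continuous. Qed.

Lemma continuous_dotv : continuous (fun y : E => dotv y y).
Proof.
apply: continuous_sumr => j y.
by apply: (@continuousM _ _ (fun y : E => y 0 j) (fun y : E => y 0 j)); exact: continuous_coord.
Qed.

Lemma vmeasurable_dotv : vmeasurable (fun y : E => dotv y y).
Proof. exact: vmeasurable_continuous continuous_dotv. Qed.

Lemma vintegrable_gauss (s : R) : s != 0 ->
  vintegrable (fun y : E => expR (- (s ^+ 2 *+ 2)^-1 * dotv y y)).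
Proof.
move=> s0; apply/integrableP; split.
  apply/measurable_EFinP; apply: (vmeasurable_comp (u := expR)); first exact: continuous_expR.
  by apply: vmeasurableM; [exact: vmeasurable_cst|exact: vmeasurable_dotv].
under eq_integral => t _ do rewrite /= ger0_norm ?expR_ge0 //.
by rewrite gauss_integral // ltry.
Qed.

(** Written as in the inner product, with which it agrees by conversion. *)
Definition gweight (y : E) : R := expR (- eucl_norm y ^+ 2 / 2).

Lemma gweight_gt0 (y : E) : 0 < gweight y.
Proof. exact: expR_gt0. Qed.

Lemma gweightE y : gweight y = expR (- (1 ^+ 2 *+ 2)^-1 * dotv y y).
Proof. by rewrite /gweight eucl_norm2 expr1n; congr expR; rewrite !mulNr mulrC. Qed.

Lemma vint_gweight : vint gweight = (2 * pi) `^ (m%:R / 2).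
Proof.
rewrite vintE /Rintegral; under eq_integral do rewrite gweightE.
rewrite gauss_integral ?oner_neq0 //= expr1n mul1r -mulr_natl.
by rewrite (mulrC m%:R) powRrM powR12_sqrt ?mulr_ge0 ?pi_ge0 // powR_mulrn ?sqrtr_ge0.
Qed.

Lemma vintegrable_gweight : vintegrable gweight.
Proof.
rewrite (_ : gweight = fun y => expR (- (1 ^+ 2 *+ 2)^-1 * dotv y y)).
  exact: vintegrable_gauss (oner_neq0 _).
by apply/funext => y; rewrite gweightE.
Qed.

Lemma vmeasurable_gweight : vmeasurable gweight.
Proof. exact: vintegrable_measurable vintegrable_gweight. Qed.

Definition norm1 (y : E) : R := \sum_j `|y 0 j|.

Lemma norm1_ge0 (y : E) : 0 <= norm1 y.
Proof. exact: sumr_ge0. Qed.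

Lemma coord_le_norm1 (y : E) (j : 'I_m) : `|y 0 j| <= norm1 y.
Proof. by rewrite /norm1 (bigD1 j) //= lerDl sumr_ge0. Qed.

Lemma vmeasurable_norm1 : vmeasurable norm1.
Proof.
apply: vmeasurable_sum => j; apply: (vmeasurable_comp (u := Num.norm)).
  exact: norm_continuous.
exact: vmeasurable_coord.
Qed.

Lemma vmeasurable_exp_norm1 c : vmeasurable (fun y : E => expR (c * norm1 y)).
Proof.
apply: (vmeasurable_comp (u := expR)); first exact: continuous_expR.
by apply: vmeasurableM; [exact: vmeasurable_cst|exact: vmeasurable_norm1].
Qed.

Lemma exp_norm1_gweight_le c (y : E) :
  expR (c * norm1 y) * gweight y <=
  expR (m%:R * c ^+ 2) * expR (- (Num.sqrt 2 ^+ 2 *+ 2)^-1 * dotv y y).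
Proof.
rewrite gweightE -!expRD ler_expR sqr_sqrtr // expr1n.
have -> : m%:R * c ^+ 2 = \sum_(j < m) c ^+ 2 by rewrite sumr_const card_ord mulr_natl.
rewrite /norm1 /dotv !mulr_sumr -!big_split /=; apply: ler_sum => j _.
have -> : y 0 j * y 0 j = `|y 0 j| ^+ 2 by rewrite -expr2 real_normK ?num_real.
have := sqr_ge0 (`|y 0 j| / 2 - c).
move: (`|y 0 j|) => x h.
rewrite -subr_ge0 (_ : _ - _ = (x / 2 - c) ^+ 2) //.
by rewrite !mulr2n; field.
Qed.

(** Functions integrable against every exponential: the class on which the
    Laplace transform is entire. *)
Definition exp_integrable k := vmeasurable k /\
  forall c, vintegrable (fun y => `|k y| * expR (c * norm1 y)).

Lemma exp_integrable_gweight : exp_integrable gweight.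
Proof.
split; first exact: vmeasurable_gweight.
move=> c; apply: (vintegrable_le (h := fun y => expR (m%:R * c ^+ 2) *
    expR (- (Num.sqrt 2 ^+ 2 *+ 2)^-1 * dotv y y))).
- apply: vmeasurableM; last exact: vmeasurable_exp_norm1.
  by apply: vmeasurable_comp; [exact: norm_continuous|exact: vmeasurable_gweight].
- move=> y; rewrite ger0_norm ?mulr_ge0 ?expR_ge0 //.
  by rewrite (ger0_norm (ltW (gweight_gt0 y))) mulrC exp_norm1_gweight_le.
- by apply: vintegrableZ; apply: vintegrable_gauss; rewrite sqrtr_eq0 -ltNge.
Qed.

Lemma exp_integrable_le k k' (C c : R) : vmeasurable k -> 0 <= C ->
  (forall y, `|k y| <= C * expR (c * norm1 y) * `|k' y|) ->
  exp_integrable k' -> exp_integrable k.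
Proof.
move=> mk C0 kk' [_ ik']; split => // d.
apply: (vintegrable_le (h := fun y => C * (`|k' y| * expR ((c + d) * norm1 y)))).
- apply: vmeasurableM; last exact: vmeasurable_exp_norm1.
  by apply: vmeasurable_comp; [exact: norm_continuous|].
- move=> y; rewrite ger0_norm ?mulr_ge0 ?expR_ge0 // mulrDl expRD.
  rewrite (_ : C * _ = C * expR (c * norm1 y) * `|k' y| * expR (d * norm1 y)); last by ring.
  by rewrite ler_wpM2r ?expR_ge0.
- exact/vintegrableZ.
Qed.

Lemma exp_integrableP k c : exp_integrable k ->
  vintegrable (fun y => `|k y| * expR (c * norm1 y)).
Proof. by case. Qed.

Lemma exp_integrable_vintegrable k : exp_integrable k -> vintegrable k.
Proof.
move=> [mk /(_ 0) ik]; apply: vintegrable_le ik => // y.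
by rewrite mul0r expR0 mulr1.
Qed.

Lemma exp_integrableM k (h : E -> R) (C c : R) : 0 <= C -> vmeasurable h ->
  (forall y, `|h y| <= C * expR (c * norm1 y)) ->
  exp_integrable k -> exp_integrable (fun y => k y * h y).
Proof.
move=> C0 mh hC ik; have [mk _] := ik.
apply: (@exp_integrable_le _ k C c) => //; first exact: vmeasurableM.
by move=> y; rewrite normrM mulrC ler_wpM2r.
Qed.

Lemma le_expR_norm1 (x : R) : x <= expR x.
Proof. by have := expR_ge1Dx x; lra. Qed.

(** 2 |u| e^(c |y|) <= u^2 + e^(2 c |y|). *)
Lemma exp_integrable_square u : vmeasurable u ->
  vintegrable (fun y => u y ^+ 2 * gweight y) -> exp_integrable (fun y => u y * gweight y).
Proof.
move=> mum iu; split; first by apply: vmeasurableM => //; exact: vmeasurable_gweight.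
move=> c.
apply: (vintegrable_le (h := fun y => 2^-1 * (u y ^+ 2 * gweight y +
  `|gweight y| * expR ((2 * c) * norm1 y)))).
- apply: vmeasurableM; last exact: vmeasurable_exp_norm1.
  apply: vmeasurable_comp; first exact: norm_continuous.
  by apply: vmeasurableM => //; exact: vmeasurable_gweight.
- move=> y; rewrite ger0_norm ?mulr_ge0 ?expR_ge0 // normrM.
  rewrite !(ger0_norm (ltW (gweight_gt0 y))).
  have -> : expR (2 * c * norm1 y) = expR (c * norm1 y) ^+ 2.
    by rewrite -expRM_natl mulrA.
  rewrite -[u y ^+ 2]real_normK ?num_real //.
  have w0 := gweight_gt0 y; move: (gweight y) w0 (`|u y|) (expR (c * norm1 y)) => w w0 a b.
  rewrite -subr_ge0 (_ : _ - _ = 2^-1 * w * (a - b) ^+ 2); last by field.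
  apply: mulr_ge0; last exact: sqr_ge0.
  by apply: mulr_ge0; [rewrite invr_ge0|exact: ltW].
- apply: vintegrableZ; apply: vintegrableD => //.
  exact: (exp_integrableP (2 * c) exp_integrable_gweight).
Qed.

End GaussianWeight.

(** * Integrals with values in C and in the Clifford algebra *)

Section ComplexIntegral.
Context {R : realType} {m : nat}.
Local Notation E := 'rV[R]_m.
Local Notation C := R[i].
Local Notation Cl := (clifford R m).
Local Notation normc := (@ComplexField.Normc.normc R).
Implicit Types (phi psi : E -> C) (h k : E -> Cl) (y : E).

Definition cintegrable phi :=
  vintegrable (fun y => complex.Re (phi y)) /\ vintegrable (fun y => complex.Im (phi y)).
Definition cint phi : C :=
  (vint (fun y => complex.Re (phi y)) +i* vint (fun y => complex.Im (phi y)))%C.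

Lemma eq_cint phi psi : phi =1 psi -> cint phi = cint psi.
Proof. by move=> /funext ->. Qed.

Lemma cintegrable0 : cintegrable (fun=> 0).
Proof. by split; exact: vintegrable0. Qed.

Lemma cintegrableD phi psi : cintegrable phi -> cintegrable psi ->
  cintegrable (fun y => phi y + psi y).
Proof.
move=> [i1 i2] [j1 j2]; split.
  by under eq_fun do rewrite cReD; exact: vintegrableD.
by under eq_fun do rewrite cImD; exact: vintegrableD.
Qed.

Lemma cintD phi psi : cintegrable phi -> cintegrable psi ->
  cint (fun y => phi y + psi y) = cint phi + cint psi.
Proof.
move=> [i1 i2] [j1 j2]; rewrite /cint.
under eq_fun do rewrite cReD; under [X in (_ +i* vint X)%C]eq_fun do rewrite cImD.
by rewrite !vintD.
Qed.

Lemma cintegrableZ (k : C) phi : cintegrable phi -> cintegrable (fun y => k * phi y).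
Proof.
move=> [i1 i2]; split.
  by under eq_fun do rewrite cReM; apply: vintegrableB; exact: vintegrableZ.
by under eq_fun do rewrite cImM; apply: vintegrableD; exact: vintegrableZ.
Qed.

Lemma cintZ (k : C) phi : cintegrable phi -> cint (fun y => k * phi y) = k * cint phi.
Proof.
move=> [i1 i2]; rewrite /cint.
under eq_fun do rewrite cReM; under [X in (_ +i* vint X)%C]eq_fun do rewrite cImM.
rewrite vintB ?vintD ?vintZ //; try exact: vintegrableZ.
by case: k => a b; apply/eqP; rewrite eq_complex /= !eqxx.
Qed.

Lemma cintegrable_sum (I : eqType) (s : seq I) (F : I -> E -> C) :
  (forall i, cintegrable (F i)) -> cintegrable (fun y => \sum_(i <- s) F i y).
Proof.
move=> iF; elim: s => [|i s IH].
  by under eq_fun do rewrite big_nil; exact: cintegrable0.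
by under eq_fun do rewrite big_cons; exact: cintegrableD.
Qed.

Lemma cint0 : cint (fun=> 0) = 0.
Proof. by rewrite /cint vint0. Qed.

Lemma cint_sum (I : eqType) (s : seq I) (F : I -> E -> C) :
  (forall i, cintegrable (F i)) ->
  cint (fun y => \sum_(i <- s) F i y) = \sum_(i <- s) cint (F i).
Proof.
move=> iF; elim: s => [|i s IH].
  by under eq_fun do rewrite big_nil; rewrite cint0 big_nil.
under eq_fun do rewrite big_cons.
by rewrite cintD ?IH ?big_cons //; exact: cintegrable_sum.
Qed.

Lemma cintegrableN phi : cintegrable phi -> cintegrable (fun y => - phi y).
Proof.
move=> /(cintegrableZ (-1)); congr cintegrable; apply/funext => y; exact: mulN1r.
Qed.

Lemma cintegrableB phi psi : cintegrable phi -> cintegrable psi ->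
  cintegrable (fun y => phi y - psi y).
Proof. by move=> i j; apply: cintegrableD => //; exact: cintegrableN. Qed.

Lemma cintN phi : cintegrable phi -> cint (fun y => - phi y) = - cint phi.
Proof.
move=> i; rewrite -mulN1r -cintZ //; apply: eq_cint => y; by rewrite mulN1r.
Qed.

Lemma cintB phi psi : cintegrable phi -> cintegrable psi ->
  cint (fun y => phi y - psi y) = cint phi - cint psi.
Proof. by move=> i j; rewrite cintD ?cintN //; exact: cintegrableN. Qed.

Definition cmeasurable phi :=
  vmeasurable (fun y => complex.Re (phi y)) /\ vmeasurable (fun y => complex.Im (phi y)).

Lemma cintegrable_measurable phi : cintegrable phi -> cmeasurable phi.
Proof. by move=> [i j]; split; exact: vintegrable_measurable. Qed.

Lemma cmeasurableM phi psi : cmeasurable phi -> cmeasurable psi ->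
  cmeasurable (fun y => phi y * psi y).
Proof.
move=> [a1 a2] [b1 b2]; split.
  under eq_fun do rewrite cReM.
  by apply: vmeasurableD; [|apply: vmeasurableN]; exact: vmeasurableM.
by under eq_fun do rewrite cImM; apply: vmeasurableD; exact: vmeasurableM.
Qed.

Lemma cmeasurableD phi psi : cmeasurable phi -> cmeasurable psi ->
  cmeasurable (fun y => phi y + psi y).
Proof.
move=> [a1 a2] [b1 b2]; split.
  by under eq_fun do rewrite cReD; exact: vmeasurableD.
by under eq_fun do rewrite cImD; exact: vmeasurableD.
Qed.

Lemma cmeasurable_cst (a : C) : cmeasurable (fun=> a).
Proof. by split; exact: vmeasurable_cst. Qed.

Lemma cmeasurable_real (g : E -> R) : vmeasurable g -> cmeasurable (fun y => (g y)%:C%C).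
Proof. by move=> mg; split => //; exact: vmeasurable_cst. Qed.

Lemma cmeasurable_sum I (s : seq I) (F : I -> E -> C) :
  (forall i, cmeasurable (F i)) -> cmeasurable (fun y => \sum_(i <- s) F i y).
Proof.
move=> iF; elim: s => [|i s IH].
  by under eq_fun do rewrite big_nil; exact: cmeasurable_cst.
by under eq_fun do rewrite big_cons; exact: cmeasurableD.
Qed.

Lemma cmeasurableX phi n : cmeasurable phi -> cmeasurable (fun y => phi y ^+ n).
Proof.
move=> mp; elim: n => [|n IH].
  by under eq_fun do rewrite expr0; exact: cmeasurable_cst.
by under eq_fun do rewrite exprS; exact: cmeasurableM.
Qed.

Lemma cmeasurable_normc phi : cmeasurable phi -> vmeasurable (fun y => normc (phi y)).
Proof.
move=> [a1 a2]; rewrite (_ : (fun y => normc (phi y)) = fun y =>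
   Num.sqrt (complex.Re (phi y) * complex.Re (phi y) + complex.Im (phi y) * complex.Im (phi y))).
  apply: vmeasurable_comp; first exact: sqrt_continuous.
  by apply: vmeasurableD; exact: vmeasurableM.
by apply/funext => y; case: (phi y) => a b /=; rewrite !expr2.
Qed.

Lemma cintegrable_le phi (g : E -> R) : cmeasurable phi -> vintegrable g ->
  (forall y, normc (phi y) <= g y) -> cintegrable phi.
Proof.
move=> [a1 a2] ig H; split; apply: (vintegrable_le _ _ ig) => // y.
  exact: le_trans (Re_le_normc _) (H y).
exact: le_trans (Im_le_normc _) (H y).
Qed.

(** The factor 2 comes from estimating the real and the imaginary part separately. *)
Lemma normc_cint_le phi (g : E -> R) : cmeasurable phi -> vintegrable g ->
  (forall y, normc (phi y) <= g y) -> normc (cint phi) <= 2 * vint g.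
Proof.
move=> [a1 a2] ig H; apply: (le_trans (normc_le_ReIm _)) => /=.
rewrite mulr_natl mulr2n; apply: lerD; apply: le_norm_vint_le => // y.
  exact: le_trans (Re_le_normc _) (H y).
exact: le_trans (Im_le_normc _) (H y).
Qed.

Definition clintegrable h := forall A, cintegrable (fun y => h y A).

Lemma integral_clE h A : integral_cl h A = cint (fun y => h y A).
Proof. by rewrite ffunE /cint !vintE. Qed.

Lemma clifford_subE (x y : Cl) A : (x - y) A = x A - y A.
Proof. by rewrite !ffunE. Qed.

Lemma integral_clD h k : clintegrable h -> clintegrable k ->
  integral_cl (fun y => h y + k y) = integral_cl h + integral_cl k.
Proof.
move=> ih ik; apply/ffunP => A; rewrite [RHS]ffunE !integral_clE -cintD //.
by apply: eq_cint => y; rewrite ffunE.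
Qed.

Lemma integral_clB h k : clintegrable h -> clintegrable k ->
  integral_cl (fun y => h y - k y) = integral_cl h - integral_cl k.
Proof.
move=> ih ik; apply/ffunP => A; rewrite clifford_subE !integral_clE -cintB //.
by apply: eq_cint => y; rewrite clifford_subE.
Qed.

Lemma scale_cliffordE (k : C) (x : Cl) A : (k *: x) A = k * x A.
Proof. by rewrite ffunE. Qed.

Lemma clintegrableMl (a : Cl) h : clintegrable h -> clintegrable (fun y => a * h y).
Proof.
move=> ih A; under eq_fun do rewrite clifford_mulrE.
apply: cintegrable_sum => B; under eq_fun do rewrite mulrA.
exact: cintegrableZ.
Qed.

Lemma integral_clMl (a : Cl) h : clintegrable h ->
  integral_cl (fun y => a * h y) = a * integral_cl h.
Proof.
move=> ih; apply/ffunP => A; rewrite clifford_mulrE integral_clE.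
under eq_cint do rewrite clifford_mulrE.
rewrite cint_sum.
  by apply: eq_bigr => B _; rewrite integral_clE mulrA -cintZ //; apply: eq_cint => y;
     rewrite mulrA.
by move=> B; under eq_fun do rewrite mulrA; exact: cintegrableZ.
Qed.

Lemma clintegrable_sum (I : eqType) (s : seq I) (F : I -> E -> Cl) :
  (forall i, clintegrable (F i)) -> clintegrable (fun y => \sum_(i <- s) F i y).
Proof.
move=> iF A; under eq_fun do rewrite sum_ffunE; apply: cintegrable_sum => i; exact: iF.
Qed.

Lemma integral_cl_sum (I : eqType) (s : seq I) (F : I -> E -> Cl) :
  (forall i, clintegrable (F i)) ->
  integral_cl (fun y => \sum_(i <- s) F i y) = \sum_(i <- s) integral_cl (F i).
Proof.
move=> iF; apply/ffunP => A; rewrite integral_clE sum_ffunE.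
under eq_cint do rewrite sum_ffunE.
by rewrite cint_sum => [|i]; [apply: eq_bigr => i _; rewrite integral_clE|exact: iF].
Qed.

End ComplexIntegral.

#[global] Opaque cint integral_cl.

(** * Functions of class C^1 *)

Section C1.
Context {R : realType} {m : nat}.
Local Notation E := 'rV[R]_m.
Local Notation e_ j := (delta_mx 0 j : E).
Implicit Types (g : E -> R) (x y v : E).

Lemma is_derive_line g x v (s : R) : derivable g (x + s *: v) v ->
  is_derive s 1 (fun s => g (x + s *: v)) ('D_v g (x + s *: v)).
Proof.
have H : (fun h => h^-1 *: (((fun s => g (x + s *: v)) \o shift s) (h *: 1) - g (x + s *: v))) =
   (fun h => h^-1 *: ((g \o shift (x + s *: v)) (h *: v) - g (x + s *: v))).
  apply/funext => h /=; congr (_ *: (g _ - _)).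
  by rewrite [_ *: 1]mulr1 scalerDl addrCA.
move=> dg; apply: DeriveDef; first by rewrite /derivable H.
by rewrite /derive H.
Qed.

Lemma partialE j g x : partial j g x = 'D_(e_ j) g x.
Proof. by []. Qed.

Lemma derive_sum_partial g x v : differentiable g x ->
  'D_v g x = \sum_j v 0 j * partial j g x.
Proof.
move=> dg; rewrite deriveE // {1}[v]row_sum_delta linear_sum.
apply: eq_bigr => j _; rewrite linearZ /partial deriveE //.
Qed.

Lemma C1_continuous g : continuously_differentiable g -> continuous g.
Proof. by move=> [dg _] x; exact: differentiable_continuous. Qed.

Lemma C1_is_derive_line g x v (s : R) : continuously_differentiable g ->
  is_derive s 1 (fun s => g (x + s *: v)) (\sum_j v 0 j * partial j g (x + s *: v)).
Proof.
move=> [dg _]; rewrite -derive_sum_partial //; apply: is_derive_line.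
exact: diff_derivable.
Qed.

Lemma C1_is_derive_coord g x j (r s : R) : continuously_differentiable g ->
  is_derive s 1 (fun s => g (x + r *: (s *: e_ j))) (r * partial j g (x + r *: (s *: e_ j))).
Proof.
move=> cg; have := C1_is_derive_line x (r *: e_ j) s cg.
have E1 u : u *: (r *: e_ j) = r *: (u *: e_ j) by rewrite !scalerA mulrC.
under [X in is_derive _ _ X _]eq_fun do rewrite E1.
rewrite E1 (bigD1 j) //= big1 => [|i ij]; rewrite !mxE ?eqxx ?addr0 ?mulr1 //.
by rewrite (negPf ij) mulr0 mul0r.
Qed.

(** The points x + r y stay in a compact box. *)
Lemma bounded_on_dilations g x (B : R) : 0 <= B -> continuous g ->
  exists2 M, 0 <= M & forall (r : R) y, 0 <= r <= 1 -> dotv y y <= B -> `|g (x + r *: y)| <= M.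
Proof.
move=> B0 cg.
pose A (j : 'I_m) : set R := `[x 0 j - (B + 1), x 0 j + (B + 1)]%classic.
pose K := [set v : E | forall j, A j (v ord0 j)].
have cK : compact K by apply: rV_compact => j; exact: segment_compact.
have cn : {within K, continuous (fun v => `|g v|)}.
  apply: continuous_subspaceT => v; apply: continuous_comp; first exact: cg.
  exact: norm_continuous.
have K0 : K !=set0.
  by exists x => j; rewrite /A /= in_itv /=; apply/andP; split; lra.
have [c _ Hc] := compact_EVT_max K0 cK cn.
exists `|g c| => // r y r01 yB; apply: Hc; rewrite inE => j.
rewrite /A /= in_itv /= !mxE.
have yj : y 0 j ^+ 2 <= B.
  apply: le_trans yB; rewrite /dotv (bigD1 j) //= -expr2 lerDl.
  by apply: sumr_ge0 => i _; rewrite -expr2 sqr_ge0.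
have : `|r * y 0 j| <= B + 1.
  have a0 := normr_ge0 (y 0 j); rewrite normrM ger0_norm; last by case/andP: r01.
  apply: (@le_trans _ _ `|y 0 j|); first by rewrite ler_piMl //; case/andP: r01.
  by move: yj; rewrite -[y 0 j ^+ 2]real_normK ?num_real // expr2; nra.
by rewrite ler_norml; lra.
Qed.

(** Where |y|^2 <= B the Gaussian weight is at least e^(-B / 2). *)
Lemma compact_gauss_le (k : E -> R) (B M : R) : vmeasurable k -> 0 <= M ->
  (forall y, dotv y y <= B -> `|k y| <= M) -> (forall y, B <= dotv y y -> k y = 0) ->
  vintegrable k /\ vint (fun y => `|k y|) <= M * expR (B / 2) * vint (@gweight R m).
Proof.
move=> mk M0 kM k0.
have H y : `|k y| <= M * expR (B / 2) * gweight y.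
  have [yB|By] := leP (dotv y y) B; last first.
    by rewrite k0 ?(ltW By) // normr0 !mulr_ge0 ?expR_ge0.
  rewrite -mulrA; apply: (le_trans (kM _ yB)); rewrite ler_peMr //.
  rewrite /gweight eucl_norm2 -expRD -[leLHS]expR0 ler_expR; lra.
have iM := vintegrableZ (M * expR (B / 2)) (@vintegrable_gweight R m).
have ik := vintegrable_le mk H iM.
split => //; rewrite -vintZ; last exact: vintegrable_gweight.
by apply: le_vint => //; exact: vintegrable_norm.
Qed.
End C1.

#[global] Opaque partial.

(** * Mean values of monogenic functions *)

Section RadialMean.
Context {R : realType} {m : nat}.
Local Notation E := 'rV[R]_m.
Local Notation Cl := (clifford R m).
Local Notation mR := (measurableTypeR R).
Implicit Types (g : E -> R) (x y v : E).
(** A radial kernel rho(y) = eta(|y|^2) of class C^1 with compact support. *)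
Variables (eta eta' : R -> R) (B : R).
Hypothesis B0 : 0 <= B.
Hypothesis deta : forall q : R, is_derive q 1 eta (eta' q).
Hypothesis ceta' : continuous eta'.
Hypothesis eta0 : forall q, B <= q -> eta q = 0 /\ eta' q = 0.

Local Notation rho y := (eta (dotv y y)).
Local Notation e_ j := (delta_mx 0 j : E).

Let ceta : continuous eta := is_derive1_continuous deta.

Lemma continuous_eta_dotv (u : R -> R) : continuous u -> continuous (fun y : E => u (dotv y y)).
Proof.
move=> cu y; apply: (@continuous_comp _ _ _ (fun y : E => dotv y y) u); last exact: cu.
exact: continuous_dotv.
Qed.

Lemma continuous_dilate x (r : R) : continuous (fun y : E => x + r *: y).
Proof.
move=> y; apply: (@continuousD _ E _ (cst x) (fun y : E => r *: y)).
  exact: cst_continuous.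
exact: (@scaler_continuous _ E r y).
Qed.

Lemma continuous_dilate_comp g x (r : R) : continuous g -> continuous (fun y : E => g (x + r *: y)).
Proof.
move=> cg y; apply: (@continuous_comp _ _ _ (fun y : E => x + r *: y) g); last exact: cg.
exact: continuous_dilate.
Qed.

Lemma continuousMf (T : topologicalType) (a b : T -> R) :
  continuous a -> continuous b -> continuous (fun z => a z * b z).
Proof. by move=> ca cb z; apply: (@continuousM _ _ a b); [exact: ca|exact: cb]. Qed.

Lemma continuousZf (T : topologicalType) (c : R) (a : T -> R) :
  continuous a -> continuous (fun z => c * a z).
Proof.
by move=> ca z; apply: (@continuousM _ _ (cst c) a); [exact: cst_continuous|exact: ca].
Qed.

Lemma continuousDf (T : topologicalType) (a b : T -> R) :
  continuous a -> continuous b -> continuous (fun z => a z + b z).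
Proof. by move=> ca cb z; apply: (@continuousD _ _ _ a b); [exact: ca|exact: cb]. Qed.

Lemma kernel_integrable (k : E -> R) (u : R -> R) : continuous k -> continuous u ->
  (forall q, B <= q -> u q = 0) -> vintegrable (fun y : E => k y * u (dotv y y)).
Proof.
move=> ck cu u0.
have ckr : continuous (fun y : E => k y * u (dotv y y)).
  by apply: continuousMf => //; exact: continuous_eta_dotv.
have [M M0 HM] := bounded_on_dilations 0 B0 ckr.
have [] := @compact_gauss_le R m (fun y => k y * u (dotv y y)) B M => //.
- exact: vmeasurable_continuous.
- by move=> y yB; have := HM 1 y; rewrite add0r scale1r; apply; rewrite ?ler01 ?lexx.
- by move=> y yB; rewrite u0 ?mulr0.
Qed.

Lemma is_derive_dotv y j (s : R) :
  is_derive s 1 (fun s : R => dotv (s *: e_ j + y) (s *: e_ j + y))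
    (2 * (s *: e_ j + y) 0 j).
Proof.
have E1 (u : R) : dotv (u *: e_ j + y) (u *: e_ j + y) = u ^+ 2 + 2 * y 0 j * u + dotv y y.
  rewrite /dotv (bigD1 j) //= [in RHS](bigD1 j) //= !mxE !eqxx /=.
  rewrite addrA; congr (_ + _); first by ring.
  by apply: eq_bigr => i ij; rewrite !mxE (negPf ij) mulr0 add0r.
under eq_fun do rewrite E1.
apply: is_derive_eq; rewrite !mxE !eqxx /= [_ *: _]mulr1 [in LHS]/GRing.scale /=.
by ring.
Qed.

(** The rotation field y_i d_j - y_j d_i kills radial kernels and has zero integral. *)
Lemma rotation_moment g x (i j : 'I_m) (r : R) : continuously_differentiable g -> r != 0 ->
  vint (fun y => y 0 i * partial j g (x + r *: y) * rho y) =
  vint (fun y => y 0 j * partial i g (x + r *: y) * rho y).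
Proof.
move=> cg r0; have [->//|ij] := eqVneq i j.
have fin (a b c c' : R) : r * a + 2 * c = 0 -> r * b + 2 * c' = 0 -> c' = c -> a = b.
  by move=> h1 h2 cc; apply: (mulfI r0); lra.
have cgx k : continuous (partial k g) by case: cg.
have key (a b : 'I_m) : a != b ->
    r * vint (fun y => y 0 a * partial b g (x + r *: y) * rho y) +
    2 * vint (fun y => y 0 a * y 0 b * g (x + r *: y) * eta' (dotv y y)) = 0.
  move=> ab.
  have i1 : vintegrable (fun y => y 0 a * partial b g (x + r *: y) * rho y).
    apply: kernel_integrable => //; last by move=> q /eta0[].
    apply: continuousMf; first exact: continuous_coord.
    exact: continuous_dilate_comp.
  have i2 : vintegrable (fun y => y 0 a * y 0 b * g (x + r *: y) * eta' (dotv y y)).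
    apply: kernel_integrable => //; last by move=> q /eta0[].
    apply: continuousMf; last by apply: continuous_dilate_comp; exact: C1_continuous.
    by apply: continuousMf; exact: continuous_coord.
  rewrite -!vintZ // -vintD; [|exact: vintegrableZ|exact: vintegrableZ].
  apply: (@vint_derive R m (fun y => y 0 a * g (x + r *: y) * rho y) _ (e_ b)).
  - apply: continuousDf; apply: continuousZf.
      apply: continuousMf; last exact: continuous_eta_dotv.
      by apply: continuousMf; [exact: continuous_coord|exact: continuous_dilate_comp].
    apply: continuousMf; last exact: continuous_eta_dotv.
    apply: continuousMf; last by apply: continuous_dilate_comp; exact: C1_continuous.
    by apply: continuousMf; exact: continuous_coord.
  - move=> y s.
    have d1 : is_derive s 1 (fun s : R => (s *: e_ b + y) 0 a) 0.
      rewrite (_ : (fun s => _) = cst (y 0 a)); first exact: is_derive_cst.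
      by apply/funext => u; rewrite !mxE (negPf ab) mulr0 add0r.
    have d2 : is_derive s 1 (fun s : R => g (x + r *: (s *: e_ b + y)))
        (r * partial b g (x + r *: (s *: e_ b + y))).
      have E1 (u : R) : x + r *: (u *: e_ b + y) = (x + r *: y) + r *: (u *: e_ b).
        by rewrite scalerDr addrA addrAC.
      under eq_fun do rewrite E1.
      by rewrite E1; exact: C1_is_derive_coord.
    have d3 : is_derive s 1 (fun s : R => rho (s *: e_ b + y))
        (2 * (s *: e_ b + y) 0 b * eta' (dotv (s *: e_ b + y) (s *: e_ b + y))).
      have dq := is_derive_dotv y b s.
      have de := deta (dotv (s *: e_ b + y) (s *: e_ b + y)).
      apply: (is_derive_eq (is_derive1_comp de dq)).
      by rewrite mulrC.
    by apply: (is_derive_eq (is_derive1M (is_derive1M d1 d2) d3)); ring.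
  - apply: kernel_integrable => //; last by move=> q /eta0[].
    apply: continuousMf; first exact: continuous_coord.
    by apply: continuous_dilate_comp; exact: C1_continuous.
  - by apply: vintegrableD; exact: vintegrableZ.
have H1 := key i j ij; have H2 := key j i; rewrite eq_sym in H2; have {}H2 := H2 ij.
have E1 : vint (fun y => y 0 j * y 0 i * g (x + r *: y) * eta' (dotv y y)) =
  vint (fun y => y 0 i * y 0 j * g (x + r *: y) * eta' (dotv y y)).
  by congr vint; apply/funext => y; rewrite (mulrC (y 0 j)).
exact: (fin _ _ _ _ H1 H2 E1).
Qed.

Lemma rho_integrable : vintegrable (fun y : E => rho y).
Proof.
have := @kernel_integrable (fun=> 1) eta _ ceta _.
under [X in vintegrable X]eq_fun do rewrite mul1r.
apply; [exact: cst_continuous|by move=> q /eta0[]].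
Qed.

Section MonogenicRadial.
Variable f : E -> Cl.
Hypothesis mf : monogenic f.

Let C1Re A : continuously_differentiable (coefRe f A). Proof. by case: mf => /(_ A)[]. Qed.
Let C1Im A : continuously_differentiable (coefIm f A). Proof. by case: mf => /(_ A)[]. Qed.

Lemma radial_moment_integrable g x (i j : 'I_m) (r : R) : continuously_differentiable g ->
  vintegrable (fun y => y 0 i * partial j g (x + r *: y) * rho y).
Proof.
move=> [_ cg]; apply: kernel_integrable; [|exact: ceta|by move=> q /eta0[]].
apply: continuousMf; first exact: continuous_coord.
exact: continuous_dilate_comp.
Qed.

Definition radial_moment x (r : R) (i j : 'I_m) : Cl :=
  integral_cl (fun y => (y 0 i * rho y)%:C%C *: partial_cl j f (x + r *: y)).

Let TcoefE x (r : R) i j A (y : E) :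
  ((y 0 i * rho y)%:C%C *: partial_cl j f (x + r *: y)) A =
   ((y 0 i * partial j (coefRe f A) (x + r *: y) * rho y)%R +i*
    (y 0 i * partial j (coefIm f A) (x + r *: y) * rho y)%R)%C.
Proof.
rewrite scale_cliffordE ffunE.
move: (partial _ _ _) (partial _ _ _) (y 0 i) (rho y) => a b c d.
by apply/eqP; rewrite eq_complex /=; apply/andP; split; apply/eqP; ring.
Qed.

Let TE x r i j A : radial_moment x r i j A =
  (vint (fun y => y 0 i * partial j (coefRe f A) (x + r *: y) * rho y) +i*
   vint (fun y => y 0 i * partial j (coefIm f A) (x + r *: y) * rho y))%C.
Proof.
by rewrite /radial_moment integral_clE (eq_cint (TcoefE x r i j A)).
Qed.

Let T_integrable x (r : R) i j :
  clintegrable (fun y => (y 0 i * rho y)%:C%C *: partial_cl j f (x + r *: y)).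
Proof.
move=> A; rewrite /cintegrable; under eq_fun do rewrite TcoefE.
under [X in _ /\ vintegrable X]eq_fun do rewrite TcoefE.
by split; apply: radial_moment_integrable.
Qed.

Let T_sym x (r : R) i j : r != 0 -> radial_moment x r i j = radial_moment x r j i.
Proof.
move=> r0; apply/ffunP => A.
apply: (etrans (TE x r i j A)); apply: (etrans _ (esym (TE x r j i A))).
exact: (congr2 (@Complex R) (rotation_moment x i j (C1Re A) r0)
  (rotation_moment x i j (C1Im A) r0)).
Qed.

Let T_dirac x (r : R) : \sum_i \sum_j gen i * gen j * radial_moment x r i j = 0.
Proof.
have H i j : gen i * gen j * radial_moment x r i j = integral_cl (fun y =>
    gen i * gen j * ((y 0 i * rho y)%:C%C *: partial_cl j f (x + r *: y))).
  by rewrite integral_clMl.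
under eq_bigr do under eq_bigr do rewrite H.
under eq_bigr => i _.
  rewrite -integral_cl_sum; last by move=> j; apply: clintegrableMl; exact: T_integrable.
  over.
rewrite -integral_cl_sum; last first.
  by move=> i; apply: clintegrable_sum => j; apply: clintegrableMl; exact: T_integrable.
rewrite [X in integral_cl X](_ : _ = fun=> 0).
  by apply/ffunP => A; rewrite integral_clE [RHS]ffunE -[RHS](@cint0 R m); apply: eq_cint => y; rewrite ffunE.
apply/funext => y; rewrite big1 // => i _.
under eq_bigr => j _ do rewrite -scalerAr -mulrA scalerAl.
rewrite -mulr_sumr [X in _ * X](_ : _ = dirac_op f (x + r *: y)) //.
by case: mf => _ ->; rewrite mulr0.
Qed.

(** The sum of e_i e_j T_ij vanishes because f is monogenic. Since T is symmetric, it equals half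
    the sum of (e_i e_j + e_j e_i) T_ij, which is minus the trace of T. *)
Let T_trace x (r : R) : r != 0 -> \sum_j radial_moment x r j j = 0.
Proof.
move=> r0; have H := T_dirac x r.
have H2 : \sum_i \sum_j gen j * gen i * radial_moment x r i j = 0.
  rewrite -[RHS]H exchange_big /=; apply: eq_bigr => i _; apply: eq_bigr => j _.
  exact: (congr1 (fun t => gen i * gen j * t) (T_sym x j i r0)).
have : \sum_i \sum_j (gen i * gen j + gen j * gen i) * radial_moment x r i j = 0.
  transitivity (\sum_i \sum_j gen i * gen j * radial_moment x r i j +
    \sum_i \sum_j gen j * gen i * radial_moment x r i j); last by rewrite H H2 addr0.
  rewrite -big_split; apply: eq_bigr => i _.
  by rewrite -big_split; apply: eq_bigr => j _; rewrite mulrDl.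
under eq_bigr => i _.
  rewrite (bigD1 i) //= big1 ?addr0.
    rewrite gen_anticomm eqxx mulr1 -scalerAl mul1r.
    over.
  by move=> j ji; rewrite gen_anticomm eq_sym (negPf ji) mulr0 scale0r mul0r.
rewrite -scaler_sumr => /eqP; rewrite scaler_eq0 oppr_eq0 pnatr_eq0 /=.
by move=> /eqP.
Qed.

(** The integrands are rho(y) times the derivative in r of the coefficients of f(x + r y), and their
    integrals are the coefficients of the trace. *)
Lemma monogenic_radial_derivative x (r : R) A : r != 0 ->
  vint (fun y => \sum_j y 0 j * partial j (coefRe f A) (x + r *: y) * rho y) = 0 /\
  vint (fun y => \sum_j y 0 j * partial j (coefIm f A) (x + r *: y) * rho y) = 0.
Proof.
move=> r0; have /ffunP /(_ A) := T_trace x r0; rewrite sum_ffunE [RHS]ffunE.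
under eq_bigr do rewrite TE.
rewrite !vint_sum; try by move=> j; apply: radial_moment_integrable.
move=> H.
have sRe (F G : 'I_m -> R) : complex.Re (\sum_j (F j +i* G j)%C) = \sum_j F j.
  by apply: (big_morph (@complex.Re R)) => //; exact: cReD.
have sIm (F G : 'I_m -> R) : complex.Im (\sum_j (F j +i* G j)%C) = \sum_j G j.
  by apply: (big_morph (@complex.Im R)) => //; exact: cImD.
have h1 := congr1 (@complex.Re R) H; rewrite sRe in h1.
have h2 := congr1 (@complex.Im R) H; rewrite sIm in h2.
exact: (conj h1 h2).
Qed.

Let mean g x : continuously_differentiable g ->
  (forall r : R, r != 0 ->
    vint (fun y => \sum_j y 0 j * partial j g (x + r *: y) * rho y) = 0) ->
  vint (fun y => g (x + y) * rho y) = g x * vint (fun y : E => rho y).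
Proof.
move=> cg H; have cg0 := C1_continuous cg; have [_ cg1] := cg.
have iK (r : R) : vintegrable (fun y => g (x + r *: y) * rho y).
  by apply: kernel_integrable; [exact: continuous_dilate_comp|exact: ceta|move=> q /eta0[]].
have iPhi (r : R) : vintegrable (fun y => \sum_j y 0 j * partial j g (x + r *: y) * rho y).
  by apply: vintegrable_sum => j; exact: radial_moment_integrable.
pose W j y := \sum_(j : 'I_m) y 0 j * partial j g (x + y) * rho y.
have bnd : exists C, forall r : R, 0 <= r <= 1 ->
    vint (fun y => `|\sum_j y 0 j * partial j g (x + r *: y) * rho y|) <= C.
  have cr : continuous (fun y : E => rho y) by exact: continuous_eta_dotv.
  have [M M0 HM] := bounded_on_dilations 0 B0 cr.
  pose c j := projT1 (cid2 (bounded_on_dilations x B0 (cg1 j))).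
  have Hc j : 0 <= c j /\ forall (r : R) y, 0 <= r <= 1 -> dotv y y <= B ->
      `|partial j g (x + r *: y)| <= c j.
    by rewrite /c; case: cid2.
  eexists => r r01.
  have [||||_] := @compact_gauss_le R m
     (fun y => \sum_j y 0 j * partial j g (x + r *: y) * rho y) B (\sum_j (B + 1) * c j * M).
  - exact: vintegrable_measurable.
  - apply: sumr_ge0 => j _; apply: mulr_ge0 => //; apply: mulr_ge0; last exact: (Hc j).1.
    by have := B0; lra.
  - move=> y yB; apply: (le_trans (ler_norm_sum _ _ _)); apply: ler_sum => j _.
    rewrite !normrM; apply: ler_pM; rewrite ?mulr_ge0 //.
      apply: ler_pM => //; last exact: (Hc j).2.
      have yj : y 0 j ^+ 2 <= B.
        apply: le_trans yB; rewrite /dotv (bigD1 j) //= -expr2 lerDl.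
        by apply: sumr_ge0 => i _; rewrite -expr2 sqr_ge0.
      by have := normr_ge0 (y 0 j); move: yj; rewrite -[y 0 j ^+ 2]real_normK ?num_real // expr2; nra.
    by have := HM 1 y; rewrite add0r scale1r; apply; rewrite ?ler01 ?lexx.
  - move=> y yB; rewrite big1 // => j _; by rewrite (eta0 yB).1 mulr0.
  exact.
have [C HC] := bnd.
pose K (r : R) (y : E) := g (x + r *: y) * rho y.
pose Phi (r : R) (y : E) := \sum_j y 0 j * partial j g (x + r *: y) * rho y.
have mPhi : measurable_fun setT (fun p : mR * m.-tuple mR => Phi p.1 (row_of_tuple p.2)).
  apply: measurable_sum => j; apply: measurable_funM.
    apply: measurable_funM; first exact: (measurable_snd_row (@vmeasurable_coord R m j)).
    by apply: measurable_dilate; exact: vmeasurable_continuous.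
  apply: (measurable_snd_row (g := fun y : E => rho y)).
  exact: (vintegrable_measurable rho_integrable).
have hPhi (s : R) : 0 < s <= 1 ->
    [/\ vintegrable (Phi s), vint (fun y => `|Phi s y|) <= C & vint (Phi s) = 0].
  move=> /andP[s0 s1]; split; first exact: iPhi.
    by apply: HC; rewrite s1 ltW.
  by apply: H; rewrite gt_eqF.
have dK (y : E) (s : R) : is_derive s 1 (K ^~ y) (Phi s y).
  have d := C1_is_derive_line x y s cg.
  have d2 : is_derive s 1 (fun=> rho y) 0 by exact: is_derive_cst.
  apply: (is_derive_eq (is_derive1M d d2)).
  by rewrite mulr0 addr0 mulr_suml.
have cPhi (y : E) : continuous (Phi ^~ y).
  apply: continuous_sumr => j.
  apply: continuousMf; last exact: cst_continuous.
  apply: continuousMf; first exact: cst_continuous.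
  move=> s; apply: (@continuous_comp _ _ _ (fun s : R => x + s *: y) (partial j g)).
    rewrite (_ : (fun s => _) = (fun s : R => s *: y + x)); first exact: line_continuous.
    by apply/funext => u; rewrite addrC.
  exact: cg1.
have path := vint_path mPhi hPhi dK cPhi (iK 0) (iK 1).
have {}path : vint (K 1) = vint (K 0) by apply/eqP; rewrite -subr_eq0 path.
transitivity (vint (K 1)).
  by congr vint; apply/funext => y; rewrite /K scale1r.
rewrite path -vintZ; last exact: rho_integrable.
by congr vint; apply/funext => y; rewrite /K scale0r addr0.
Qed.

(** The average of f(x + r y) against rho has zero derivative for r > 0, so that its values at
    r = 0 and r = 1 agree. *)
Lemma monogenic_radial_mean x A :
  vint (fun y => coefRe f A (x + y) * rho y) = coefRe f A x * vint (fun y : E => rho y) /\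
  vint (fun y => coefIm f A (x + y) * rho y) = coefIm f A x * vint (fun y : E => rho y).
Proof.
split; apply: mean => // r r0; have [H1 H2] := monogenic_radial_derivative x A r0.
  exact: H1.
exact: H2.
Qed.
End MonogenicRadial.
End RadialMean.

(** * Gaussian averages and the reproducing formula *)

Section GaussianMean.
Context {R : realType} {m : nat}.
Local Notation E := 'rV[R]_m.
Local Notation mR := (measurableTypeR R).
Local Notation Cl := (clifford R m).
Implicit Types (g h : E -> R) (x y : E).

Lemma vint_dominated (h : nat -> E -> R) (g H : E -> R) :
  (forall n, vmeasurable (h n)) -> vmeasurable g ->
  (forall n y, `|h n y| <= H y) -> vintegrable H ->
  (forall y, h ^~ y @ \oo --> g y) -> (fun n => vint (h n)) @ \oo --> vint g.
Proof.
move=> mh mg hH iH hg.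
have mhE n : measurable_fun setT (fun t => (h n (row_of_tuple t))%:E).
  by apply/measurable_EFinP; exact: mh.
have mgE : measurable_fun setT (fun t => (g (row_of_tuple t))%:E).
  by apply/measurable_EFinP; exact: mg.
have hgE (y : E) : (fun n => (h n y)%:E) @ \oo --> (g y)%:E.
  by apply/fine_cvgP; split; [exact: nearW|exact: hg].
have hHE n (t : m.-tuple mR) : (`|(h n (row_of_tuple t))%:E| <= (H (row_of_tuple t))%:E)%E.
  by rewrite lee_fin; exact: hH.
have [ig _ cv] := @dominated_convergence _ _ R (@lebesgue_tuple R m) setT measurableT
  (fun n t => (h n (row_of_tuple t))%:E) (fun t => (g (row_of_tuple t))%:E)
  (fun t => (H (row_of_tuple t))%:E) mhE mgE
  (aeW _ (fun t _ => hgE (row_of_tuple t))) iH (aeW _ (fun t n _ => hHE n t)).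
have ih n : vintegrable (h n) by exact: vintegrable_le (mh n) (hH n) iH.
move: cv; rewrite (EFin_vint ig) => cv.
rewrite (_ : (fun n => vint (h n)) =
   fine \o (fun n => (\int[@lebesgue_tuple R m]_t (h n (row_of_tuple t))%:E)%E)).
  exact: fine_cvg cv.
by apply/funext => n; rewrite /= (EFin_vint (ih n)).
Qed.

Definition pos2 (q : R) : R := Num.max 0 q ^+ 2.

Lemma is_derive_pos2 (q : R) : is_derive q 1 pos2 (2 * Num.max 0 q).
Proof.
apply: (@is_derive1_quadratic R pos2 q _ 1) => h _; rewrite mul1r /pos2.
have [q0|q0] := leP 0 q; have [h0|h0] := leP 0 (q + h).
- by rewrite (_ : _ - _ = h ^+ 2) ?ger0_norm ?sqr_ge0 //; ring.
- by rewrite ler_norml; apply/andP; split; nra.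
- by rewrite ler_norml; apply/andP; split; nra.
- by rewrite expr0n /= mulr0 mul0r !subr0 normr0 sqr_ge0.
Qed.

Lemma max0_continuous : continuous (fun q : R => Num.max 0 q).
Proof.
have -> : (fun q : R => Num.max 0 q) = (fun q => 2^-1 * (q + `|q|)).
  apply/funext => q; have [q0|q0] := leP 0 q.
    by rewrite ger0_norm //; field.
  by rewrite ltr0_norm //; field.
apply: continuousZf; apply: continuousDf; first by move=> q; exact: cvg_id.
exact: norm_continuous.
Qed.

(** e^(-q/2) times the square of the positive part of 1 - q / c: kernels of class C^1 with
    compact support that tend to the Gaussian as c grows. *)
Definition cut (c q : R) : R := expR (- q / 2) * pos2 (1 - q / c).
Definition cut' (c q : R) : R :=
  - 2^-1 * expR (- q / 2) * pos2 (1 - q / c) +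
  expR (- q / 2) * (- c^-1 * (2 * Num.max 0 (1 - q / c))).

Lemma is_derive_affine (a b q : R) : is_derive q 1 (fun q => a + b * q) b.
Proof.
apply: (@is_derive1_quadratic R _ q b 0) => h _.
by rewrite (_ : _ - _ = 0) ?normr0 ?mul0r //; ring.
Qed.

Lemma is_derive_cut (c q : R) : is_derive q 1 (cut c) (cut' c q).
Proof.
have d1 : is_derive q 1 (fun q => expR (- q / 2)) (- 2^-1 * expR (- q / 2)).
  have d := is_derive_affine 0 (- 2^-1) q.
  have E1 (u : R) : 0 + - 2^-1 * u = - u / 2 by rewrite add0r; ring.
  have := @is_derive1_comp R expR (fun q => 0 + - 2^-1 * q) q _ _ (is_derive_expR (0 + - 2^-1 * q)) d.
  rewrite E1 mulrC; congr is_derive; apply/funext => u /=; by rewrite E1.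
have d2 : is_derive q 1 (fun q => pos2 (1 - q / c)) (- c^-1 * (2 * Num.max 0 (1 - q / c))).
  have d := is_derive_affine 1 (- c^-1) q.
  have E1 (u : R) : 1 + - c^-1 * u = 1 - u / c by ring.
  have := @is_derive1_comp R pos2 (fun q => 1 + - c^-1 * q) q _ _ (is_derive_pos2 (1 + - c^-1 * q)) d.
  rewrite E1 mulrC; congr is_derive; apply/funext => u /=; by rewrite E1.
exact: is_derive1M d1 d2.
Qed.

Lemma affine_continuous (a b : R) : continuous (fun q : R => a + b * q).
Proof. exact: is_derive1_continuous (is_derive_affine a b). Qed.

Lemma continuous_cut' c : continuous (cut' c).
Proof.
have ce : continuous (fun q : R => expR (- q / 2)).
  move=> q; apply: (@continuous_comp _ _ _ (fun q : R => - q / 2) expR); last exact: continuous_expR.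
  rewrite (_ : (fun q => _) = (fun q => 0 + - 2^-1 * q)); first exact: affine_continuous.
  by apply/funext => u; ring.
have ca : continuous (fun q : R => 1 - q / c).
  rewrite (_ : (fun q => _) = (fun q => 1 + - c^-1 * q)); first exact: affine_continuous.
  by apply/funext => u; ring.
have cm : continuous (fun q : R => Num.max 0 (1 - q / c)).
  by move=> q; apply: (@continuous_comp _ _ _ (fun q : R => 1 - q / c) (Num.max 0)); [exact: ca|exact: max0_continuous].
apply: continuousDf; apply: continuousMf => //.
- exact: continuousZf.
- by rewrite /pos2; under eq_fun do rewrite expr2; exact: continuousMf.
- by apply: continuousZf; exact: continuousZf.
Qed.

Lemma cut_support (c q : R) : 0 < c -> c <= q -> cut c q = 0 /\ cut' c q = 0.
Proof.
move=> c0 cq; have h : 1 - q / c <= 0.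
  by rewrite subr_le0 ler_pdivlMr // mul1r.
by rewrite /cut /cut' /pos2 max_l // expr0n /= !mulr0 add0r.
Qed.

Lemma cut_bound (c : R) y : 0 < c -> 0 <= cut c (dotv y y) <= gweight y.
Proof.
move=> c0; rewrite /cut /gweight eucl_norm2; apply/andP; split.
  by rewrite mulr_ge0 ?expR_ge0 // sqr_ge0.
rewrite ler_piMr ?expR_ge0 // /pos2.
have h : 1 - dotv y y / c <= 1 by rewrite gerBl divr_ge0 ?dotv_ge0 // ltW.
by rewrite exprn_ile1 ?le_max ?lexx // ge_max ler01.
Qed.

Lemma cut_cvg y : (fun n : nat => cut n.+1%:R (dotv y y)) @ \oo --> gweight y.
Proof.
rewrite /cut /gweight eucl_norm2 -[X in _ --> X]mulr1; apply: cvgMl_tmp.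
have c1 : (fun n : nat => 1 - dotv y y / n.+1%:R) @ \oo --> (1 : R).
  rewrite -[X in _ --> X]subr0; apply: cvgB; first exact: cvg_cst.
  rewrite -(mulr0 (dotv y y)); apply: cvgMl_tmp; exact: cvg_harmonic.
have c2 : pos2 1 = 1 by rewrite /pos2 max_r ?ler01 // expr1n.
rewrite -[X in _ --> X]c2.
apply: (continuous_cvg _ _ c1).
exact: (is_derive1_continuous is_derive_pos2).
Qed.

Lemma gaussian_mean_of_cuts g : continuous g ->
  (forall x (c : R), 0 < c ->
    vint (fun y => g (x + y) * cut c (dotv y y)) = g x * vint (fun y : E => cut c (dotv y y))) ->
  forall x, vintegrable (fun y => g (x + y) * gweight y) ->
  vint (fun y => g (x + y) * gweight y) = g x * vint (@gweight R m).
Proof.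
move=> cg H x ig.
have mgx : vmeasurable (fun y => g (x + y)).
  by apply: vmeasurable_shift; exact: vmeasurable_continuous.
have mcut (c : R) : vmeasurable (fun y : E => cut c (dotv y y)).
  apply: vmeasurable_continuous; apply: continuous_eta_dotv.
  exact: (is_derive1_continuous (is_derive_cut c)).
have n0 n : 0 < n.+1%:R :> R by [].
have c1 : (fun n : nat => vint (fun y => g (x + y) * cut n.+1%:R (dotv y y))) @ \oo -->
    vint (fun y => g (x + y) * gweight y).
  apply: (@vint_dominated _ _ (fun y => `|g (x + y) * gweight y|)).
  - by move=> n; apply: vmeasurableM => //; exact: mcut.
  - exact: vintegrable_measurable.
  - move=> n y; have /andP[a b] := cut_bound y (n0 n).
    rewrite normrM [leRHS]normrM; apply: ler_wpM2l => //.
    by rewrite (ger0_norm a) (ger0_norm (ltW (gweight_gt0 y))).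
  - exact: vintegrable_norm.
  - by move=> y; apply: cvgMl_tmp; exact: cut_cvg.
have c2 : (fun n : nat => g x * vint (fun y : E => cut n.+1%:R (dotv y y))) @ \oo -->
    g x * vint (@gweight R m).
  apply: cvgMl_tmp; apply: (@vint_dominated _ _ (@gweight R m)).
  - by move=> n; exact: mcut.
  - exact: vmeasurable_gweight.
  - by move=> n y; have /andP[a b] := cut_bound y (n0 n); rewrite ger0_norm.
  - exact: vintegrable_gweight.
  - by move=> y; exact: cut_cvg.
apply: (cvg_unique (@Rhausdorff R) c1).
rewrite (_ : (fun n : nat => _) = (fun n => g x * vint (fun y : E => cut n.+1%:R (dotv y y)))) //.
by apply/funext => n; rewrite H.
Qed.

Lemma MB_coef (f : E -> Cl) A : MB f ->
  [/\ continuously_differentiable (coefRe f A), continuously_differentiable (coefIm f A),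
   vintegrable (fun y => coefRe f A y ^+ 2 * gweight y) &
   vintegrable (fun y => coefIm f A y ^+ 2 * gweight y)].
Proof.
move=> [[/(_ A)[c1 c2] _] /(_ A)[/square_integrableP[_ i1] /square_integrableP[_ i2]]].
have E1 (a : R) y : (a * expR (- eucl_norm y ^+ 2 / 4)) ^+ 2 = a ^+ 2 * gweight y.
  by rewrite exprMn -expRM_natl /gweight; congr (_ * expR _); field.
apply: And4; [exact: c1|exact: c2|move: i1|move: i2].
  by congr vintegrable; apply/funext => y; exact: E1.
by congr vintegrable; apply/funext => y; exact: E1.
Qed.

Lemma gweight_shift x y : gweight (y - x) =
  gweight y * expR (\sum_j x 0 j * y 0 j) * expR (- dotv x x / 2).
Proof.
rewrite /gweight !eucl_norm2 -!expRD; congr expR.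
have -> : dotv (y - x) (y - x) = dotv y y - 2 * (\sum_j x 0 j * y 0 j) + dotv x x.
  rewrite /dotv mulr_sumr -sumrB -big_split; apply: eq_bigr => j _.
  rewrite !mxE /=; move: (x 0 j) (y 0 j) => a b; ring.
by field.
Qed.

Lemma expR_dot_le x : exists2 c, 0 <= c & forall y, `|\sum_j x 0 j * y 0 j| <= c * norm1 y.
Proof.
exists (norm1 x) => [|y]; first exact: norm1_ge0.
apply: (le_trans (ler_norm_sum _ _ _)); rewrite /norm1 mulr_sumr; apply: ler_sum => j _.
by rewrite normrM ler_wpM2r // coord_le_norm1.
Qed.

(** Averaging g(x + y) is integrating g(y) against the translated weight
    w(y - x) = w(y) e^<x, y> e^(-|x|^2 / 2). *)
Lemma gaussian_mean (g : E -> R) : continuous g ->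
  vintegrable (fun y => g y ^+ 2 * gweight y) ->
  (forall x (c : R), 0 < c ->
    vint (fun y => g (x + y) * cut c (dotv y y)) = g x * vint (fun y : E => cut c (dotv y y))) ->
  forall x, g x * vint (@gweight R m) = expR (- dotv x x / 2) *
    vint (fun y => g y * gweight y * expR (\sum_j x 0 j * y 0 j)).
Proof.
move=> cg ig H x.
have eg : exp_integrable (fun y => g y * gweight y).
  by apply: exp_integrable_square => //; exact: vmeasurable_continuous.
have [c c0 Hc] := expR_dot_le x.
have i1 : vintegrable (fun y => g y * gweight y * expR (\sum_j x 0 j * y 0 j)).
  apply: exp_integrable_vintegrable; apply: (@exp_integrableM _ _ _ _ 1 c) => //.
    apply: (vmeasurable_comp (u := expR)); first exact: continuous_expR.
    by apply: vmeasurable_sum => j; apply: vmeasurableM; [exact: vmeasurable_cst|exact: vmeasurable_coord].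
  move=> y; rewrite mul1r ger0_norm ?expR_ge0 // ler_expR.
  exact: le_trans (ler_norm _) (Hc y).
have E1 : (fun y => g y * gweight (y - x)) = (fun y => expR (- dotv x x / 2) *
    (g y * gweight y * expR (\sum_j x 0 j * y 0 j))).
  by apply/funext => y; rewrite gweight_shift; ring.
have i2 : vintegrable (fun y => g y * gweight (y - x)).
  by rewrite E1; exact: vintegrableZ.
have E2 : (fun y => g (x + y) * gweight y) = (fun y => (fun y => g y * gweight (y - x)) (x + y)).
  by apply/funext => y /=; rewrite addrC addrK.
rewrite -(gaussian_mean_of_cuts cg H).
  rewrite E2; apply: (etrans (vint_shift x i2)); rewrite E1.
  exact: vintZ.
by rewrite E2; exact: (vintegrable_shift x i2).
Qed.

(** The reproducing formula of the Bargmann space: the mean value property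
    [monogenic_radial_mean] passes to the Gaussian weight through the kernels [cut]. *)
Lemma MB_gaussian_mean (f : E -> Cl) A : MB f -> forall x,
  coefRe f A x * vint (@gweight R m) = expR (- dotv x x / 2) *
    vint (fun y => coefRe f A y * gweight y * expR (\sum_j x 0 j * y 0 j)) /\
  coefIm f A x * vint (@gweight R m) = expR (- dotv x x / 2) *
    vint (fun y => coefIm f A y * gweight y * expR (\sum_j x 0 j * y 0 j)).
Proof.
move=> mbf x; have [c1 c2 i1 i2] := MB_coef A mbf.
have mf : monogenic f by case: mbf.
have K (c : R) x' (c0 : 0 < c) := monogenic_radial_mean (ltW c0) (is_derive_cut c)
   (continuous_cut' (c := c)) (fun q => @cut_support c q c0) mf x' A.
split; apply: gaussian_mean => //; try exact: C1_continuous.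
  by move=> x' c c0; exact: (K c x' c0).1.
by move=> x' c c0; exact: (K c x' c0).2.
Qed.
End GaussianMean.

(** * The complex exponential *)

Section ComplexExponential.
Context {R : realType}.
Local Notation C := R[i].
Local Notation normc := (@ComplexField.Normc.normc R).
Implicit Types (u v w z : C) (s : R).

Definition cexp w : C :=
  ((expR (complex.Re w) * cos (complex.Im w))%R +i* (expR (complex.Re w) * sin (complex.Im w))%R)%C.

Lemma cexpD z w : cexp (z + w) = cexp z * cexp w.
Proof.
apply/eqP; rewrite eq_complex /= cReD cImD expRD cosD sinD.
by apply/andP; split; apply/eqP; ring.
Qed.

Lemma cexp0 : cexp 0 = 1.
Proof. by apply/eqP; rewrite eq_complex /= expR0 cos0 sin0 mulr1 mulr0 !eqxx. Qed.

Lemma normc_cexp w : normc (cexp w) = expR (complex.Re w).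
Proof.
rewrite /= !exprMn -mulrDr cos2Dsin2 mulr1 sqrtr_sqr ger0_norm //; exact: expR_ge0.
Qed.

Lemma cexp_real s : cexp s%:C%C = (expR s)%:C%C.
Proof. by apply/eqP; rewrite eq_complex /= cos0 sin0 mulr1 mulr0 !eqxx. Qed.

(** Take for u the conjugate of z. *)
Lemma normc_le_of_Re z (b : R) : (forall u, complex.Re (u * z) <= normc u * b) -> normc z <= b.
Proof.
move=> H; have [z0|z0] := eqVneq z 0.
  by have := H 1; rewrite z0 mulr0 ComplexField.Normc.normc1 ComplexField.Normc.normc0 mul1r.
have nz : 0 < normc z.
  rewrite lt_neqAle normc_ge0 andbT eq_sym; apply: contra z0 => /eqP h.
  by apply/eqP; exact: ComplexField.Normc.eq0_normc.
have := H (z^*)%C.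
have -> : normc (z^*)%C = normc z by case: (z) => a b' /=; rewrite sqrrN.
have -> : complex.Re ((z^*)%C * z) = normc z * normc z.
  rewrite -expr2; case: (z) => a b' /=; rewrite sqr_sqrtr ?addr_ge0 ?sqr_ge0 //; ring.
by rewrite ler_pM2l.
Qed.

Section Taylor.
Variable w : C.
Local Notation q n u s := (\sum_(l < n) complex.Re (u * w ^+ l) / l`!%:R * s ^+ l).
Local Notation a u s := (complex.Re (u * cexp (s%:C%C * w))).

Let aE u s : a u s = expR (s * complex.Re w) *
  (complex.Re u * cos (s * complex.Im w) - complex.Im u * sin (s * complex.Im w)).
Proof. by rewrite cReM /cexp /= cReM cImM /= !mul0r subr0 addr0; ring. Qed.

Let is_derive_scale (c s : R) : is_derive s 1 (fun s => s * c) c.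
Proof.
apply: (@is_derive1_quadratic R _ s c 0) => h _.
by rewrite (_ : _ - _ = 0) ?normr0 ?mul0r //; ring.
Qed.

Let is_derive_a u s : is_derive s 1 (fun s => a u s) (a (u * w) s).
Proof.
set x := complex.Re w; set y := complex.Im w.
have d1 := is_derive_scale x s; have d2 := is_derive_scale y s.
have de := @is_derive1_comp R expR (fun s => s * x) s _ _ (is_derive_expR _) d1.
have dc := @is_derive1_comp R cos (fun s => s * y) s _ _ (is_derive_cos _) d2.
have ds := @is_derive1_comp R sin (fun s => s * y) s _ _ (is_derive_sin _) d2.
have := is_derive1M de (is_derive1B (is_derive1Z (complex.Re u) dc)
  (is_derive1Z (complex.Im u) ds)).
move=> D; rewrite aE cReM cImM -/x -/y.
under [X in is_derive _ _ X _]eq_fun do rewrite aE.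
apply: (is_derive_eq D); rewrite /=; ring.
Qed.

Let is_derive_q n u s : is_derive s 1 (fun s => q n.+1 u s) (q n (u * w) s).
Proof.
elim: n => [|n IH].
  under [X in is_derive _ _ X _]eq_fun do rewrite big_ord_recr big_ord0 /= expr0 mulr1.
  rewrite big_ord0; under [X in is_derive _ _ X _]eq_fun do rewrite expr0.
  exact: (is_derive_cst (0 + complex.Re u / 0`!%:R * 1) s 1).
under [X in is_derive _ _ X _]eq_fun do rewrite big_ord_recr /=.
rewrite [X in is_derive _ _ _ X]big_ord_recr /=.
apply: (is_derive1D IH).
apply: (is_derive_eq (is_derive1Z _ (is_derive1X n s))).
have n0 : n.+1%:R != 0 :> R by rewrite pnatr_eq0.
have f0 : n`!%:R != 0 :> R by rewrite pnatr_eq0 -lt0n fact_gt0.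
have -> : u * w ^+ n.+1 = u * w * w ^+ n by rewrite exprS mulrA.
rewrite factS natrM; move: (complex.Re _) (n.+1%:R : R) n0 (n`!%:R : R) f0 => c a' a0 b0 b1.
by field; rewrite a0 b1.
Qed.

Let b n s := s ^+ n * normc w ^+ n / n`!%:R * expR (s * normc w).

Let is_derive_b n s : is_derive s 1 (b n.+1) (normc w * b n s + normc w * b n.+1 s).
Proof.
have de := @is_derive1_comp R expR (fun s => s * normc w) s _ _ (is_derive_expR _)
  (is_derive_scale (normc w) s).
have D := is_derive1M (is_derive1Z (normc w ^+ n.+1 / n.+1`!%:R) (is_derive1X n s)) de.
rewrite (_ : b n.+1 = fun s => normc w ^+ n.+1 / n.+1`!%:R * s ^+ n.+1 * expR (s * normc w)).
  apply: (is_derive_eq D).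
  have n0 : n.+1%:R != 0 :> R by rewrite pnatr_eq0.
  have f0 : n`!%:R != 0 :> R by rewrite pnatr_eq0 -lt0n fact_gt0.
  rewrite /b /= factS natrM !exprS.
  move: (n.+1%:R : R) n0 (n`!%:R : R) f0 => a' a0 b0 b1.
  by field; rewrite a0 b1.
by apply/funext => t; rewrite /b; ring.
Qed.

(** Induction on n: the derivative in s of the left-hand side is the same remainder for u w, at the
    previous degree. *)
Let taylor_Re n u s : 0 <= s -> a u s - q n u s <= normc u * b n s.
Proof.
elim: n u s => [|n IH] u s s0.
  rewrite big_ord0 subr0 /b !expr0 fact0 divr1 !mul1r.
  apply: (le_trans (ler_norm _)); apply: (le_trans (Re_le_normc _)).
  rewrite ComplexField.Normc.normcM ler_wpM2l ?normc_ge0 // normc_cexp ler_expR.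
  rewrite cReM /= mul0r subr0 ler_wpM2l //.
  exact: le_trans (ler_norm _) (Re_le_normc _).
have D (t : R) : is_derive t 1 (fun t => a u t - q n.+1 u t - normc u * b n.+1 t)
   (a (u * w) t - q n (u * w) t - normc u * (normc w * b n t + normc w * b n.+1 t)).
  exact: is_derive1B (is_derive1B (is_derive_a u t) (is_derive_q n u t))
    (is_derive1Z (normc u) (is_derive_b n t)).
pose F (t : R) := a u t - q n.+1 u t - normc u * b n.+1 t.
have F0 : F 0 = 0.
  rewrite /F mul0r cexp0 mulr1 big_ord_recl big1; last first.
    by move=> i _; rewrite /= expr0n /= mulr0.
  rewrite /b !expr0 expr0n /= fact0 !mulr1 !mul0r; move: (complex.Re u) => c.
  by field.
suff : F s - F 0 <= 0 * (s - 0) by rewrite F0 mul0r subr0 /F subr_le0.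
apply: (mean_value_le s0 (fun t _ => D t)) => t /andP[t0 ts].
have h1 := IH (u * w) t t0; rewrite ComplexField.Normc.normcM in h1.
have h2 : 0 <= b n.+1 t.
  by rewrite /b !mulr_ge0 ?expR_ge0 ?invr_ge0 ?exprn_ge0 ?normc_ge0.
rewrite subr_le0; apply: (le_trans h1).
by rewrite -mulrA ler_wpM2l ?normc_ge0 // lerDl mulr_ge0 ?normc_ge0.
Qed.

Definition exp_poly n : C := \sum_(l < n) (l`!%:R)^-1 * w ^+ l.

Lemma cexp_taylor n :
  normc (cexp w - exp_poly n) <= normc w ^+ n / n`!%:R * expR (normc w).
Proof.
apply: normc_le_of_Re => u.
have E (l : nat) : complex.Re (u * ((l`!%:R)^-1 * w ^+ l)) = complex.Re (u * w ^+ l) / l`!%:R.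
  have -> : (l`!%:R)^-1 = ((l`!%:R)^-1)%:C%C :> C by rewrite fmorphV rmorph_nat.
  by rewrite mulrCA [LHS]cReM /= mul0r subr0 mulrC.
have e1 : (1 : R)%:C%C * w = w by rewrite mul1r.
have := @taylor_Re n u 1 ler01; rewrite /b e1 expr1n !mul1r => H.
rewrite mulrBr cReD cReN /exp_poly mulr_sumr.
rewrite (big_morph (@complex.Re R) (@cReD R) (erefl : complex.Re 0 = 0)).
rewrite (eq_bigr (fun l : 'I_n => complex.Re (u * w ^+ l) / l`!%:R * 1 ^+ l)) // => l _.
by rewrite E expr1n mulr1.
Qed.

End Taylor.

Lemma pow_fact_le (x : R) n : 0 <= x -> x ^+ n / n`!%:R <= expR x.
Proof.
move=> x0; case: n => [|n].
  by rewrite expr0 fact0 divr1; have := expR_ge1Dx x; lra.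
have := expR_ge1Dxn n x0; lra.
Qed.

(** A bound geometric in n, so that the Taylor series of the kernel converges
    fast enough to be integrated termwise. *)
Lemma cexp_taylor_geometric w n :
  normc (cexp w - exp_poly w n) <= 2^-1 ^+ n * expR (3 * normc w).
Proof.
apply: (le_trans (cexp_taylor w n)).
have -> : 3 * normc w = 2 * normc w + normc w by ring.
rewrite expRD mulrA ler_wpM2r ?expR_ge0 //.
have := @pow_fact_le (2 * normc w) n ltac:(by rewrite mulr_ge0 ?normc_ge0).
rewrite exprMn -mulrA -ler_pdivlMl ?exprn_gt0 // => h; apply: (le_trans h).
by rewrite exprVn.
Qed.

Lemma cexp_second_order w : normc (cexp w - 1 - w) <= normc w ^+ 2 * expR (normc w).
Proof.
have E : exp_poly w 2 = 1 + w.
  by rewrite /exp_poly big_ord_recr big_ord1 /= expr0 expr1 (_ : 1`! = 1%N) // fact0 invr1 !mul1r.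
have := cexp_taylor w 2; rewrite E opprD addrA => h; apply: (le_trans h).
rewrite ler_wpM2r ?expR_ge0 // (_ : 2`! = 2%N) //.
by rewrite ler_piMr ?exprn_ge0 ?normc_ge0 // invf_le1 // ler1n.
Qed.
End ComplexExponential.

(** * Holomorphic functions on C^m *)

Section FrechetDerivative.
Context {K : numFieldType} {m : nat}.
Local Notation V := 'rV[K]_m.

Definition row_form (d : 'I_m -> K) (h : V) : K^o := \sum_j h 0 j * d j.

Lemma row_form_linear d : linear (row_form d).
Proof.
move=> k x y; rewrite /row_form scaler_sumr -big_split; apply: eq_bigr => j _.
by rewrite !mxE mulrDl -mulrA.
Qed.
HB.instance Definition _ d := GRing.isLinear.Build K V K^o _ (row_form d) (row_form_linear d).

Lemma row_form_continuous d : continuous (row_form d).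
Proof.
move=> z; apply: differentiable_continuous.
rewrite (_ : row_form d = \sum_j (fun h : V => (h 0 j : K^o) * d j)); last first.
  by apply/funext => h; rewrite fct_sumE.
elim/big_ind: _ => [|f g df dg|j _].
- exact: differentiable_cst.
- exact: differentiableD.
- apply: (@differentiableM _ _ (fun h : V => h 0 j : K^o) (cst (d j))).
    exact: differentiable_coord.
  exact: differentiable_cst.
Qed.

Lemma differentiable_of_littleo (f : V -> K^o) z (d : 'I_m -> K) :
  (forall eps, 0 < eps -> exists2 r, 0 < r & forall h, `|h| < r ->
     `|f (z + h) - f z - row_form d h| <= eps * `|h|) ->
  differentiable f z /\ forall v, 'd f z v = row_form d v.
Proof.
move=> H; pose df : {linear V -> K^o} := row_form d.
have cdf : continuous df := @row_form_continuous d.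
have fE : f \o shift z = cst (f z) + df +o_ (0 : V) id.
  apply/eqaddoP => eps eps0; have [r r0 Hr] := H eps eps0.
  have N1 : \forall h \near (0 : V), `|h| < r by exact: nbhs0_lt.
  apply: filterS N1 => h h1.
  have -> : ((f \o shift z) - (cst (f z) + df)) h = f (z + h) - f z - row_form d h.
    by rewrite [z + h]addrC -[LHS]/(f (h + z) - (f z + row_form d h)) opprD addrA.
  exact: Hr.
have dE := diff_unique cdf fE; split; last by move=> v; rewrite dE.
by apply/diff_locallyP; rewrite dE.
Qed.

Lemma differentiable_of_quadratic (f : V -> K^o) z (d : 'I_m -> K) (M r : K) : 0 <= M -> 0 < r ->
  (forall h, `|h| < r -> `|f (z + h) - f z - row_form d h| <= M * `|h| ^+ 2) ->
  differentiable f z.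
Proof.
move=> M0 r0 H.
have [eps eps0|//] := @differentiable_of_littleo f z d.
have M1 : 0 < M + 1 by rewrite ltr_wpDl.
have e1 : 0 < eps / (M + 1) by rewrite divr_gt0.
(* in a partially ordered field, (1/x + 1/y)^-1 stands for the minimum of x and y *)
have small (x y : K) : 0 < x -> 0 < y -> (x^-1 + y^-1)^-1 <= x.
  move=> x0 y0; rewrite -[leRHS]invrK lef_pV2 ?posrE ?addr_gt0 ?invr_gt0 //.
  by rewrite lerDl invr_ge0 ltW.
exists (r^-1 + (eps / (M + 1))^-1)^-1 => [|h hr]; first by rewrite invr_gt0 addr_gt0 ?invr_gt0.
have h1 := lt_le_trans hr (small _ _ r0 e1).
rewrite addrC in hr; have h2 := lt_le_trans hr (small _ _ e1 r0).
apply: (le_trans (H h h1)); rewrite expr2 mulrA ler_wpM2r //.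
apply: (@le_trans _ _ ((M + 1) * `|h|)); first by rewrite ler_wpM2r // lerDl.
by rewrite mulrC -ler_pdivlMr // ltW.
Qed.

Lemma differentiable_along_line (f : V -> K^o) a b (t : K) : differentiable f (a + t *: b) ->
  exists d : K, forall eps, 0 < eps -> exists2 r, 0 < r & forall w, `|w - t| < r ->
    `|f (a + w *: b) - f (a + t *: b) - d * (w - t)| <= eps * `|w - t|.
Proof.
move=> df; exists ('d f (a + t *: b) b) => eps eps0.
have b1 : 0 < `|b| + 1 by rewrite ltr_wpDl.
have /eqaddoP := diff_locally df.
have e0 : 0 < eps / (`|b| + 1) by rewrite divr_gt0.
move=> /(_ _ e0) /nbhs_norm0P[r /= r0 Hr].
exists (r / (`|b| + 1)) => [|w hw]; first by rewrite divr_gt0.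
have nb : `|(w - t) *: b| <= `|w - t| * (`|b| + 1).
  by rewrite normrZ ler_wpM2l // lerDl.
have := Hr ((w - t) *: b); rewrite /= => /(_ _) h.
have {}h := h (le_lt_trans nb _); rewrite -ltr_pdivlMr // in h.
have {h} := h hw.
have -> : ((f \o shift (a + t *: b)) - (cst (f (a + t *: b)) + 'd f (a + t *: b))) ((w - t) *: b) =
   f (a + w *: b) - f (a + t *: b) - 'd f (a + t *: b) b * (w - t).
  rewrite -[LHS]/(f ((w - t) *: b + (a + t *: b)) - (f (a + t *: b) + 'd f (a + t *: b) ((w - t) *: b))).
  by rewrite linearZ opprD addrA addrCA -scalerDl subrK [_ *: _ as X in _ - X]mulrC.
move=> h; apply: (le_trans h); apply: (le_trans (ler_wpM2l (ltW e0) nb)).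
by rewrite mulrCA divfK ?gt_eqF // mulrC.
Qed.
End FrechetDerivative.

Section HolomorphicMaps.
Context {R : realType} {m : nat}.
Local Notation C := (R[i] : numFieldType).
Local Notation V := 'rV[C]_m.
Local Notation Cl := (clifford R m).
Local Notation normc := (@ComplexField.Normc.normc R).
Implicit Types (z w h : V).

(** A real-valued norm on C^m, whereas the norm of the module C^m has its values in R[i]. *)
Definition znorm z : R := \sum_j normc (z 0 j).

Lemma znorm_ge0 z : 0 <= znorm z.
Proof. by apply: sumr_ge0 => j _; exact: normc_ge0. Qed.

Lemma normC_ReE (a : C) : 0 <= a -> a = (complex.Re a)%:C%C.
Proof. by case: a => x y; rewrite lecE /= => /andP[/eqP -> _]. Qed.

Lemma normr_rowE h : `|h| = (complex.Re `|h|)%:C%C.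
Proof. exact: normC_ReE. Qed.

Lemma coord_le_norm h j : `|h 0 j| <= `|h|.
Proof.
have : mx_norm h <= mx_norm h by [].
rewrite !mx_normE num_le => /bigmax_leP[_ /(_ (0, j) isT)].
by rewrite -num_le /= -mx_normE.
Qed.

Lemma normc_coord_le h j : normc (h 0 j) <= complex.Re `|h|.
Proof. by rewrite -lecR -normr_rowE -normrcE coord_le_norm. Qed.

Lemma znorm_le h : znorm h <= m%:R * complex.Re `|h|.
Proof.
rewrite (_ : m%:R * _ = \sum_(j < m) complex.Re `|h|); last first.
  by rewrite sumr_const card_ord mulr_natl.
by apply: ler_sum => j _; exact: normc_coord_le.
Qed.

Lemma differentiable_quadratic (f : V -> C) z (d : 'I_m -> C) (K : R) : 0 <= K ->
  (forall h, znorm h <= 1 -> normc (f (z + h) - f z - row_form d h) <= K * znorm h ^+ 2) ->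
  differentiable (f : V -> C^o) z.
Proof.
move=> K0 H.
have m0 : 0 < m%:R + 1 :> R by rewrite ltr_wpDl.
apply: (@differentiable_of_quadratic _ _ (f : V -> C^o) z d (K * m%:R ^+ 2)%:C%C ((m%:R + 1)^-1)%:C%C).
- by rewrite ler0c mulr_ge0 // exprn_ge0.
- by rewrite ltcR invr_gt0.
move=> h hr; rewrite (normr_rowE h) ltcR in hr.
rewrite (normr_rowE h); set n := complex.Re `|h| in hr *.
have -> : (K * m%:R ^+ 2)%:C%C * n%:C%C ^+ 2 = (K * m%:R ^+ 2 * n ^+ 2)%:C%C :> C.
  by rewrite [RHS]rmorphM [in RHS]rmorphXn.
rewrite normrcE lecR.
have n0 : 0 <= n by rewrite -ler0c -normr_rowE.
have zn : znorm h <= m%:R * n := znorm_le h.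
have z1 : znorm h <= 1.
  apply: (le_trans zn); apply: (@le_trans _ _ ((m%:R + 1) * n)).
    by rewrite ler_wpM2r // lerDl.
  by rewrite -ler_pdivlMl // mulr1 ltW.
apply: (le_trans (H h z1)); rewrite -mulrA -exprMn ler_wpM2l //.
by rewrite lerXn2r ?nnegrE ?znorm_ge0 ?mulr_ge0.
Qed.

Lemma differentiable_cderivative (f : V -> C) a b (t : C) :
  differentiable (f : V -> C^o) (a + t *: b) ->
  exists d, cderivative (fun u => f (a + u *: b)) t d.
Proof.
move=> /differentiable_along_line[d Hd]; exists d => e e0.
have ec0 : 0 < e%:C%C :> C by rewrite ltcR.
have [r r0 Hr] := Hd _ ec0.
have rE := normC_ReE (ltW r0).
have r1 : 0 < complex.Re r by rewrite -ltcR -rE.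
exists (complex.Re r / 2) => [|w hw]; first by rewrite divr_gt0.
have wr : `|w - t| < r.
  rewrite rE normrcE ltcR; apply: (le_lt_trans hw).
  by rewrite ltr_pdivrMr // ltr_pMr // ltr1n.
have := Hr w wr; rewrite !normrcE.
have -> : e%:C%C * (normc (w - t))%:C%C = (e * normc (w - t))%:C%C :> C.
  by rewrite [RHS]rmorphM.
by rewrite lecR.
Qed.

(** Write z = x + i y with x and y real: z is the value at u = i of the line x + u y, whose points
    with real u are real. *)
Lemma holomorphic_zero (f : V -> C) : (forall z, differentiable (f : V -> C^o) z) ->
  (forall x : 'rV[R]_m, f (complexify x) = 0) -> forall z, f z = 0.
Proof.
move=> df f0 z.
pose x : 'rV[R]_m := map_mx (@complex.Re R) z; pose y : 'rV[R]_m := map_mx (@complex.Im R) z.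
have zE : z = complexify x + 'i%C *: complexify y.
  by apply/rowP => j; rewrite !mxE [LHS]complexE.
rewrite zE; apply: (zero_on_reals (g := fun u => f (complexify x + u *: complexify y))).
  by move=> t; apply: differentiable_cderivative.
move=> r; rewrite (_ : _ + _ = complexify (x + r *: y)) //.
by apply/rowP => j; rewrite !mxE rmorphD rmorphM.
Qed.

Lemma holomorphic_extension_unique (f : 'rV[R]_m -> Cl) F :
  is_holomorphic_extension f F -> holomorphic_extension f = F.
Proof.
move=> [hF eF].
have [hG eG] : is_holomorphic_extension f (holomorphic_extension f).
  by apply: (@xgetPex _ (fun=> 0) [set F | is_holomorphic_extension f F]); exists F.
apply/funext => z; apply/ffunP => A; apply/eqP; rewrite -subr_eq0; apply/eqP.
apply: (@holomorphic_zero (fun w => holomorphic_extension f w A - F w A)).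
  by move=> w; apply: (@differentiableB _ _ _ (fun w => holomorphic_extension f w A : C^o) (fun w => F w A : C^o)).
by move=> x; rewrite eF eG subrr.
Qed.
End HolomorphicMaps.

(** * The Segal-Bargmann transform *)

Section Laplace.
Context {R : realType} {m : nat}.
Local Notation C := (R[i] : numFieldType).
Local Notation V := 'rV[C]_m.
Local Notation E := 'rV[R]_m.
Local Notation Cl := (clifford R m).
Local Notation normc := (@ComplexField.Normc.normc R).
Implicit Types (z h : V) (y x : E) (k phi : E -> C).

Definition zdot z y : C := \sum_j z 0 j * (y 0 j)%:C%C.

Lemma zdotD z h y : zdot (z + h) y = zdot z y + zdot h y.
Proof. by rewrite /zdot -big_split; apply: eq_bigr => j _; rewrite mxE mulrDl. Qed.

Lemma zdotZ (a : C) z y : zdot (a *: z) y = a * zdot z y.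
Proof. by rewrite /zdot mulr_sumr; apply: eq_bigr => j _; rewrite mxE mulrA. Qed.

Lemma normc_zdot z y : normc (zdot z y) <= znorm z * norm1 y.
Proof.
apply: (le_trans (normc_sum _ _)); rewrite /znorm mulr_suml; apply: ler_sum => j _.
rewrite ComplexField.Normc.normcM normcC ler_wpM2l ?normc_ge0 //.
exact: coord_le_norm1.
Qed.

Lemma cmeasurable_zdot z : cmeasurable (zdot z).
Proof.
apply: cmeasurable_sum => j; apply: cmeasurableM; first exact: cmeasurable_cst.
by apply: cmeasurable_real; exact: vmeasurable_coord.
Qed.

Lemma cmeasurable_cexp phi : cmeasurable phi -> cmeasurable (fun y => cexp (phi y)).
Proof.
move=> [m1 m2]; split; apply: vmeasurableM.
- by apply: (vmeasurable_comp (u := expR)) => //; exact: continuous_expR.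
- by apply: (vmeasurable_comp (u := cos)) => //; exact: continuous_cos.
- by apply: (vmeasurable_comp (u := expR)) => //; exact: continuous_expR.
- by apply: (vmeasurable_comp (u := sin)) => //; exact: continuous_sin.
Qed.

Definition cexp_integrable k := cmeasurable k /\
  forall c, vintegrable (fun y => normc (k y) * expR (c * norm1 y)).

Lemma cexp_integrable_of_parts k :
  exp_integrable (fun y => complex.Re (k y)) -> exp_integrable (fun y => complex.Im (k y)) ->
  cexp_integrable k.
Proof.
move=> [m1 i1] [m2 i2]; split; first by split.
move=> c; apply: vintegrable_le (vintegrableD (i1 c) (i2 c)).
  by apply: vmeasurableM; [exact: cmeasurable_normc|exact: vmeasurable_exp_norm1].
move=> y; rewrite ger0_norm ?mulr_ge0 ?expR_ge0 ?normc_ge0 // -mulrDl.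
by rewrite ler_wpM2r ?expR_ge0 ?normc_le_ReIm.
Qed.

Lemma cexp_integrableM k phi (B c : R) : 0 <= B -> cmeasurable phi ->
  (forall y, normc (phi y) <= B * expR (c * norm1 y)) ->
  cexp_integrable k -> cexp_integrable (fun y => k y * phi y).
Proof.
move=> B0 mp hp [mk ik]; split; first exact: cmeasurableM.
move=> d; apply: vintegrable_le (vintegrableZ B (ik (c + d))).
  apply: vmeasurableM; last exact: vmeasurable_exp_norm1.
  by apply: cmeasurable_normc; exact: cmeasurableM.
move=> y; rewrite ger0_norm ?mulr_ge0 ?expR_ge0 ?normc_ge0 // mulrDl expRD.
rewrite ComplexField.Normc.normcM.
rewrite (_ : B * _ = normc (k y) * (B * expR (c * norm1 y)) * expR (d * norm1 y)); last by ring.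
by rewrite ler_wpM2r ?expR_ge0 // ler_wpM2l ?normc_ge0.
Qed.

Lemma cexp_integrable_cintegrable k : cexp_integrable k -> cintegrable k.
Proof.
move=> [mk ik]; apply: (cintegrable_le mk (ik 0)) => y.
by rewrite mul0r expR0 mulr1.
Qed.

Lemma cexp_integrable_coord k j : cexp_integrable k ->
  cexp_integrable (fun y => k y * (y 0 j)%:C%C).
Proof.
apply: (@cexp_integrableM _ _ 1 1) => //.
  by apply: cmeasurable_real; exact: vmeasurable_coord.
move=> y; rewrite normcC !mul1r; apply: (le_trans (coord_le_norm1 y j)).
exact: le_expR_norm1.
Qed.

Lemma normc_cexp_zdot z y : normc (cexp (zdot z y)) <= expR (znorm z * norm1 y).
Proof.
rewrite normc_cexp ler_expR; apply: (le_trans (ler_norm _)).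
exact: le_trans (Re_le_normc _) (normc_zdot z y).
Qed.

Lemma cexp_integrable_kernel k z : cexp_integrable k ->
  cexp_integrable (fun y => k y * cexp (zdot z y)).
Proof.
apply: (@cexp_integrableM _ _ 1 (znorm z)) => //.
  by apply: cmeasurable_cexp; exact: cmeasurable_zdot.
by move=> y; rewrite mul1r; exact: normc_cexp_zdot.
Qed.

Definition laplace k z : C := cint (fun y => k y * cexp (zdot z y)).

(** For |h| <= 1 the second-order remainder of e^<z + h, y> is O(|h|^2) e^((|z| + 2) |y|). *)
Lemma laplace_quadratic k z : cexp_integrable k -> exists2 B, 0 <= B &
  forall h, znorm h <= 1 ->
  normc (laplace k (z + h) - laplace k z -
    row_form (fun j => laplace (fun y => k y * (y 0 j)%:C%C) z) h) <= B * znorm h ^+ 2.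
Proof.
move=> ik; have [mk ikc] := ik.
pose G y := 2 * (normc (k y) * expR ((znorm z + 2) * norm1 y)).
have iG : vintegrable G by exact/vintegrableZ.
exists (2 * vint G) => [|h h1].
  rewrite mulr_ge0 //; apply: vint_ge0 => y.
  by rewrite !mulr_ge0 ?normc_ge0 ?expR_ge0.
have iK z' : cintegrable (fun y => k y * cexp (zdot z' y)).
  by apply: cexp_integrable_cintegrable; exact: cexp_integrable_kernel.
have iKj j : cintegrable (fun y => k y * (y 0 j)%:C%C * cexp (zdot z y)).
  apply: cexp_integrable_cintegrable; apply: cexp_integrable_kernel.
  exact: cexp_integrable_coord.
have -> : row_form (fun j => laplace (fun y => k y * (y 0 j)%:C%C) z) h =
    cint (fun y => \sum_j h 0 j * (k y * (y 0 j)%:C%C * cexp (zdot z y))).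
  rewrite /row_form cint_sum; last by move=> j; exact: cintegrableZ.
  by apply: eq_bigr => j _; rewrite /laplace -cintZ.
have iS : cintegrable (fun y => \sum_j h 0 j * (k y * (y 0 j)%:C%C * cexp (zdot z y))).
  by apply: cintegrable_sum => j; exact: cintegrableZ.
rewrite /laplace -!cintB //; last exact: cintegrableB.
set H := fun y => k y * cexp (zdot (z + h) y) - k y * cexp (zdot z y) - _.
have HE y : H y = k y * cexp (zdot z y) * (cexp (zdot h y) - 1 - zdot h y).
  rewrite /H zdotD cexpD.
  have -> : \sum_j h 0 j * (k y * (y 0 j)%:C%C * cexp (zdot z y)) =
      k y * cexp (zdot z y) * zdot h y.
    by rewrite /zdot mulr_sumr; apply: eq_bigr => j _; ring.
  by ring.
have mH : cmeasurable H.
  by apply: cintegrable_measurable; apply: cintegrableB => //; exact: cintegrableB.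
have HG y : normc (H y) <= znorm h ^+ 2 * G y.
  rewrite HE !ComplexField.Normc.normcM.
  have n0 := norm1_ge0 y; have z0 := znorm_ge0 h.
  have h2 := cexp_second_order (zdot h y).
  have h3 : normc (cexp (zdot h y) - 1 - zdot h y) <=
      znorm h ^+ 2 * (2 * expR (2 * norm1 y)).
    apply: (le_trans h2).
    have a1 : normc (zdot h y) ^+ 2 <= znorm h ^+ 2 * norm1 y ^+ 2.
      by rewrite -exprMn lerXn2r ?nnegrE ?normc_ge0 ?mulr_ge0 // normc_zdot.
    have a2 : expR (normc (zdot h y)) <= expR (norm1 y).
      rewrite ler_expR; apply: (le_trans (normc_zdot h y)).
      by rewrite ler_piMl.
    have a3 : norm1 y ^+ 2 <= 2 * expR (norm1 y).
      by have := pow_fact_le 2 n0; rewrite (_ : 2`! = 2%N) // ler_pdivrMr // mulrC.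
    apply: (le_trans (ler_pM _ _ a1 a2)); rewrite ?exprn_ge0 ?normc_ge0 ?expR_ge0 //.
    rewrite -mulrA ler_wpM2l ?exprn_ge0 // (_ : 2 * norm1 y = norm1 y + norm1 y); last by ring.
    by rewrite expRD mulrA ler_wpM2r ?expR_ge0.
  apply: (le_trans (ler_pM _ _ (ler_wpM2l (normc_ge0 (k y)) (normc_cexp_zdot z y)) h3)).
  - by rewrite mulr_ge0 ?normc_ge0.
  - exact: normc_ge0.
  rewrite /G (_ : (znorm z + 2) * norm1 y = znorm z * norm1 y + 2 * norm1 y); last by ring.
  by rewrite expRD le_eqVlt; apply/orP; left; apply/eqP; ring.
apply: (le_trans (normc_cint_le mH (vintegrableZ (znorm h ^+ 2) iG) HG)).
by rewrite vintZ // mulrCA mulrC mulrA.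
Qed.

Lemma laplace_differentiable k z : cexp_integrable k ->
  differentiable (laplace k : V -> C^o) z.
Proof.
move=> ik; have [B B0 HB] := laplace_quadratic z ik.
exact: differentiable_quadratic B0 HB.
Qed.

Definition zsq z : C := \sum_j z 0 j * z 0 j.

Lemma gauss_factor_differentiable z :
  differentiable ((fun w => cexp (- 2^-1 * zsq w)) : V -> C^o) z.
Proof.
have half : normc (2^-1) = 2^-1.
  by rewrite ComplexField.Normc.normcV -[2]/(2%:R) -(rmorph_nat (real_complex R)) normcC normr_nat.
pose e0 := cexp (- 2^-1 * zsq z).
pose zh h : C := \sum_j z 0 j * h 0 j.
pose s := znorm z + 1; have s0 : 0 <= s by rewrite addr_ge0 ?znorm_ge0.
apply: (@differentiable_quadratic _ _ _ _ (fun j => - e0 * z 0 j)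
   (normc e0 * (s ^+ 2 * expR s + 1))).
  by rewrite mulr_ge0 ?normc_ge0 // addr_ge0 // mulr_ge0 ?expR_ge0 ?exprn_ge0.
move=> h h1; have zn := znorm_ge0 h.
have zsq_le g : normc (zsq g) <= znorm g ^+ 2.
  apply: (le_trans (normc_sum _ _)); rewrite expr2 {2}/znorm mulr_sumr; apply: ler_sum => j _.
  rewrite ComplexField.Normc.normcM ler_wpM2r ?normc_ge0 //.
  by rewrite /znorm (bigD1 j) //= lerDl sumr_ge0 // => i _; exact: normc_ge0.
have zh_le : normc (zh h) <= znorm z * znorm h.
  apply: (le_trans (normc_sum _ _)); rewrite {1}/znorm mulr_suml; apply: ler_sum => j _.
  rewrite ComplexField.Normc.normcM ler_wpM2l ?normc_ge0 //.
  by rewrite /znorm (bigD1 j) //= lerDl sumr_ge0 // => i _; exact: normc_ge0.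
pose w := - zh h - 2^-1 * zsq h.
have zsqD : - 2^-1 * zsq (z + h) = - 2^-1 * zsq z + w.
  have -> : zsq (z + h) = zsq z + 2 * zh h + zsq h.
    rewrite /zsq /zh mulr_sumr -!big_split; apply: eq_bigr => j _; rewrite /= mxE; ring.
  by rewrite /w; field.
have rowE : row_form (fun j => - e0 * z 0 j) h = - e0 * zh h.
  by rewrite /row_form /zh mulr_sumr; apply: eq_bigr => j _; ring.
have -> : cexp (- 2^-1 * zsq (z + h)) - cexp (- 2^-1 * zsq z) -
   row_form (fun j => - e0 * z 0 j) h = e0 * ((cexp w - 1 - w) + - 2^-1 * zsq h).
  by rewrite zsqD cexpD rowE -/e0 /w; ring.
rewrite ComplexField.Normc.normcM -mulrA ler_wpM2l ?normc_ge0 //.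
have nw : normc w <= s * znorm h.
  apply: (le_trans (normc_triang _ _)); rewrite !normcN mulrDl mul1r; apply: lerD => //.
  rewrite ComplexField.Normc.normcM half.
  have := zsq_le h; have : znorm h ^+ 2 <= znorm h by rewrite expr2 ler_piMl.
  have := normc_ge0 (zsq h); lra.
apply: (le_trans (normc_triang _ _)); rewrite [leRHS]mulrDl mul1r; apply: lerD.
  apply: (le_trans (cexp_second_order w)).
  rewrite [leRHS]mulrAC; apply: ler_pM; rewrite ?exprn_ge0 ?normc_ge0 ?expR_ge0 //.
    by rewrite -exprMn lerXn2r ?nnegrE ?normc_ge0 // (le_trans (normc_ge0 w)).
  by rewrite ler_expR; apply: (le_trans nw); rewrite ler_piMr.
rewrite ComplexField.Normc.normcM normcN half.
by have := zsq_le h; have := normc_ge0 (zsq h); lra.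
Qed.

(** The inverse of the total mass of the Gaussian weight, see [mass_vint]. *)
Definition mass : R := ((2 * pi) `^ (m%:R / 2))^-1.

Definition weighted (f : E -> Cl) A y : C := f y A * (gweight y)%:C%C.

(** The Segal-Bargmann transform, the integral of e^(<z, y> - <z, z> / 2) f(y) against the
    Gaussian probability measure. *)
Definition segal_bargmann (f : E -> Cl) (z : V) : Cl :=
  [ffun A => mass%:C%C * (cexp (- 2^-1 * zsq z) * laplace (weighted f A) z)].

Lemma weighted_integrable f A : MB f -> cexp_integrable (weighted f A).
Proof.
move=> mbf; have [c1 c2 i1 i2] := MB_coef A mbf.
have rE y : complex.Re (weighted f A y) = coefRe f A y * gweight y.
  by rewrite /weighted cReM /= mulr0 subr0.
have iE y : complex.Im (weighted f A y) = coefIm f A y * gweight y.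
  by rewrite /weighted cImM /= mulr0 add0r.
apply: cexp_integrable_of_parts.
  under eq_fun do rewrite rE; apply: exp_integrable_square => //.
  by apply: vmeasurable_continuous; exact: C1_continuous.
under eq_fun do rewrite iE; apply: exp_integrable_square => //.
by apply: vmeasurable_continuous; exact: C1_continuous.
Qed.

Lemma mass_vint : mass * vint (@gweight R m) = 1.
Proof. by rewrite vint_gweight mulVf // gt_eqF // powR_gt0 // mulr_gt0 // pi_gt0. Qed.

(** At real points this is the reproducing formula. *)
Lemma segal_bargmann_extension f : MB f -> is_holomorphic_extension f (segal_bargmann f).
Proof.
move=> mbf; split=> [A z|x].
  rewrite (_ : (fun w => _) = (fun w : V => (cst (mass%:C%C : C^o) w : C^o) *
     ((cexp (- 2^-1 * zsq w) : C^o) * (laplace (weighted f A) w : C^o)))); last first.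
    by apply/funext => w; rewrite ffunE.
  apply: (@differentiableM _ _ (cst (mass%:C%C : C^o))
     (fun w : V => (cexp (- 2^-1 * zsq w) : C^o) * (laplace (weighted f A) w : C^o))).
    exact: differentiable_cst.
  apply: (@differentiableM _ _ (fun w : V => (cexp (- 2^-1 * zsq w) : C^o))
    (fun w : V => laplace (weighted f A) w : C^o)).
    exact: gauss_factor_differentiable.
  by apply: laplace_differentiable; exact: weighted_integrable.
apply/ffunP => A; rewrite ffunE.
have [H1 H2] := MB_gaussian_mean A mbf x.
have zE y : zdot (complexify x) y = (\sum_j x 0 j * y 0 j)%:C%C.
  by rewrite /zdot rmorph_sum; apply: eq_bigr => j _; rewrite mxE rmorphM.
have sE : - 2^-1 * zsq (complexify x) = (- dotv x x / 2)%:C%C.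
  rewrite /zsq /dotv rmorphM rmorphN rmorph_sum fmorphV rmorph_nat mulNr mulrC -mulNr.
  by congr (- _ * _); apply: eq_bigr => j _; rewrite !mxE rmorphM.
have LE : laplace (weighted f A) (complexify x) =
   (vint (fun y => coefRe f A y * gweight y * expR (\sum_j x 0 j * y 0 j)) +i*
    vint (fun y => coefIm f A y * gweight y * expR (\sum_j x 0 j * y 0 j)))%C.
  rewrite /laplace -[RHS]/(cint (fun y => ((coefRe f A y * gweight y * expR (\sum_j x 0 j * y 0 j))%R +i*
      (coefIm f A y * gweight y * expR (\sum_j x 0 j * y 0 j))%R)%C)).
  apply: eq_cint => y; rewrite zE cexp_real /weighted.
  apply/eqP; rewrite eq_complex !(cReM, cImM) /=.
  by apply/andP; split; apply/eqP; rewrite /coefRe /coefIm; ring.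
rewrite sE cexp_real LE.
apply/eqP; rewrite eq_complex !(cReM, cImM) /= !mul0r !subr0 !addr0.
by rewrite -H1 -H2 !(mulrCA mass) mass_vint !mulr1 !eqxx.
Qed.
End Laplace.

(** * Monogenic plane waves *)

Section PlaneWaves.
Context {R : realType} {m : nat}.
Local Notation C := (R[i] : numFieldType).
Local Notation E := 'rV[R]_m.
Local Notation Cl := (clifford R m).
Local Notation normc := (@ComplexField.Normc.normc R).
Implicit Types (tau : 'rV[C]_m) (u v h : E) (q : C -> C).

Lemma cderivative_mull (a : Cl) (K K' : C -> Cl) z :
  (forall A, cderivative (fun w => K w A) z (K' z A)) ->
  forall D, cderivative (fun w => (a * K w) D) z ((a * K' z) D).
Proof.
move=> H D; rewrite clifford_mulrE.
have -> : (fun w => (a * K w) D) = fun w => \sum_A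
   (-1) ^+ inversions A (symdiff A D) * (a A * K w (symdiff A D)).
  by apply/funext => w; rewrite clifford_mulrE.
by apply: cderivative_sum => A; do 2!apply: cderivativeZ.
Qed.

Lemma norm1_le h : norm1 h <= m%:R * `|h|.
Proof.
rewrite /norm1 -[X in X%:R]card_ord -sum1_card natr_sum mulr_suml.
apply: ler_sum => j _; rewrite mul1r /Num.norm /= mx_normrE.
exact: (le_bigmax _ (fun ij : 'I_1 * 'I_m => `|h ij.1 ij.2|) (0, j)).
Qed.

Lemma derive_plane_wave tau q u d : cderivative q (zdot tau u) d ->
  differentiable (fun u => complex.Re (q (zdot tau u)) : R^o) u /\
  forall v, 'D_v (fun u => complex.Re (q (zdot tau u)) : R) u = complex.Re (zdot tau v * d).
Proof.
move=> Hq.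
have rowE v : row_form (fun j => complex.Re (tau 0 j * d)) v = complex.Re (zdot tau v * d).
  rewrite /row_form /zdot mulr_suml (big_morph _ cReD (erefl (complex.Re 0))).
  apply: eq_bigr => j _; rewrite mulrAC.
  by move: (tau 0 j * d) => w; rewrite mulrC [w * _]mulrC cReM /= mul0r subr0 mulrC.
have [eps eps0|df dE] := @differentiable_of_littleo R m
    (fun u => complex.Re (q (zdot tau u)) : R) u (fun j => complex.Re (tau 0 j * d)).
  pose K := znorm tau * m%:R + 1.
  have K0 : 0 < K by rewrite ltr_wpDl // mulr_ge0 ?znorm_ge0.
  have [|del del0 H] := Hq (eps / K); first by rewrite divr_gt0.
  exists (del / K) => [|h hr]; first by rewrite divr_gt0.
  have nz : normc (zdot tau h) <= K * `|h|.
    apply: (le_trans (normc_zdot _ _)); rewrite mulrDl mul1r ler_wpDr // -mulrA.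
    by rewrite ler_wpM2l ?znorm_ge0 ?norm1_le.
  have zD : zdot tau (u + h) = zdot tau u + zdot tau h.
    by rewrite /zdot -big_split; apply: eq_bigr => j _; rewrite mxE rmorphD mulrDr.
  rewrite rowE zD.
  have e1 : zdot tau u + zdot tau h - zdot tau u = zdot tau h by rewrite addrAC subrr add0r.
  have := H (zdot tau u + zdot tau h); rewrite e1 => /(_ _) H1.
  have {}H1 : normc (q (zdot tau u + zdot tau h) - q (zdot tau u) - d * zdot tau h) <=
     eps / K * normc (zdot tau h).
    by apply: H1; apply: (le_trans nz); rewrite mulrC -ler_pdivlMr // ltW.
  rewrite -!cReN -!cReD (mulrC (zdot tau h)).
  apply: (le_trans (Re_le_normc _)); apply: (le_trans H1).
  rewrite mulrAC ler_pdivrMr // -mulrA ler_wpM2l ?(ltW eps0) // mulrC.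
  exact: le_trans nz _.
by split=> // v; rewrite deriveE // dE rowE.
Qed.

Lemma C1_plane_wave tau q q' : (forall z, cderivative q z (q' z)) ->
  (forall z, exists d, cderivative q' z d) ->
  continuously_differentiable (fun u => complex.Re (q (zdot tau u))) /\
  forall j u, partial j (fun u => complex.Re (q (zdot tau u))) u =
    complex.Re (tau 0 j * q' (zdot tau u)).
Proof.
move=> dq dq'.
have pE j u : partial j (fun u => complex.Re (q (zdot tau u))) u =
    complex.Re (tau 0 j * q' (zdot tau u)).
  have [_ /(_ (delta_mx 0 j))] := derive_plane_wave (dq (zdot tau u)).
  rewrite partialE => ->; congr (complex.Re (_ * _)).
  rewrite /zdot (bigD1 j) //= big1 => [|i ij]; rewrite !mxE ?eqxx ?addr0 ?mulr1 //.
  by rewrite (negPf ij) mulr0.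
split=> //; split=> [u|j]; first exact: (derive_plane_wave (dq _)).1.
rewrite (_ : partial j _ = fun u => complex.Re (tau 0 j * q' (zdot tau u))); last first.
  by apply/funext => u; exact: pE.
move=> u; have [d hd] := dq' (zdot tau u).
have h1 := cderivativeM (cderivative_cst (tau 0 j) (zdot tau u)) hd.
exact: differentiable_continuous (derive_plane_wave h1).1.
Qed.

(** Since e_1 d_1 + ... + e_m d_m turns Q(<u, tau>) into tau Q'(<u, tau>), a plane wave in
    the direction tau is monogenic as soon as tau annihilates Q'. *)
Lemma monogenic_plane_wave tau (Q Q' : C -> Cl) :
  (forall A z, cderivative (fun w => Q w A) z (Q' z A)) ->
  (forall A z, exists d, cderivative (fun w => Q' w A) z d) ->
  (forall z, cvec tau * Q' z = 0) -> monogenic (fun u => Q (zdot tau u)).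
Proof.
move=> dQ dQ' tQ.
have reP A := C1_plane_wave tau (dQ A) (dQ' A).
have imP A : continuously_differentiable (coefIm (fun u => Q (zdot tau u)) A) /\
   forall j u, partial j (coefIm (fun u => Q (zdot tau u)) A) u =
    complex.Im (tau 0 j * Q' (zdot tau u) A).
  have imE (a : C) : complex.Im a = complex.Re (- 'i%C * a).
    by rewrite cReM /=; ring.
  have H1 z : cderivative (fun w => - 'i%C * Q w A) z (- 'i%C * Q' z A).
    have := cderivativeM (cderivative_cst (- 'i%C) z) (dQ A z).
    by rewrite mul0r add0r.
  have H2 z : exists d, cderivative (fun w => - 'i%C * Q' w A) z d.
    have [d hd] := dQ' A z.
    by exists (0 * Q' z A + - 'i%C * d); exact: cderivativeM (cderivative_cst _ _) hd.
  have [c1 pE] := C1_plane_wave tau H1 H2.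
  have fE : coefIm (fun u => Q (zdot tau u)) A = fun u => complex.Re (- 'i%C * Q (zdot tau u) A).
    by apply/funext => u; rewrite /coefIm imE.
  by rewrite fE; split=> // j u; rewrite pE imE; congr (complex.Re _); rewrite mulrCA.
split=> [A|u]; first by split; [exact: (reP A).1|exact: (imP A).1].
have pE j : partial_cl j (fun u => Q (zdot tau u)) u = tau 0 j *: Q' (zdot tau u).
  apply/ffunP => A; rewrite ffunE scale_cliffordE.
  rewrite (reP A).2 (imP A).2; by case: (_ * _).
rewrite /dirac_op; under eq_bigr do rewrite pE -scalerAr scalerAl.
by rewrite -mulr_suml; exact: tQ.
Qed.
End PlaneWaves.

(** * The Hilbert module of the Gaussian weight *)

Section WeightedL2.
Context {R : realType} {m : nat}.
Local Notation C := (R[i] : numFieldType).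
Local Notation E := 'rV[R]_m.
Local Notation Cl := (clifford R m).
Local Notation normc := (@ComplexField.Normc.normc R).
Local Notation mass := (@mass R m).
Implicit Types (f g h : E -> Cl) (a b : Cl).

Definition normsq a : R := \sum_A normc (a A) ^+ 2.

Lemma normsq_ge0 a : 0 <= normsq a.
Proof. by apply: sumr_ge0 => A _; exact: sqr_ge0. Qed.

Lemma normc_le_normsq a A : normc (a A) ^+ 2 <= normsq a.
Proof. by rewrite /normsq (bigD1 A) //= lerDl sumr_ge0 // => B _; exact: sqr_ge0. Qed.

Lemma normcJ (z : C) : normc z^*%C = normc z.
Proof. by case: z => x y /=; rewrite sqrrN. Qed.

Lemma normc_sign n : normc ((-1) ^+ n) = 1.
Proof.
by rewrite normcX normcN ComplexField.Normc.normc1 expr1n.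
Qed.

Lemma dagger_mul_coef a b D : (dagger a * b) D = \sum_A
  (-1) ^+ inversions A (symdiff A D) * ((-1) ^+ inversions A A * (a A)^*%C * b (symdiff A D)).
Proof. by rewrite clifford_mulrE; apply: eq_bigr => A _; rewrite ffunE. Qed.

Lemma dagger1 : dagger (1 : Cl) = 1.
Proof.
apply/ffunP => A; rewrite !ffunE; case: eqVneq => [->|_].
  by rewrite inversions0l conjc1 mul1r.
by rewrite conjc0 mulr0.
Qed.

(** The sign of [dagger] on e_A is that of e_A e_A. *)
Lemma scalar_dagger_mul a b : scalar_part (dagger a * b) = \sum_A (a A)^*%C * b A.
Proof.
rewrite /scalar_part dagger_mul_coef; apply: eq_bigr => A _.
by rewrite symdiff0 !mulrA -exprD -signr_odd oddD addbb mul1r.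
Qed.

Lemma Re_scalar_dagger a : complex.Re (scalar_part (dagger a * a)) = normsq a.
Proof.
rewrite scalar_dagger_mul (big_morph _ cReD (erefl (complex.Re 0))).
apply: eq_bigr => A _; case: (a A) => x y /=.
by rewrite sqr_sqrtr ?addr_ge0 ?sqr_ge0 // !expr2; ring.
Qed.

Lemma normsqD a b :
  normsq (a + b) = normsq a + normsq b + 2 * complex.Re (scalar_part (dagger b * a)).
Proof.
rewrite scalar_dagger_mul (big_morph _ cReD (erefl (complex.Re 0))) mulr_sumr.
rewrite /normsq -!big_split; apply: eq_bigr => A _; rewrite ffunE.
case: (a A) => x y; case: (b A) => u v /=.
by rewrite !sqr_sqrtr ?addr_ge0 ?sqr_ge0 // !expr2; ring.
Qed.

Lemma normsqB_le a b : normsq (a - b) <= 2 * (normsq a + normsq b).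
Proof.
rewrite mulrDr /normsq !mulr_sumr -big_split; apply: ler_sum => A _.
rewrite clifford_subE; case: (a A) => x y; case: (b A) => u v /=.
rewrite !sqr_sqrtr ?addr_ge0 ?sqr_ge0 //.
by have := sqr_ge0 (x + u); have := sqr_ge0 (y + v); lra.
Qed.

Lemma normsqZ (k : C) a : normsq (k *: a) = normc k ^+ 2 * normsq a.
Proof.
rewrite /normsq mulr_sumr; apply: eq_bigr => A _.
by rewrite scale_cliffordE ComplexField.Normc.normcM exprMn.
Qed.

(** 2 |a_A| |b_B| <= lam |a_A|^2 + |b_B|^2 / lam, summed over the pairs that contribute to e_D. *)
Lemma normc_dagger_mul_le a b D (lam : R) : 0 < lam ->
  normc ((dagger a * b) D) <= 2^-1 * (lam * normsq a + lam^-1 * normsq b).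
Proof.
move=> lam0.
have nb : normsq b = \sum_A normc (b (symdiff A D)) ^+ 2.
  by under [RHS]eq_bigr do rewrite symdiffC;
     rewrite [LHS](reindex_inj (can_inj (symdiffK D))).
rewrite dagger_mul_coef nb /normsq !mulr_sumr -big_split mulr_sumr.
apply: (le_trans (normc_sum _ _)); apply: ler_sum => A _.
rewrite !ComplexField.Normc.normcM !normc_sign !mul1r normcJ /=.
move: (normc _) (normc _) => y x.
have li : lam * lam^-1 = 1 by rewrite divff // gt_eqF.
rewrite -subr_ge0 (_ : _ - _ = 2^-1 * lam * (x - lam^-1 * y) ^+ 2).
  by rewrite mulr_ge0 ?sqr_ge0 // mulr_ge0 ?invr_ge0 ?ler0n // ltW.
rewrite (_ : 2^-1 * lam * (x - lam^-1 * y) ^+ 2 = 2^-1 * (lam * x ^+ 2 -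
  2 * (lam * lam^-1) * x * y + (lam * lam^-1) * lam^-1 * y ^+ 2)); last by ring.
by rewrite li; field; rewrite gt_eqF.
Qed.

Definition L2 f := (forall A, cmeasurable (fun y => f y A)) /\
  vintegrable (fun y => normsq (f y) * gweight y).

(** The squared norm, see [MB_normE]. *)
Definition nrm2 f : R := mass * vint (fun y => normsq (f y) * gweight y).

Lemma mass_gt0 : 0 < mass.
Proof. by rewrite invr_gt0 powR_gt0 // mulr_gt0 // pi_gt0. Qed.

Lemma nrm2_ge0 f : 0 <= nrm2 f.
Proof.
rewrite mulr_ge0 ?(ltW mass_gt0) //; apply: vint_ge0 => y.
by rewrite mulr_ge0 ?normsq_ge0 // ltW // gweight_gt0.
Qed.

Lemma vmeasurable_normsq f : (forall A, cmeasurable (fun y => f y A)) ->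
  vmeasurable (fun y => normsq (f y)).
Proof.
move=> mf; apply: vmeasurable_sum => A.
by under eq_fun do rewrite expr2; apply: vmeasurableM; exact: cmeasurable_normc.
Qed.

Lemma L2_le f (G : E -> R) : (forall A, cmeasurable (fun y => f y A)) ->
  vintegrable G -> (forall y, normsq (f y) * gweight y <= G y) -> L2 f.
Proof.
move=> mf iG H; split=> //; apply: vintegrable_le iG.
  by apply: vmeasurableM; [exact: vmeasurable_normsq|exact: vmeasurable_gweight].
move=> y; rewrite ger0_norm // mulr_ge0 ?normsq_ge0 // ltW // gweight_gt0 //.
Qed.

Lemma L2B f g : L2 f -> L2 g -> L2 (f \- g).
Proof.
move=> [mf If] [mg Ig].
apply: (L2_le _ (vintegrableZ 2 (vintegrableD If Ig))) => [A|y].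
  have E1 : (fun y => (f \- g) y A) = fun y => f y A + (-1) * g y A.
    by apply/funext => y; rewrite clifford_subE mulN1r.
  rewrite E1; apply: cmeasurableD => //; apply: cmeasurableM => //.
  exact: cmeasurable_cst.
rewrite -mulrDl mulrA ler_wpM2r ?(ltW (gweight_gt0 _)) //; exact: normsqB_le.
Qed.

Lemma dagger_mul_measurable f g D : (forall A, cmeasurable (fun y => f y A)) ->
  (forall A, cmeasurable (fun y => g y A)) -> cmeasurable (fun y => (dagger (f y) * g y) D).
Proof.
move=> mf mg; under eq_fun do rewrite dagger_mul_coef.
apply: cmeasurable_sum => A; apply: cmeasurableM; first exact: cmeasurable_cst.
apply: cmeasurableM => //; apply: cmeasurableM; first exact: cmeasurable_cst.
have [m1 m2] := mf A; split.
  by rewrite (_ : (fun y => _) = fun y => complex.Re (f y A)) //; apply/funext => y; case: (f y A).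
rewrite (_ : (fun y => _) = fun y => - complex.Im (f y A)); first exact: vmeasurableN.
by apply/funext => y; case: (f y A).
Qed.

Lemma weighted_dagger_le f g D (lam : R) y : 0 < lam ->
  normc (((gweight y)%:C%C *: (dagger (f y) * g y)) D) <=
  2^-1 * (lam * (normsq (f y) * gweight y) + lam^-1 * (normsq (g y) * gweight y)).
Proof.
move=> lam0; have w0 := gweight_gt0 y.
rewrite scale_cliffordE ComplexField.Normc.normcM normcC (ger0_norm (ltW w0)).
rewrite mulrC; apply: (le_trans (ler_wpM2r (ltW w0) (normc_dagger_mul_le (f y) (g y) D lam0))).
by rewrite le_eqVlt; apply/orP; left; apply/eqP; ring.
Qed.

Lemma weighted_dagger_measurable f g D : L2 f -> L2 g ->
  cmeasurable (fun y => ((gweight y)%:C%C *: (dagger (f y) * g y)) D).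
Proof.
move=> [mf _] [mg _]; under eq_fun do rewrite scale_cliffordE; apply: cmeasurableM.
  by apply: cmeasurable_real; exact: vmeasurable_gweight.
exact: dagger_mul_measurable.
Qed.

Lemma inner_integrable f g : L2 f -> L2 g ->
  clintegrable (fun y => (gweight y)%:C%C *: (dagger (f y) * g y)).
Proof.
move=> lf lg D; have [_ If] := lf; have [_ Ig] := lg.
apply: (cintegrable_le (weighted_dagger_measurable D lf lg)
  (vintegrableZ 2^-1 (vintegrableD (vintegrableZ 1 If) (vintegrableZ 1^-1 Ig)))) => y.
exact: weighted_dagger_le.
Qed.

Lemma MB_innerE f g : MB_inner f g = (mass)%:C%C *:
  integral_cl (fun y => (gweight y)%:C%C *: (dagger (f y) * g y)).
Proof. by []. Qed.

(** The Cauchy-Schwarz inequality before the optimization over lam, which every limit argument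
    below performs by its own choice of lam. *)
Lemma inner_le f g D (lam : R) : 0 < lam -> L2 f -> L2 g ->
  normc (MB_inner f g D) <= lam * nrm2 f + lam^-1 * nrm2 g.
Proof.
move=> lam0 lf lg; have [_ If] := lf; have [_ Ig] := lg.
have H := normc_cint_le (weighted_dagger_measurable D lf lg)
  (vintegrableZ 2^-1 (vintegrableD (vintegrableZ lam If) (vintegrableZ lam^-1 Ig)))
  (fun y => weighted_dagger_le f g D y lam0).
rewrite MB_innerE scale_cliffordE ComplexField.Normc.normcM normcC (ger0_norm (ltW mass_gt0)).
rewrite integral_clE; apply: (le_trans (ler_wpM2l (ltW mass_gt0) H)).
rewrite vintZ; last by apply: vintegrableD; exact: vintegrableZ.
rewrite vintD; try exact: vintegrableZ.
rewrite !vintZ // /nrm2.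
by move: (vint _) (vint _) => x y; rewrite le_eqVlt; apply/orP; left; apply/eqP; field; rewrite gt_eqF.
Qed.

Lemma MB_innerBr h f g : L2 h -> L2 f -> L2 g ->
  MB_inner h (f \- g) = MB_inner h f - MB_inner h g.
Proof.
move=> lh lf lg; rewrite !MB_innerE -scalerBr -integral_clB; try exact: inner_integrable.
congr (_ *: integral_cl _); apply/funext => y.
by rewrite -scalerBr -mulrBr.
Qed.

Lemma daggerB a b : dagger (a - b) = dagger a - dagger b.
Proof. by rewrite daggerD -scaleN1r daggerZ rmorphN1 scaleN1r. Qed.

Lemma MB_innerBl f g h : L2 h -> L2 f -> L2 g ->
  MB_inner (f \- g) h = MB_inner f h - MB_inner g h.
Proof.
move=> lh lf lg; rewrite !MB_innerE -scalerBr -integral_clB; try exact: inner_integrable.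
congr (_ *: integral_cl _); apply/funext => y.
by rewrite daggerB -scalerBr -mulrBl.
Qed.

Lemma MB_innerDr h f g : L2 h -> L2 f -> L2 g ->
  MB_inner h (fun y => f y + g y) = MB_inner h f + MB_inner h g.
Proof.
move=> lh lf lg; rewrite !MB_innerE -scalerDr -integral_clD; try exact: inner_integrable.
congr (_ *: integral_cl _); apply/funext => y.
by rewrite -scalerDr -mulrDr.
Qed.

Lemma MB_innerDl f g h : L2 h -> L2 f -> L2 g ->
  MB_inner (fun y => f y + g y) h = MB_inner f h + MB_inner g h.
Proof.
move=> lh lf lg; rewrite !MB_innerE -scalerDr -integral_clD; try exact: inner_integrable.
congr (_ *: integral_cl _); apply/funext => y.
by rewrite daggerD -scalerDr -mulrDl.
Qed.

Lemma L2_0 : L2 (fun=> 0).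
Proof.
split=> [A|]; first by under eq_fun do rewrite ffunE; exact: cmeasurable_cst.
have n0 : normsq 0 = 0.
  by apply: big1 => A _; rewrite ffunE ComplexField.Normc.normc0 expr0n.
by under eq_fun do rewrite n0 mul0r; exact: vintegrable0.
Qed.

Lemma L2D f g : L2 f -> L2 g -> L2 (fun y => f y + g y).
Proof.
move=> lf lg; have := L2B lf (L2B L2_0 lg); congr L2; apply/funext => y /=.
by rewrite sub0r opprK.
Qed.

Lemma MB_inner0r h : L2 h -> MB_inner h (fun=> 0) = 0.
Proof.
move=> lh; have H := MB_innerBr lh L2_0 L2_0; rewrite subrr in H.
by apply: etrans H; congr (MB_inner h _); apply/funext => y /=; rewrite subrr.
Qed.

Lemma MB_inner0l h : L2 h -> MB_inner (fun=> 0) h = 0.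
Proof.
move=> lh; have H := MB_innerBl lh L2_0 L2_0; rewrite subrr in H.
by apply: etrans H; congr (MB_inner _ h); apply/funext => y /=; rewrite subrr.
Qed.

Lemma Re_scalar_weighted f g y :
  complex.Re (((gweight y)%:C%C *: (dagger (f y) * g y)) finset.set0) =
  gweight y * complex.Re (scalar_part (dagger (f y) * g y)).
Proof. by rewrite scale_cliffordE cReM /= mul0r subr0. Qed.

Lemma Re_scalar_inner f g : complex.Re (scalar_part (MB_inner f g)) =
  mass * vint (fun y => gweight y * complex.Re (scalar_part (dagger (f y) * g y))).
Proof.
rewrite MB_innerE /scalar_part scale_cliffordE integral_clE cReM /= mul0r subr0.
by congr (_ * vint _); apply/funext => y; exact: Re_scalar_weighted.
Qed.

Lemma nrm2_inner f : complex.Re (scalar_part (MB_inner f f)) = nrm2 f.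
Proof.
rewrite Re_scalar_inner; congr (_ * vint _); apply/funext => y.
by rewrite Re_scalar_dagger mulrC.
Qed.

Lemma MB_normE f : MB_norm f = Num.sqrt (nrm2 f).
Proof. by rewrite /MB_norm nrm2_inner. Qed.

(** The cross term is twice the real scalar part of <g, f>. *)
Lemma nrm2D f g : L2 f -> L2 g -> MB_inner g f = 0 ->
  nrm2 (fun y => f y + g y) = nrm2 f + nrm2 g.
Proof.
move=> lf lg gf; have [_ If] := lf; have [_ Ig] := lg.
have Ic : vintegrable (fun y => gweight y * complex.Re (scalar_part (dagger (g y) * f y))).
  have [] := inner_integrable lg lf finset.set0.
  by under eq_fun do rewrite Re_scalar_weighted.
have c0 : mass * vint (fun y => gweight y * complex.Re (scalar_part (dagger (g y) * f y))) = 0.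
  by rewrite -Re_scalar_inner gf /scalar_part ffunE.
have E1 : (fun y => normsq (f y + g y) * gweight y) = fun y =>
   (normsq (f y) * gweight y + normsq (g y) * gweight y) +
    2 * (gweight y * complex.Re (scalar_part (dagger (g y) * f y))).
  by apply/funext => y; rewrite normsqD; ring.
rewrite /nrm2 E1 vintD; [|exact: vintegrableD|exact: vintegrableZ].
rewrite vintD // vintZ //.
by rewrite mulrDr [X in _ + X]mulrCA c0 mulr0 addr0 mulrDr.
Qed.

Lemma MB_L2 f : MB f -> L2 f.
Proof.
move=> mbf.
have H A : cmeasurable (fun y => f y A) /\ vintegrable (fun y => normc (f y A) ^+ 2 * gweight y).
  have [c1 c2 i1 i2] := MB_coef A mbf; split.
    by split; apply: vmeasurable_continuous; apply: C1_continuous.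
  have := vintegrableD i1 i2; congr vintegrable; apply/funext => y.
  rewrite /coefRe /coefIm -mulrDl; congr (_ * _).
  by case: (f y A) => a b /=; rewrite sqr_sqrtr ?addr_ge0 ?sqr_ge0.
split=> [A|]; first exact: (H A).1.
under eq_fun do rewrite /normsq mulr_suml.
by apply: vintegrable_sum => A; exact: (H A).2.
Qed.

Lemma monogenic_L2_MB f : monogenic f -> L2 f -> MB f.
Proof.
move=> mf [ms If]; split=> // A; have [[c1 c2]] := mf.1 A => [[d1 d2]].
have w4 y : expR (- eucl_norm y ^+ 2 / 4) ^+ 2 = gweight y :> R.
  by rewrite -expRM_natl /gweight; congr expR; field.
have mw : vmeasurable (fun y : E => expR (- eucl_norm y ^+ 2 / 4)).
  under eq_fun do rewrite eucl_norm2.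
  apply: (vmeasurable_comp (u := expR)); first exact: continuous_expR.
  under eq_fun do rewrite mulrC -mulN1r.
  by do 2 (apply: vmeasurableM; first exact: vmeasurable_cst); exact: vmeasurable_dotv.
have K (g : E -> R) : vmeasurable g -> (forall y, `|g y| <= normc (f y A)) ->
    square_integrable (fun y => g y * expR (- eucl_norm y ^+ 2 / 4)).
  move=> mg Hg; apply/square_integrableP; split; first exact: vmeasurableM.
  under eq_fun do rewrite exprMn w4.
  apply: vintegrable_le If => [|y].
    under eq_fun do rewrite expr2; apply: vmeasurableM; first exact: vmeasurableM.
    exact: vmeasurable_gweight.
  have w0 := ltW (gweight_gt0 y).
  rewrite ger0_norm; last exact: mulr_ge0 (sqr_ge0 _) w0.
  rewrite ler_wpM2r //.
  apply: le_trans (normc_le_normsq (f y) A).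
  by rewrite -[g y ^+ 2]real_normK ?num_real // lerXn2r ?nnegrE ?normc_ge0.
have [m1 m2] := ms A.
split; first by apply: K => // y; exact: Re_le_normc.
by apply: K => // y; exact: Im_le_normc.
Qed.

End WeightedL2.

(** * Gaussian moments along a null direction *)

Section GaussianMoments.
Context {R : realType} {m : nat}.
Local Notation C := (R[i] : numFieldType).
Local Notation V := 'rV[C]_m.
Local Notation E := 'rV[R]_m.
Local Notation Cl := (clifford R m).
Local Notation normc := (@ComplexField.Normc.normc R).
Local Notation mass := (@mass R m).
Implicit Types (z sigma : V) (y : E) (k : E -> C).

Lemma zdotE z y : zdot z y = dotv (complexify y) z.
Proof. by rewrite /zdot /dotv; apply: eq_bigr => j _; rewrite mxE mulrC. Qed.

Lemma cexp_integrable_zdot k z : cexp_integrable k -> cexp_integrable (fun y => k y * zdot z y).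
Proof.
apply: (@cexp_integrableM _ _ _ _ (znorm z) 1); first exact: znorm_ge0.
  exact: cmeasurable_zdot.
move=> y; rewrite mul1r; apply: (le_trans (normc_zdot _ _)).
by rewrite ler_wpM2l ?znorm_ge0 // le_expR_norm1.
Qed.

Lemma cexp_integrable_zdotX k z n : cexp_integrable k ->
  cexp_integrable (fun y => k y * zdot z y ^+ n).
Proof.
move=> ik; elim: n => [|n IH]; first by under eq_fun do rewrite expr0 mulr1.
by under eq_fun do rewrite exprSr mulrA; exact: cexp_integrable_zdot.
Qed.

Lemma cexp_integrable_gweight : cexp_integrable (fun y : E => (gweight y)%:C%C).
Proof.
have [mw iw] := @exp_integrable_gweight R m; split; first exact: cmeasurable_real.
by move=> c; under eq_fun do rewrite normcC.
Qed.

(** The linear term of [laplace_quadratic] in the direction sigma is the transform of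
    k(y) <y, sigma>. *)
Lemma laplace_line_cderivative k sigma (b : C) : cexp_integrable k ->
  cderivative (fun b => laplace k (b *: sigma)) b
    (laplace (fun y => k y * zdot sigma y) (b *: sigma)).
Proof.
move=> ik e e0.
have [B B0 HB] := laplace_quadratic (b *: sigma) ik.
pose N := znorm sigma + 1; have N0 : 0 < N by rewrite ltr_wpDl ?znorm_ge0.
pose K := B * N ^+ 2 + 1; have K0 : 0 < K by rewrite ltr_wpDl // mulr_ge0 // exprn_ge0 // ltW.
exists (Num.min N^-1 (e / K)) => [|w]; first by rewrite lt_min invr_gt0 N0 divr_gt0.
rewrite le_min => /andP[w1 w2].
have zZ : znorm ((w - b) *: sigma) = normc (w - b) * znorm sigma.
  by rewrite /znorm mulr_sumr; apply: eq_bigr => j _; rewrite mxE ComplexField.Normc.normcM.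
have zN : znorm ((w - b) *: sigma) <= normc (w - b) * N.
  by rewrite zZ ler_wpM2l ?normc_ge0 // lerDl.
have h1 : znorm ((w - b) *: sigma) <= 1.
  by apply: (le_trans zN); rewrite -ler_pdivlMr // mul1r.
have rowE : row_form (fun j => laplace (fun y => k y * (y 0 j)%:C%C) (b *: sigma))
    ((w - b) *: sigma) = laplace (fun y => k y * zdot sigma y) (b *: sigma) * (w - b).
  have iKj j : cintegrable (fun y => k y * (y 0 j)%:C%C * cexp (zdot (b *: sigma) y)).
    apply: cexp_integrable_cintegrable; apply: cexp_integrable_kernel.
    exact: cexp_integrable_coord.
  rewrite /laplace; under [in RHS]eq_cint do rewrite /zdot mulr_sumr mulr_suml.
  rewrite cint_sum; last first.
    move=> j; rewrite (_ : (fun y => _) = fun y => sigma 0 j *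
       (k y * (y 0 j)%:C%C * cexp (zdot (b *: sigma) y))); first exact: cintegrableZ.
    by apply/funext => y; ring.
  rewrite mulr_suml /row_form; apply: eq_bigr => j _; rewrite mxE.
  rewrite -mulrA mulrC; congr (_ * _); rewrite -cintZ //; apply: eq_cint => y.
  by rewrite /zdot; ring.
have zE : b *: sigma + (w - b) *: sigma = w *: sigma by rewrite -scalerDl addrC subrK.
have h2 := HB _ h1; rewrite rowE zE in h2.
apply: (le_trans h2).
have n0 := normc_ge0 (w - b).
apply: (@le_trans _ _ (B * (normc (w - b) * N) ^+ 2)).
  by rewrite ler_wpM2l // lerXn2r ?nnegrE ?znorm_ge0 // mulr_ge0 // ltW.
rewrite exprMn mulrCA mulrC expr2 mulrA ler_wpM2r //.
apply: (@le_trans _ _ (K * normc (w - b))); first by rewrite ler_wpM2r // lerDl.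
by rewrite mulrC -ler_pdivlMr.
Qed.

Section NullDirection.
(** For tau = t + i s the hypotheses express that t and s are orthonormal, see
    [null_vector_null]. In the Clifford algebra they become tau tau = 0 and
    tau tau^dagger + tau^dagger tau = 4. *)
Context (tau : V).
Hypothesis tau_null : dotv tau tau = 0.
Let sigma : V := map_mx (@conjc R) tau.
Hypothesis tau_sigma : dotv tau sigma = 2.
Local Notation Z := (zdot tau).
Local Notation Zb := (zdot sigma).

Lemma cvec_anticomm z w : cvec z * cvec w + cvec w * cvec z = (-2 * dotv z w)%:A.
Proof.
have E1 (a b : V) : cvec a * cvec b = \sum_i \sum_j (a 0 i * b 0 j) *: (gen i * gen j).
  rewrite /cvec mulr_suml; apply: eq_bigr => i _; rewrite mulr_sumr; apply: eq_bigr => j _.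
  by rewrite -scalerAl -scalerAr scalerA.
rewrite [cvec w * _]E1 exchange_big [cvec z * _]E1 -big_split /=.
under eq_bigr => i _.
  rewrite -big_split /=; under eq_bigr => j _.
    rewrite (mulrC (w 0 j)) -scalerDr gen_anticomm scalerA.
    over.
  rewrite (bigD1 i) //= big1 => [|j ij]; last by rewrite eq_sym (negPf ij) !mulr0 scale0r.
  rewrite addr0 eqxx mulr1.
  over.
by rewrite -scaler_suml -mulr_suml mulrC.
Qed.

Lemma cvec_null_sq : cvec tau * cvec tau = 0.
Proof.
have := cvec_anticomm tau tau; rewrite tau_null mulr0 scale0r -mulr2n => /eqP.
rewrite -scaler_nat scaler_eq0 pnatr_eq0 /= => /eqP; exact.
Qed.

Lemma vdagger_sigma : vdagger tau = - sigma. Proof. by []. Qed.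

Lemma cvec_dagger_anticomm :
  cvec tau * dagger (cvec tau) + dagger (cvec tau) * cvec tau = 4%:A.
Proof.
rewrite dagger_cvec cvec_anticomm vdagger_sigma; congr (_ *: _).
rewrite (_ : dotv tau (- sigma) = - dotv tau sigma); first by rewrite tau_sigma; ring.
by rewrite /dotv -sumrN; apply: eq_bigr => j _; rewrite mxE mulrN.
Qed.

Lemma cvec_dagger_cvec : cvec tau * dagger (cvec tau) * cvec tau = 4 *: cvec tau.
Proof.
have /(congr1 (fun x => x * cvec tau)) := cvec_dagger_anticomm.
by rewrite mulrDl -[dagger _ * _ * _]mulrA cvec_null_sq mulr0 addr0 -scalerAl mul1r.
Qed.

Lemma dagger_cvec_dagger :
  dagger (cvec tau) * cvec tau * dagger (cvec tau) = 4 *: dagger (cvec tau).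
Proof.
have := congr1 dagger cvec_dagger_cvec; rewrite daggerZ rmorph_nat => <-.
rewrite !daggerM (_ : dagger (dagger (cvec tau)) = cvec tau) ?mulrA //.
rewrite !dagger_cvec; congr cvec; apply/rowP => j; rewrite !mxE rmorphN opprK.
exact: conjcK.
Qed.

Lemma cvec_neq0 : cvec tau != 0.
Proof.
apply/eqP => t0; have := cvec_dagger_anticomm.
rewrite t0 mul0r mulr0 addr0 => /esym/eqP.
by rewrite scaler_eq0 pnatr_eq0 oner_eq0.
Qed.

Lemma zsq_line (b : C) : zsq (b *: sigma) = 0.
Proof.
rewrite (_ : zsq _ = b ^+ 2 * (dotv tau tau)^*%C); first by rewrite tau_null rmorph0 mulr0.
rewrite /zsq /dotv rmorph_sum mulr_sumr; apply: eq_bigr => j _.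
by rewrite !mxE rmorphM /=; ring.
Qed.

(** For b in tau Cl these are the monogenic functions that span MB(tau). *)
Definition zpow l (b : Cl) y : Cl := Z y ^+ l *: b.

Lemma zpow_L2 l b : L2 (zpow l b).
Proof.
have ik := cexp_integrable_zdotX tau (l + l) cexp_integrable_gweight.
have [_ /(_ 0) ik0] := ik.
apply: (L2_le _ (vintegrableZ (normsq b) ik0)) => [A|y].
  under eq_fun do rewrite scale_cliffordE.
  by apply: cmeasurableM; [apply: cmeasurableX; exact: cmeasurable_zdot|exact: cmeasurable_cst].
rewrite mul0r expR0 mulr1 normsqZ ComplexField.Normc.normcM normcC.
rewrite (ger0_norm (ltW (gweight_gt0 y))) exprD ComplexField.Normc.normcM.
by rewrite le_eqVlt; apply/orP; left; apply/eqP; ring.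
Qed.

Lemma zpow_MB l a : MB (zpow l (cvec tau * a)).
Proof.
apply: monogenic_L2_MB; last exact: zpow_L2.
pose Q (z : C) : Cl := z ^+ l *: (cvec tau * a).
pose Q' (z : C) : Cl := ('X^l)^`().[z] *: (cvec tau * a).
suff : monogenic (fun u => Q (zdot tau u)) by [].
apply: (@monogenic_plane_wave _ _ tau Q Q') => [A z|A z|z]; rewrite /Q /Q'.
- have -> : (fun w => (w ^+ l *: (cvec tau * a)) A) = fun w => (cvec tau * a) A * ('X^l).[w].
    by apply/funext => w; rewrite scale_cliffordE hornerXn mulrC.
  by rewrite scale_cliffordE mulrC; apply: cderivativeZ; exact: cderivative_horner.
- exists ((cvec tau * a) A * ('X^l)^`()^`().[z]).
  have -> : (fun w => (('X^l)^`().[w] *: (cvec tau * a)) A) =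
      fun w => (cvec tau * a) A * ('X^l)^`().[w].
    by apply/funext => w; rewrite scale_cliffordE mulrC.
  by apply: cderivativeZ; exact: cderivative_horner.
- by rewrite -scalerAr mulrA cvec_null_sq mul0r scaler0.
Qed.

Lemma zpow_extension l :
  is_holomorphic_extension (zpow l (cvec tau * 1)) (fun z => dotv z tau ^+ l *: (cvec tau * 1)).
Proof.
split=> [A z|x]; last by rewrite /zpow zdotE.
have dL : differentiable (row_form (fun j => tau 0 j) : V -> C^o) z.
  exact: linear_differentiable (@row_form_continuous _ _ _).
elim: l => [|l IH].
  have -> : (fun w => (dotv w tau ^+ 0 *: (cvec tau * 1)) A : C^o) =
      cst ((cvec tau * 1) A : C^o).
    by apply/funext => w; rewrite expr0 scale1r.
  exact: differentiable_cst.
have -> : (fun w => (dotv w tau ^+ l.+1 *: (cvec tau * 1)) A : C^o) =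
   (fun w => (row_form (fun j => tau 0 j) w : C^o) *
     ((dotv w tau ^+ l *: (cvec tau * 1)) A : C^o)).
  by apply/funext => w; rewrite !scale_cliffordE exprS mulrA.
exact: (@differentiableM _ _ (row_form (fun j => tau 0 j) : V -> C^o)
   (fun w => (dotv w tau ^+ l *: (cvec tau * 1)) A : C^o)).
Qed.

Definition moment_kernel (k l : nat) y : C := (gweight y)%:C%C * Z y ^+ k * Zb y ^+ l.

Lemma moment_kernel_integrable (k l : nat) : cexp_integrable (moment_kernel k l).
Proof. by do 2!apply: cexp_integrable_zdotX; exact: cexp_integrable_gweight. Qed.

(** By uniqueness of the extension, <z, tau>^k tau is the Segal-Bargmann transform of
    <x, tau>^k tau. At z = b sigma one has <z, z> = 0 and <z, tau> = 2 b. *)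
Lemma laplace_moment0 (k : nat) (b : C) :
  mass%:C%C * laplace (moment_kernel k 0) (b *: sigma) = (2 * b) ^+ k.
Proof.
have E1 := esym (holomorphic_extension_unique (segal_bargmann_extension (zpow_MB k 1))).
rewrite (holomorphic_extension_unique (zpow_extension k)) in E1.
have /existsP[A tA] : [exists A, (cvec tau) A != 0].
  apply: contraT => /existsPn H; move: cvec_neq0; rewrite -[cvec tau != 0]negbK.
  by case/negP; rewrite negbK; apply/eqP/ffunP => A; rewrite ffunE; have := H A; rewrite negbK => /eqP.
have := congr1 (fun F : V -> Cl => F (b *: sigma) A) E1.
rewrite /= /segal_bargmann ffunE zsq_line mulr0 cexp0 mul1r mulr1 scale_cliffordE.
have -> : dotv (b *: sigma) tau = 2 * b.
  rewrite -tau_sigma /dotv mulr_suml; apply: eq_bigr => j _; rewrite mxE; ring.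
have -> : laplace (weighted (zpow k (cvec tau)) A) (b *: sigma) =
   cvec tau A * laplace (moment_kernel k 0) (b *: sigma).
  rewrite /laplace -cintZ.
    apply: eq_cint => y; rewrite /weighted /zpow /moment_kernel scale_cliffordE expr0.
    by ring.
  apply: cexp_integrable_cintegrable; apply: cexp_integrable_kernel.
  exact: moment_kernel_integrable.
move=> H; apply: (mulIf tA); rewrite -H; ring.
Qed.

(** Each derivative in b brings a factor <y, sigma> under the integral. *)
Lemma laplace_moment (k l : nat) (b : C) :
  mass%:C%C * laplace (moment_kernel k l) (b *: sigma) = ((2 ^+ k) *: 'X^k)^`(l).[b].
Proof.
elim: l b => [|l IH] b.
  by rewrite laplace_moment0 derivn0 hornerZ hornerXn exprMn.
rewrite derivnS.
have H1 : cderivative (fun b => mass%:C%C * laplace (moment_kernel k l) (b *: sigma)) b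
    (mass%:C%C * laplace (moment_kernel k l.+1) (b *: sigma)).
  apply: cderivativeZ.
  have -> : moment_kernel k l.+1 = fun y => moment_kernel k l y * Zb y.
    by apply/funext => y; rewrite /moment_kernel exprSr mulrA.
  by apply: laplace_line_cderivative; exact: moment_kernel_integrable.
apply: (cderivative_unique H1).
have -> : (fun b => mass%:C%C * laplace (moment_kernel k l) (b *: sigma)) =
   fun b => ((2 ^+ k) *: 'X^k)^`(l).[b] by apply/funext.
exact: cderivative_horner.
Qed.

(** The case b = 0 of [laplace_moment]. *)
Lemma gaussian_moment (k l : nat) :
  mass%:C%C * cint (moment_kernel k l) = (2 ^ k * k`!)%:R *+ (k == l).
Proof.
have := laplace_moment k l 0; rewrite scale0r horner_coef0 coef_derivn addn0 coefZ coefXn.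
have -> : laplace (moment_kernel k l) 0 = cint (moment_kernel k l).
  apply: eq_cint => y; rewrite (_ : zdot 0 y = 0) ?cexp0 ?mulr1 //.
  by rewrite /zdot big1 // => j _; rewrite mxE mul0r.
move=> ->; rewrite eq_sym; case: eqP => [->|_]; last by rewrite mulr0 mul0rn.
by rewrite mulr1 ffactnn natrM natrX mulr_natr.
Qed.

End NullDirection.
End GaussianMoments.

Section Fatou.
Context {R : realType} {m : nat}.
Local Notation mR := (measurableTypeR R).
Local Notation E := 'rV[R]_m.

Lemma vint_fatou (h : nat -> E -> R) (g : E -> R) (B : R) :
  (forall n, vintegrable (h n)) -> (forall n (y : E), 0 <= h n y) ->
  vmeasurable g -> (forall y, h ^~ y @ \oo --> g y) ->
  (forall n, vint (h n) <= B) -> vintegrable g /\ vint g <= B.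
Proof.
move=> ih h0 mg hg hB.
have mhE n : measurable_fun setT (fun t => (h n (row_of_tuple t))%:E).
  by apply/measurable_EFinP; exact: vintegrable_measurable.
have hgE (y : E) : (fun n => (h n y)%:E) @ \oo --> (g y)%:E.
  by apply/fine_cvgP; split; [exact: nearW|exact: hg].
have g0 (y : E) : 0 <= g y.
  by rewrite -(cvg_lim (@Rhausdorff R) (hg y)); apply: limr_ge; [exact: (cvgP _ (hg y))|exact: nearW].
have := @fatou _ _ R (@lebesgue_tuple R m) setT measurableT
  (fun n t => (h n (row_of_tuple t))%:E) mhE (fun n t _ => h0 n (row_of_tuple t)).
under eq_integral => t _ do rewrite (cvg_limn_einf_sup (hgE (row_of_tuple t))).1.
move=> H.
have {}H : (\int[@lebesgue_tuple R m]_t (g (row_of_tuple t))%:E <= B%:E)%E.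
  apply: (le_trans H); rewrite limn_einf_lim; apply: lime_le.
    exact: is_cvg_einfs.
  apply: nearW => n; apply: ge_ereal_inf; exists (\int[@lebesgue_tuple R m]_t (h n (row_of_tuple t))%:E)%E.
    by exists n => /=.
  by rewrite EFin_vint // lee_fin.
have ig : vintegrable g.
  apply/integrableP; split; first exact/measurable_EFinP.
  apply: le_lt_trans (ltry B); apply: le_trans H.
  by under eq_integral do rewrite /= ger0_norm ?g0 //.
by split=> //; rewrite -lee_fin -EFin_vint.
Qed.
End Fatou.

(** * Orthogonal expansion along a null direction *)

Section Projection.
Context {R : realType} {m : nat}.
Local Notation C := (R[i] : numFieldType).
Local Notation V := 'rV[C]_m.
Local Notation E := 'rV[R]_m.
Local Notation Cl := (clifford R m).
Local Notation normc := (@ComplexField.Normc.normc R).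
Local Notation mass := (@mass R m).
Implicit Types (y : E) (f g h : E -> Cl).
Context (tau : V).
Hypothesis tau_null : dotv tau tau = 0.
Let sigma : V := map_mx (@conjc R) tau.
Hypothesis tau_sigma : dotv tau sigma = 2.
Local Notation Z := (zdot tau).
Local Notation Zb := (zdot sigma).
Local Notation zpow := (zpow tau).
Local Notation t := (cvec tau).

Lemma conjc_zdot y : (Z y)^*%C = Zb y.
Proof.
rewrite /zdot rmorph_sum; apply: eq_bigr => j _; rewrite rmorphM mxE /=.
by rewrite oppr0.
Qed.

Lemma dagger_zpow l (b : Cl) y : dagger (zpow l b y) = Zb y ^+ l *: dagger b.
Proof. by rewrite daggerZ rmorphXn /= conjc_zdot. Qed.

Lemma scaler_mul_split (k l : C) (a b : Cl) : k *: ((l *: a) * b) = a * (k *: ((l *: 1) * b)).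
Proof. by rewrite -!scalerAl mul1r -!scalerAr. Qed.

Lemma inner_zpow l (b : Cl) g : L2 g ->
  MB_inner (zpow l b) g = dagger b * MB_inner (zpow l 1) g.
Proof.
move=> lg; rewrite !MB_innerE -scalerAr -integral_clMl; last first.
  by apply: inner_integrable => //; exact: zpow_L2.
congr (_ *: integral_cl _); apply/funext => y; rewrite !dagger_zpow dagger1.
exact: scaler_mul_split.
Qed.

Lemma inner_zpow1 l g A :
  MB_inner (zpow l 1) g A = mass%:C%C * cint (fun y => (gweight y)%:C%C * (Zb y ^+ l * g y A)).
Proof.
rewrite MB_innerE scale_cliffordE integral_clE; congr (_ * _); apply: eq_cint => y.
by rewrite scale_cliffordE dagger_zpow dagger1 -scalerAl mul1r scale_cliffordE.
Qed.

Lemma inner_zpow_zpow k l (b : Cl) :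
  MB_inner (zpow k 1) (zpow l b) = ((2 ^ l * l`!)%:R *+ (l == k)) *: b.
Proof.
apply/ffunP => A; rewrite inner_zpow1 scale_cliffordE -(gaussian_moment tau_null tau_sigma).
rewrite -mulrA (mulrC (cint _)) -[b A * _]cintZ.
  congr (_ * _); apply: eq_cint => y; rewrite /zpow scale_cliffordE /moment_kernel -/sigma.
  by ring.
by apply: cexp_integrable_cintegrable; exact: moment_kernel_integrable.
Qed.

(** The coefficient of f along <x, tau>^l tau: 2^l l! is the squared norm of <x, tau>^l, and 4 comes
    from tau^dagger tau tau^dagger = 4 tau^dagger. *)
Definition fourier f l : Cl :=
  (4 * (2 ^ l * l`!)%:R)^-1 *: (dagger t * MB_inner (zpow l 1) f).

Definition partial_sum f n y : Cl := \sum_(l < n) zpow l (t * fourier f l) y.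

Lemma zpow_tauE l (b : Cl) y :
  zpow l (t * b) y = dotv (complexify y) tau ^+ l *: (t * b).
Proof. by rewrite /zpow zdotE. Qed.

Lemma partial_sumS f n : partial_sum f n.+1 =
  fun y => partial_sum f n y + zpow n (t * fourier f n) y.
Proof. by apply/funext => y; rewrite /partial_sum big_ord_recr. Qed.

Lemma partial_sum0 f : partial_sum f 0 = fun=> 0.
Proof. by apply/funext => y; rewrite /partial_sum big_ord0. Qed.

Lemma partial_sum_L2 f n : L2 (partial_sum f n).
Proof.
elim: n => [|n IH]; first by rewrite partial_sum0; exact: L2_0.
by rewrite partial_sumS; apply: L2D => //; exact: zpow_L2.
Qed.

Lemma inner_zpow_partial_sum f n k : MB_inner (zpow k 1) (partial_sum f n) =
  if (k < n)%N then (2 ^ k * k`!)%:R *: (t * fourier f k) else 0.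
Proof.
elim: n => [|n IH]; first by rewrite partial_sum0 MB_inner0r //; exact: zpow_L2.
rewrite partial_sumS MB_innerDr ?IH ?inner_zpow_zpow;
  [|exact: zpow_L2|exact: partial_sum_L2|exact: zpow_L2].
rewrite ltnS [(k <= n)%N]leq_eqVlt eq_sym; case: eqP => [->|_] /=.
  by rewrite ltnn add0r.
by rewrite scale0r addr0.
Qed.

(** Both terms of the difference are b^dagger tau^dagger <Z^k, f>, where Z = <x, tau>: for the
    second one this is tau^dagger tau tau^dagger = 4 tau^dagger. *)
Lemma inner_zpow_remainder f n k (b : Cl) : L2 f -> (k < n)%N ->
  MB_inner (zpow k (t * b)) (f \- partial_sum f n) = 0.
Proof.
move=> lf kn; have ls := partial_sum_L2 f n.
rewrite inner_zpow; last exact: L2B.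
rewrite MB_innerBr //; last exact: zpow_L2.
rewrite inner_zpow_partial_sum kn daggerM -mulrA mulrBr.
have N0 : (2 ^ k * k`!)%:R != 0 :> C.
  by rewrite pnatr_eq0 -lt0n muln_gt0 expn_gt0 fact_gt0.
rewrite /fourier; move: (MB_inner _ f) => M.
have tN (c d : C) : dagger t * (c *: (t * (d *: (dagger t * M)))) = (c * d * 4) *: (dagger t * M).
  rewrite -!scalerAr scalerA !mulrA (dagger_cvec_dagger tau_null tau_sigma).
  by rewrite -scalerAl scalerA.
rewrite tN -mulrA (mulrC _ 4) mulrA (mulrC _ 4) divff; last first.
  by rewrite mulf_neq0 // pnatr_eq0.
by rewrite scale1r subrr mulr0.
Qed.
End Projection.

Section Limits.
Context {R : realType} {m : nat}.
Local Notation C := (R[i] : numFieldType).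
Local Notation Cl := (clifford R m).
Local Notation normc := (@ComplexField.Normc.normc R).

Lemma cvg_sumr (I : Type) (s : seq I) (F : I -> nat -> R) (l : I -> R) :
  (forall i, F i @ \oo --> l i) ->
  (fun n => \sum_(i <- s) F i n) @ \oo --> \sum_(i <- s) l i.
Proof.
move=> H; elim: s => [|i s IH].
  by rewrite big_nil; under eq_fun do rewrite big_nil; exact: cvg_cst.
rewrite big_cons; under eq_fun do rewrite big_cons.
exact: cvgD (H i) IH.
Qed.

Lemma normsq_cvg (u : nat -> Cl) (l : Cl) (B : {set 'I_m} -> R) :
  (forall A n, normc (u n A - l A) <= B A * 2^-1 ^+ n) ->
  (fun n => normsq (u n)) @ \oo --> normsq l.
Proof.
move=> H; apply: cvg_sumr => A.
have B0 : (fun n => B A * 2^-1 ^+ n) @ \oo --> (0 : R).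
  rewrite -[X in _ --> X](mulr0 (B A)); apply: cvgMl_tmp.
  by apply: cvg_expr; rewrite ger0_norm // invf_lt1 // ltr1n.
have cu : (fun n => normc (u n A)) @ \oo --> normc (l A).
  apply: (@squeeze_cvgr _ _ _ _ (fun n => normc (l A) - B A * 2^-1 ^+ n)
      (fun n => normc (l A) + B A * 2^-1 ^+ n)).
  - apply: nearW => n; have h := H A n.
    have h1 : normc (l A) <= normc (u n A) + normc (u n A - l A).
      by rewrite -(normcB (l A)); apply: le_trans (normc_triang _ _); rewrite addrC subrK.
    have h2 : normc (u n A) <= normc (l A) + normc (u n A - l A).
      by apply: le_trans (normc_triang _ _); rewrite addrC subrK.
    by apply/andP; split; lra.
  - by rewrite -[X in _ --> X]subr0; apply: cvgB B0; exact: cvg_cst.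
  - by rewrite -[X in _ --> X]addr0; apply: cvgD B0; exact: cvg_cst.
rewrite expr2; under eq_fun do rewrite expr2.
exact: cvgM.
Qed.

(** Choose lam of the order of e, then M of the order of lam e. *)
Lemma le0_of_scaling (x N : R) : 0 <= N ->
  (forall e, 0 < e -> exists2 M, M <= e & forall lam, 0 < lam -> x <= lam * N + lam^-1 * M) ->
  x <= 0.
Proof.
move=> N0 H; apply/ler_addgt0Pr => e e0; rewrite add0r.
pose lam := e / (2 * (N + 1)).
have N1 : 0 < N + 1 by rewrite ltr_wpDl.
have lam0 : 0 < lam by rewrite divr_gt0 // mulr_gt0.
have [|M hM /(_ lam lam0) hx] := H (lam * (e / 2)); first by rewrite mulr_gt0 // divr_gt0.
apply: (le_trans hx); rewrite (splitr e); apply: lerD.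
  rewrite /lam mulrAC ler_pdivrMr ?mulr_gt0 //.
  rewrite (_ : e / 2 * (2 * (N + 1)) = e * (N + 1)); last by field.
  by rewrite ler_wpM2l ?(ltW e0) // lerDl.
apply: (le_trans (ler_wpM2l _ hM)); first by rewrite invr_ge0 ltW.
by rewrite mulKf // gt_eqF.
Qed.

(** Continuity of the inner product in the second argument: w is the value of <h, -> at arbitrarily
    small elements. *)
Lemma inner_le0 (h : 'rV[R]_m -> Cl) w : L2 h ->
  (forall e : R, 0 < e -> exists g', [/\ L2 g', MB_inner h g' = w & nrm2 g' <= e]) -> w = 0.
Proof.
move=> lh H; apply/ffunP => D; rewrite ffunE; apply: (@ComplexField.Normc.eq0_normc R).
apply/eqP; rewrite eq_le normc_ge0 andbT.
apply: (le0_of_scaling (nrm2_ge0 h)) => e e0.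
have [g' [lg' <- hg']] := H e e0; exists (nrm2 g') => // lam lam0; exact: inner_le.
Qed.

Lemma inner_le0l (g : 'rV[R]_m -> Cl) w : L2 g ->
  (forall e : R, 0 < e -> exists h', [/\ L2 h', MB_inner h' g = w & nrm2 h' <= e]) -> w = 0.
Proof.
move=> lg H; apply/ffunP => D; rewrite ffunE; apply: (@ComplexField.Normc.eq0_normc R).
apply/eqP; rewrite eq_le normc_ge0 andbT.
apply: (le0_of_scaling (nrm2_ge0 g)) => e e0.
have [h' [lh' <- hh']] := H e e0; exists (nrm2 h') => // lam lam0.
by rewrite addrC -[X in X * nrm2 g]invrK; apply: inner_le; rewrite ?invr_gt0.
Qed.
End Limits.

(** * The sum of the expansion *)

Section Radon.
Context {R : realType} {m : nat}.
Local Notation C := (R[i] : numFieldType).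
Local Notation V := 'rV[C]_m.
Local Notation E := 'rV[R]_m.
Local Notation Cl := (clifford R m).
Local Notation normc := (@ComplexField.Normc.normc R).
Local Notation mass := (@mass R m).
Implicit Types (y : E) (f g h : E -> Cl).
Context (tau : V).
Hypothesis tau_null : dotv tau tau = 0.
Let sigma : V := map_mx (@conjc R) tau.
Hypothesis tau_sigma : dotv tau sigma = 2.
Local Notation Z := (zdot tau).
Local Notation Zb := (zdot sigma).
Local Notation zpow := (zpow tau).
Local Notation t := (cvec tau).

(** The closed form of the projection: [segal_bargmann] is the holomorphic extension, and sigma is
    minus the Hermitian conjugate of tau. *)
Definition radon f y : Cl :=
  4^-1 *: (t * dagger t) * segal_bargmann f ((2^-1 * Z y) *: sigma).

(** The Gaussian factor is 1 because sigma is a null vector. *)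
Lemma segal_bargmann_null f (b : C) A :
  segal_bargmann f (b *: sigma) A = mass%:C%C * laplace (weighted f A) (b *: sigma).
Proof. by rewrite ffunE (zsq_line tau_null) mulr0 cexp0 mul1r. Qed.

(** A plane wave Q(<u, tau>) with Q in the right ideal tau Cl, which tau annihilates. *)
Lemma radon_monogenic f : MB f -> monogenic (radon f).
Proof.
move=> mbf.
pose v : V := 2^-1 *: sigma.
pose a : Cl := 4^-1 *: (t * dagger t).
pose k0 A := weighted f A.
pose k1 A y := k0 A y * zdot v y.
pose k2 A y := k1 A y * zdot v y.
have i0 A : cexp_integrable (k0 A) by exact: weighted_integrable.
have i1 A : cexp_integrable (k1 A) by exact: cexp_integrable_zdot.
have [K KE] : exists K : ({set 'I_m} -> E -> C) -> C -> Cl,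
    forall k z A, K k z A = mass%:C%C * laplace (k A) (z *: v).
  exists (fun k z => [ffun A => mass%:C%C * laplace (k A) (z *: v)]) => k z A; exact: ffunE.
have dK k z A : cexp_integrable (k A) ->
    cderivative (fun w => K k w A) z (K (fun A y => k A y * zdot v y) z A).
  move=> ik; rewrite KE.
  have -> : (fun w => K k w A) = fun w => mass%:C%C * laplace (k A) (w *: v).
    by apply/funext => w; exact: KE.
  by apply: cderivativeZ; exact: laplace_line_cderivative.
have -> : radon f = fun u => (fun z => a * K k0 z) (zdot tau u).
  apply/funext => u; congr (_ * _); apply/ffunP => A.
  have vE : (2^-1 * zdot tau u) *: sigma = zdot tau u *: v by rewrite /v scalerA mulrC.
  by apply: etrans (segal_bargmann_null f _ A) _; rewrite vE; exact: esym (KE _ _ _).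
apply: (@monogenic_plane_wave _ _ tau (fun z => a * K k0 z) (fun z => a * K k1 z)) => [D z|D z|z].
- by apply: (@cderivative_mull _ _ a (K k0) (K k1)) => A; exact: dK.
- exists ((a * K k2 z) D).
  by apply: (@cderivative_mull _ _ a (K k1) (K k2)) => A; exact: dK.
- by rewrite mulrA /a -scalerAr mulrA (cvec_null_sq tau_null) mul0r scaler0 mul0r.
Qed.

(** The transform of f along the line z sigma / 2, with the kernel e^(z <y, sigma> / 2) replaced by its
    Taylor polynomial, see [taylor_kernelE]. *)
Definition taylor_kernel f n (z : C) : Cl :=
  \sum_(l < n) ((2 ^ l * l`!)%:R^-1 * z ^+ l) *: MB_inner (zpow l 1) f.

Lemma scaler_mul_regroup (a k b c : C) (x y w : Cl) : a * k = c * b ->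
  a *: (x * (k *: (y * w))) = (b *: (x * y)) * (c *: w).
Proof. by move=> E; rewrite -!scalerAr -scalerAl !scalerA mulrA E. Qed.

Lemma partial_sum_taylor f n y :
  partial_sum tau f n y = 4^-1 *: (t * dagger t) * taylor_kernel f n (Z y).
Proof.
rewrite /partial_sum /taylor_kernel mulr_sumr; apply: eq_bigr => l _.
by apply: scaler_mul_regroup; rewrite invfM; ring.
Qed.

Lemma taylor_kernelE f n (z : C) A : MB f -> taylor_kernel f n z A =
  mass%:C%C * cint (fun y => weighted f A y * exp_poly (2^-1 * z * Zb y) n).
Proof.
move=> mbf; rewrite /taylor_kernel sum_ffunE.
have il (l : nat) : cintegrable (fun y => weighted f A y * Zb y ^+ l).
  apply: cexp_integrable_cintegrable; apply: cexp_integrable_zdotX.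
  exact: weighted_integrable.
have E1 y : weighted f A y * exp_poly (2^-1 * z * Zb y) n =
   \sum_(l < n) ((2 ^ l * l`!)%:R^-1 * z ^+ l) * (weighted f A y * Zb y ^+ l).
  rewrite /exp_poly mulr_sumr; apply: eq_bigr => l _.
  by rewrite !exprMn exprVn natrM natrX invfM; ring.
rewrite (eq_cint E1) cint_sum; last by move=> l; exact: cintegrableZ.
rewrite mulr_sumr; apply: eq_bigr => l _.
rewrite scale_cliffordE inner_zpow1 cintZ // mulrCA; congr (_ * (_ * _)).
by apply: eq_cint => y; rewrite /weighted /sigma; ring.
Qed.

Lemma taylor_kernel_bound f (z : C) A : MB f -> exists B : R, forall n,
  normc (taylor_kernel f n z A - segal_bargmann f ((2^-1 * z) *: sigma) A) <= B * 2^-1 ^+ n.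
Proof.
move=> mbf; have ik := weighted_integrable A mbf; have [mk ikc] := ik.
pose c := 3 * (normc (2^-1 * z) * znorm sigma).
pose G y := normc (weighted f A y) * expR (c * norm1 y).
have iG : vintegrable G by exact: ikc.
have mass0 : 0 < mass by exact: mass_gt0.
exists (mass * (2 * vint G)) => n.
have zE y : zdot ((2^-1 * z) *: sigma) y = 2^-1 * z * Zb y by rewrite zdotZ.
have i1 : cintegrable (fun y => weighted f A y * cexp (2^-1 * z * Zb y)).
  have := cexp_integrable_cintegrable (cexp_integrable_kernel ((2^-1 * z) *: sigma) ik).
  by congr cintegrable; apply/funext => y; rewrite zE.
have i2 : cintegrable (fun y => weighted f A y * exp_poly (2^-1 * z * Zb y) n).
  have i3 (l : nat) : cintegrable (fun y => (l`!%:R^-1 * (2^-1 * z) ^+ l) * (weighted f A y * Zb y ^+ l)).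
    apply: cintegrableZ; apply: cexp_integrable_cintegrable.
    exact: cexp_integrable_zdotX.
  have := @cintegrable_sum _ _ _ (enum 'I_n) (fun l y => (l`!%:R^-1 * (2^-1 * z) ^+ l) * (weighted f A y * Zb y ^+ l))
     (fun l => i3 l).
  congr cintegrable; apply/funext => y; rewrite /exp_poly mulr_sumr big_enum.
  by apply: eq_bigr => l _; rewrite [in RHS]exprMn; ring.
rewrite taylor_kernelE // segal_bargmann_null -mulrBr ComplexField.Normc.normcM normcC.
rewrite ger0_norm ?(ltW mass0) // -!mulrA ler_wpM2l ?(ltW mass0) //.
rewrite [laplace _ _](eq_cint (fun y => congr1 (fun w => weighted f A y * cexp w) (zE y))).
rewrite -cintB //.
have mD : cmeasurable (fun y => weighted f A y * exp_poly (2^-1 * z * Zb y) n -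
    weighted f A y * cexp (2^-1 * z * Zb y)).
  by apply: cintegrable_measurable; exact: cintegrableB.
have HD y : normc (weighted f A y * exp_poly (2^-1 * z * Zb y) n -
    weighted f A y * cexp (2^-1 * z * Zb y)) <= 2^-1 ^+ n * G y.
  rewrite -mulrBr ComplexField.Normc.normcM normcB /G mulrCA ler_wpM2l ?normc_ge0 //.
  apply: (le_trans (cexp_taylor_geometric _ _)); rewrite ler_wpM2l ?exprn_ge0 ?invr_ge0 //.
  rewrite ler_expR /c -[leRHS]mulrA -[_ * _ * norm1 y]mulrA ler_wpM2l // ComplexField.Normc.normcM ler_wpM2l ?normc_ge0 //.
  exact: normc_zdot.
apply: (le_trans (normc_cint_le mD (vintegrableZ _ iG) HD)).
by rewrite vintZ // [2^-1 ^+ n * _]mulrC.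
Qed.

Lemma partial_sum_bound f y : MB f -> exists B : {set 'I_m} -> R, forall A n,
  normc (partial_sum tau f n y A - radon f y A) <= B A * 2^-1 ^+ n.
Proof.
move=> mbf.
have /choice[B0 HB] A := taylor_kernel_bound (Z y) A mbf.
pose a : Cl := 4^-1 *: (t * dagger t).
exists (fun D => \sum_A normc (a A) * B0 (symdiff A D)) => D n.
rewrite partial_sum_taylor /radon -clifford_subE -mulrBr -/a clifford_mulrE mulr_suml.
apply: (le_trans (normc_sum _ _)); apply: ler_sum => A _.
rewrite !ComplexField.Normc.normcM normc_sign mul1r -mulrA ler_wpM2l ?normc_ge0 //.
by rewrite clifford_subE; exact: HB.
Qed.

Lemma inner_partial_sum_remainder f n j : L2 f -> (j <= n)%N ->
  MB_inner (partial_sum tau f j) (f \- partial_sum tau f n) = 0.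
Proof.
move=> lf; have lr := L2B lf (partial_sum_L2 tau f n).
elim: j => [|j IH] jn; first by rewrite partial_sum0 MB_inner0l.
rewrite partial_sumS MB_innerDl ?(IH (ltnW jn)) ?inner_zpow_remainder ?add0r //.
  exact: partial_sum_L2.
exact: zpow_L2.
Qed.

(** f - S_n is orthogonal to S_n - S_k. *)
Lemma nrm2_remainder f k n : L2 f -> (k <= n)%N ->
  nrm2 (f \- partial_sum tau f k) =
  nrm2 (f \- partial_sum tau f n) + nrm2 (partial_sum tau f n \- partial_sum tau f k).
Proof.
move=> lf kn; have ln := partial_sum_L2 tau f n; have lk := partial_sum_L2 tau f k.
rewrite -nrm2D; [|exact: L2B|exact: L2B|].
  by congr nrm2; apply/funext => y /=; rewrite addrA subrK.
rewrite MB_innerBl //; last exact: L2B.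
by rewrite !inner_partial_sum_remainder // subrr.
Qed.

(** The squared distances d_k from f to S_k decrease to some D, and |S_n - S_k|^2 = d_k - d_n is at
    most d_k - D. As n grows S_n tends pointwise to [radon f], so that Fatou's lemma gives the
    same bound for |radon f - S_k|^2, which tends to 0 as k grows. *)
Lemma radon_remainder f : MB f -> exists D : R,
  (fun k => nrm2 (f \- partial_sum tau f k)) @ \oo --> D /\
  forall k, L2 (radon f \- partial_sum tau f k) /\
   nrm2 (radon f \- partial_sum tau f k) <= nrm2 (f \- partial_sum tau f k) - D.
Proof.
move=> mbf; have lf := MB_L2 mbf; pose S := partial_sum tau f.
pose d k := nrm2 (f \- S k).
have nd : nonincreasing_seq d.
  by move=> k n kn; rewrite /d [leRHS](nrm2_remainder lf kn) lerDl nrm2_ge0.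
have bd : has_lbound (range d) by exists 0 => _ [k _ <-]; exact: nrm2_ge0.
have cd := nonincreasing_is_cvgn nd bd.
exists (limn d); split=> // k.
have dD n : limn d <= d n by exact: nonincreasing_cvgn_ge.
have mP A : cmeasurable (fun y => radon f y A).
  by have [c1 c2] := (radon_monogenic mbf).1 A; split; apply: vmeasurable_continuous; exact: C1_continuous.
have lS n : L2 (S n) := partial_sum_L2 tau f n.
have mPS A : cmeasurable (fun y => (radon f \- S k) y A).
  have -> : (fun y => (radon f \- S k) y A) = fun y => radon f y A + (-1) * S k y A.
    by apply/funext => y; rewrite clifford_subE mulN1r.
  by apply: cmeasurableD => //; apply: cmeasurableM; [exact: cmeasurable_cst|exact: (lS k).1].
have mass0 : 0 < mass by exact: mass_gt0.
have [|||||i1 i2] := @vint_fatou R m (fun n y => normsq ((S (k + n)%N \- S k) y) * gweight y)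
  (fun y => normsq ((radon f \- S k) y) * gweight y) (mass^-1 * (d k - limn d)).
- by move=> n; exact: (L2B (lS _) (lS _)).2.
- by move=> n y; rewrite mulr_ge0 ?normsq_ge0 // ltW // gweight_gt0.
- by apply: vmeasurableM; [exact: vmeasurable_normsq|exact: vmeasurable_gweight].
- move=> y; apply: cvgMr_tmp; have [B HB] := partial_sum_bound y mbf.
  apply: (@normsq_cvg _ _ _ _ (fun A => B A * 2^-1 ^+ k)) => A n.
  by rewrite -mulrA -exprD /= !clifford_subE opprB addrA subrK; exact: HB.
- move=> n; rewrite ler_pdivlMl // -/(nrm2 (S (k + n)%N \- S k)).
  have := nrm2_remainder lf (leq_addr n k); rewrite -/(d k) -/(d (k + n)%N) -/S => ->.
  by rewrite addrAC lerDr subr_ge0.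
by split; [split|rewrite /nrm2 -ler_pdivlMl].
Qed.

End Radon.

(** * The orthogonal projection *)

Section OrthogonalProjection.
Context {R : realType} {m : nat}.
Local Notation C := (R[i] : numFieldType).
Local Notation V := 'rV[C]_m.
Local Notation E := 'rV[R]_m.
Local Notation Cl := (clifford R m).
Local Notation normc := (@ComplexField.Normc.normc R).
Implicit Types (y : E) (f g h p : E -> Cl).

Lemma nrm2_lt_of_MB_norm f (e : R) : 0 < e -> MB_norm f < e -> nrm2 f < e ^+ 2.
Proof.
by move=> e0; rewrite MB_normE -[X in _ < X](ger0_norm (ltW e0)) -sqrtr_sqr ltr_sqrt ?exprn_gt0.
Qed.

Lemma MB_norm_lt f (e : R) : 0 < e -> nrm2 f < e ^+ 2 -> MB_norm f < e.
Proof.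
by move=> e0; rewrite MB_normE -[X in _ -> _ < X](ger0_norm (ltW e0)) -sqrtr_sqr ltr_sqrt ?exprn_gt0.
Qed.

(** By the reproducing formula f(x) - g(x) is an integral against f - g, and the inequality
    2 |u| e <= lam e^2 + u^2 / lam bounds it by lam times a constant, for every lam > 0. *)
Lemma nrm2_sub_eq0 f g : MB f -> MB g -> nrm2 (f \- g) = 0 -> f = g.
Proof.
move=> mf mg fg0.
have lfg := L2B (MB_L2 mf) (MB_L2 mg).
have v0 : vint (fun y => normsq ((f \- g) y) * gweight y) = 0.
  by move: fg0 => /eqP; rewrite mulf_eq0 (gt_eqF mass_gt0) /= => /eqP.
apply/funext => x; rewrite -(segal_bargmann_extension mf).2 -(segal_bargmann_extension mg).2.
apply/ffunP => A; rewrite !ffunE; congr (_ * (_ * _)).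
set z := complexify x.
have iK h : MB h -> cintegrable (fun y => weighted h A y * cexp (zdot z y)).
  move=> mh; apply: cexp_integrable_cintegrable; apply: cexp_integrable_kernel.
  exact: weighted_integrable.
apply/eqP; rewrite -subr_eq0 /laplace -cintB; [|exact: iK|exact: iK].
set D := fun y => _.
have mD : cmeasurable D.
  by apply: cintegrable_measurable; apply: cintegrableB; exact: iK.
pose G y := gweight y * expR (2 * znorm z * norm1 y).
have iG : vintegrable G.
  have [_ /(_ (2 * znorm z))] := @exp_integrable_gweight R m.
  by congr vintegrable; apply/funext => y; rewrite ger0_norm // ltW // gweight_gt0.
have G0 : 0 <= vint G.
  by apply: vint_ge0 => y; rewrite mulr_ge0 ?expR_ge0 // ltW // gweight_gt0.
have HD (lam : R) y : 0 < lam -> normc (D y) <=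
    2^-1 * (lam * G y + lam^-1 * (normsq ((f \- g) y) * gweight y)).
  move=> lam0.
  have -> : D y = (f \- g) y A * (gweight y)%:C%C * cexp (zdot z y).
    by rewrite /D /weighted clifford_subE; ring.
  rewrite !ComplexField.Normc.normcM normcC (ger0_norm (ltW (gweight_gt0 y))).
  have h1 := normc_le_normsq ((f \- g) y) A.
  have h2 := normc_cexp_zdot z y.
  have w0 := ltW (gweight_gt0 y).
  rewrite /G -mulrA (_ : 2 * znorm z * norm1 y = 2 * (znorm z * norm1 y)); last by ring.
  rewrite expRM_natl.
  move: (normc_ge0 ((f \- g) y A)) (normc_ge0 (cexp (zdot z y))) h1 h2 w0.
  move: (normc _) (normsq _) (normc _) (expR _) (gweight y) => c b a d w a0 c0 ab cd w0.
  have li : 0 < lam^-1 by rewrite invr_gt0.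
  have ll : lam * lam^-1 = 1 by rewrite divff // gt_eqF.
  apply: (@le_trans _ _ (w * (a * d))).
    by rewrite mulrCA ler_wpM2l // ler_wpM2l.
  apply: (@le_trans _ _ (2^-1 * (lam * (w * d ^+ 2) + lam^-1 * (a ^+ 2 * w)))); last first.
    rewrite ler_wpM2l ?invr_ge0 // lerD2l ler_wpM2l ?(ltW li) // ler_wpM2r //.
  rewrite -subr_ge0 (_ : _ - _ = 2^-1 * (w * lam) * (d - lam^-1 * a) ^+ 2).
    by rewrite mulr_ge0 ?sqr_ge0 // mulr_ge0 ?invr_ge0 // mulr_ge0 // ltW.
  rewrite (_ : 2^-1 * (w * lam) * (d - lam^-1 * a) ^+ 2 = 2^-1 * w * (lam * d ^+ 2 -
    2 * (lam * lam^-1) * d * a + (lam * lam^-1) * lam^-1 * a ^+ 2)); last by ring.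
  by rewrite ll; field; rewrite gt_eqF.
apply/eqP/(@ComplexField.Normc.eq0_normc R)/eqP; rewrite eq_le normc_ge0 andbT.
apply: (le0_of_scaling G0) => e e0; exists 0; first exact: ltW.
move=> lam lam0.
have I1 := vintegrableZ lam iG; have I2 := vintegrableZ lam^-1 lfg.2.
apply: (le_trans (normc_cint_le mD (vintegrableZ 2^-1 (vintegrableD I1 I2)) (fun y => HD lam y lam0))).
rewrite vintZ; last exact: vintegrableD.
rewrite vintD // !vintZ //; last exact: lfg.2.
by rewrite v0 mulr0 !addr0 mulVKf.
Qed.

(** Both p and q make <h, p - q> vanish for h in M, in particular for h = p and for h = q. *)
Lemma orthogonal_projection_unique (M : set (E -> Cl)) f p q : MB f -> M `<=` MB ->
  is_orthogonal_projection M f p -> is_orthogonal_projection M f q -> p = q.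
Proof.
move=> mf MM [Mp Hp] [Mq Hq].
have [mp mq] := (MM _ Mp, MM _ Mq).
have [[lf lp] lq] := (MB_L2 mf, MB_L2 mp, MB_L2 mq).
have E1 : p \- q = (f \- q) \- (f \- p).
  by apply/funext => y /=; rewrite opprB [RHS]addrC addrA subrK.
have H h : M h -> MB_inner h (p \- q) = 0.
  move=> Mh; rewrite E1 MB_innerBr; [|exact: MB_L2 (MM _ Mh)|exact: L2B|exact: L2B].
  by rewrite Hp // Hq // subrr.
apply: nrm2_sub_eq0 => //; rewrite -nrm2_inner MB_innerBl //; last exact: L2B.
by rewrite !H // subrr /scalar_part ffunE.
Qed.

Context (tau : V).
Hypothesis tau_null : dotv tau tau = 0.
Let sigma : V := map_mx (@conjc R) tau.
Hypothesis tau_sigma : dotv tau sigma = 2.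
Local Notation t := (cvec tau).

Lemma radon_L2 f : MB f -> L2 (radon tau f).
Proof.
move=> mbf; have [D [_ /(_ 0)[lP _]]] := radon_remainder tau_null tau_sigma mbf.
move: lP; congr L2; apply/funext => y /=.
by rewrite partial_sum0 subr0.
Qed.

Lemma radon_MB f : MB f -> MB (radon tau f).
Proof.
move=> mbf; apply: monogenic_L2_MB; last exact: radon_L2.
exact: radon_monogenic.
Qed.

Lemma partial_sum_cvg f (e : R) : MB f -> 0 < e -> exists N, forall n, (N <= n)%N ->
  nrm2 (radon tau f \- partial_sum tau f n) < e.
Proof.
move=> mbf e0; have [D [cD HD]] := radon_remainder tau_null tau_sigma mbf.
have /cvgrPdist_lt /(_ e e0) [N _ HN] := cD.
exists N => n Nn; apply: (le_lt_trans (HD n).2).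
by have := HN n Nn; rewrite distrC; apply: le_lt_trans; exact: ler_norm.
Qed.

Lemma partial_sum_combination f n : tau_combination tau (partial_sum tau f n).
Proof.
exists n, (fun l : 'I_n => fourier tau f l); apply/funext => x.
by apply: eq_bigr => l _; rewrite zpow_tauE.
Qed.

Lemma radon_MB_tau f : MB f -> MB_tau tau (radon tau f).
Proof.
move=> mbf; split=> [|e e0]; first exact: radon_MB.
have [N HN] := partial_sum_cvg mbf (exprn_gt0 2 e0).
exists (partial_sum tau f N); first exact: partial_sum_combination.
by apply: MB_norm_lt => //; exact: HN.
Qed.

(** f - S_n is orthogonal to this function for n > k, and radon f - S_n tends to 0. *)
Lemma inner_zpow_radon f k (b : Cl) : MB f ->
  MB_inner (zpow tau k (t * b)) (f \- radon tau f) = 0.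
Proof.
move=> mbf; have [lf lP] := (MB_L2 mbf, radon_L2 mbf).
have lz : L2 (zpow tau k (t * b)) by exact: zpow_L2.
suff H : MB_inner (zpow tau k (t * b)) (radon tau f \- f) = 0.
  by rewrite (MB_innerBr lz lf lP) -opprB -(MB_innerBr lz lP lf) H oppr0.
apply: (inner_le0 lz) => e e0; have [N HN] := partial_sum_cvg mbf e0.
pose n := maxn N k.+1; have ls := partial_sum_L2 tau f n.
exists (radon tau f \- partial_sum tau f n); split.
- exact: L2B.
- have := inner_zpow_remainder tau_null tau_sigma b lf (leq_maxr N k.+1 : (k < n)%N).
  rewrite (MB_innerBr lz lf ls) (MB_innerBr lz lP ls) (MB_innerBr lz lP lf) => /eqP.
  by rewrite subr_eq0 => /eqP ->.
- by apply: ltW; apply: HN; exact: leq_maxl.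
Qed.

Lemma combination_radon f S : MB f -> tau_combination tau S ->
  L2 S /\ MB_inner S (f \- radon tau f) = 0.
Proof.
move=> mbf [n [a ->]].
have lg := L2B (MB_L2 mbf) (radon_L2 mbf).
have H (s : seq 'I_n) : L2 (fun y => \sum_(l <- s) zpow tau l (t * a l) y) /\
    MB_inner (fun y => \sum_(l <- s) zpow tau l (t * a l) y) (f \- radon tau f) = 0.
  elim: s => [|l s [IH1 IH2]].
    under eq_fun do rewrite big_nil; split; first exact: L2_0.
    exact: MB_inner0l.
  under eq_fun do rewrite big_cons; split; first by apply: L2D => //; exact: zpow_L2.
  by rewrite MB_innerDl //; [rewrite IH2 addr0; exact: inner_zpow_radon|exact: zpow_L2].
have -> : (fun x => \sum_(l < n) dotv (complexify x) tau ^+ l *: (t * a l)) =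
    fun y => \sum_(l <- index_enum 'I_n) zpow tau l (t * a l) y.
  by apply/funext => x; apply: eq_bigr => l _; rewrite zpow_tauE.
exact: H.
Qed.

Lemma radon_projection f : MB f -> is_orthogonal_projection (MB_tau tau) f (radon tau f).
Proof.
move=> mbf; split=> [|h [mh Hh]]; first exact: radon_MB_tau.
have lh := MB_L2 mh; have lg := L2B (MB_L2 mbf) (radon_L2 mbf).
apply: (inner_le0l lg) => e e0.
have [|S tS hS] := Hh (Num.sqrt e); first by rewrite sqrtr_gt0.
have [lS S0] := combination_radon mbf tS.
exists (h \- S); split; first exact: L2B.
  by rewrite MB_innerBl // S0 subr0.
apply: ltW; rewrite -[ltRHS]sqr_sqrtr ?(ltW e0) //.
by apply: nrm2_lt_of_MB_norm hS; rewrite sqrtr_gt0.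
Qed.

Lemma bargmann_radonE f : MB f -> bargmann_radon tau f = radon tau f.
Proof.
move=> mbf; have rP := radon_projection mbf.
have bP : is_orthogonal_projection (MB_tau tau) f (bargmann_radon tau f).
  by apply: (@xgetPex _ (fun=> 0) [set p | is_orthogonal_projection (MB_tau tau) f p]);
     exists (radon tau f).
by apply: orthogonal_projection_unique bP rP => // g [].
Qed.
End OrthogonalProjection.

Lemma null_vector_null (R : realType) (m : nat) (t s : 'rV[R]_m) :
  eucl_norm t = 1 -> eucl_norm s = 1 -> dotv t s = 0 ->
  dotv (null_vector t s) (null_vector t s) = 0 /\
  dotv (null_vector t s) (map_mx (@conjc R) (null_vector t s)) = 2.
Proof.
move=> t1 s1 ts.
have tt : dotv t t = 1 by rewrite -eucl_norm2 t1 expr1n.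
have ss : dotv s s = 1 by rewrite -eucl_norm2 s1 expr1n.
have i2 : 'i%C * 'i%C = -1 :> R[i] by rewrite -expr2 sqr_i.
have cE (x y : 'rV[R]_m) : (dotv x y)%:C%C = dotv (complexify x) (complexify y).
  by rewrite /dotv rmorph_sum; apply: eq_bigr => j _; rewrite rmorphM !mxE.
have vE (b : R[i]) : dotv (null_vector t s) (complexify t + b *: complexify s) =
    (dotv t t)%:C%C + b * (dotv t s)%:C%C + 'i%C * (dotv t s)%:C%C + 'i%C * b * (dotv s s)%:C%C.
  rewrite !cE /dotv !mulr_sumr -!big_split; apply: eq_bigr => j _; rewrite !mxE /=; ring.
split.
  by rewrite [X in dotv _ X]/null_vector vE tt ss ts i2 !mulr0 !addr0 mulr1 subrr.
have -> : map_mx (@conjc R) (null_vector t s) = complexify t + (- 'i%C) *: complexify s.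
  by apply/rowP => j; rewrite !mxE; apply/eqP; rewrite eq_complex /=; apply/andP; split; apply/eqP; ring.
by rewrite vE tt ss ts mulrN i2 opprK !mulr0 !addr0 mulr1.
Qed.

Theorem theorem3p11 (R : realType) (m : nat) (hm : (2 <= m)%N)
    (t s : 'rV[R]_m)
    (ht : eucl_norm t = 1) (hs : eucl_norm s = 1) (hts : dotv t s = 0)
    (f : 'rV[R]_m -> clifford R m) (hf : MB f) :
  let tau := null_vector t s in
  monogenic (bargmann_radon tau f) /\
  forall u : 'rV[R]_m,
    bargmann_radon tau f u =
      4^-1 *: (cvec tau * dagger (cvec tau)) *
      holomorphic_extension f
        ((- 2^-1 * dotv (complexify u) tau) *: vdagger tau).
Proof.
move=> tau; have [t0 t2] := null_vector_null ht hs hts.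
rewrite (bargmann_radonE t0 t2 hf); split=> [|u]; first exact: radon_monogenic.
rewrite (holomorphic_extension_unique (segal_bargmann_extension hf)) /radon.
by rewrite zdotE /vdagger scalerN mulNr scaleNr opprK.
Qed.
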